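(* Let $v\in L_3(Q)$ and $q\in L_{3/2}(Q)$ satisfy the Navier-Stokes equations $$\partial_tv+v\cdot\nabla v-\Delta v=-\nabla q,\qquad\mathrm{div}\,v=0$$ in $Q$ in the sense of distributions, and suppose that for some $r_1\in]0,1[$ and for every $a\in]0,1[$ $$v\in L_\infty\big(B\times]-1,-a^2[\;\cup\;\{r_1<|x|<1\}\times]-1,0[\big).$$ In addition, suppose that: (i) for some $\frac12\le m<1$, with $m_1=2m-1$, $$M_1=\sup_{0<r<1}\{A_{m_1}(v,r)+E_m(v,r)+D_m(q,r)\}<\infty;$$ (ii) for some $1<s_1,l_1<\infty$ with $\frac3{s_1}+\frac2{l_1}=4$, $$M_2=\sup_{0<r<1}N^{s_1,l_1}(v,r)<\infty;$$ (iii) $v\in L_{s_2,l_2}(Q)$ for some $1\le s_2\le\infty$ and $1\le l_2\le\infty$ satisfying $$\frac3{s_2}+\frac{\alpha+1}{l_2}=\alpha,\qquad\alpha=2-m .$$ If $m=\frac12$ (equivalently $m_1=0$, equivalently $\alpha=\frac32$) and $l_2=\infty$, assume additionally that $$v\in C([-\delta_1^2,0];L_2(B(\delta_1)))$$ for some number $0<\delta_1\le1$. Then $$\lim_{r\to0}\overline M^{3,3}_{2,m}(v,r)=0,\qquad\text{where}\quad\overline M^{3,3}_{2,m}(v,r)=r^{-2m}\int_{-r^{3-m}}^0\int_{B(r)}|v|^3dxdt .$$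
   Context: Notation: $B(r)\subset\mathbb R^3$ is the ball of radius $r$ centred at the origin, $Q(r)=B(r)\times]-r^2,0[$, $B=B(1)$, $Q=Q(1)$; $z=(x,t)$, $dz=dx\,dt$. Here $v$ is $\mathbb R^3$-valued and $q$ is scalar. $L_{s,l}(Q)=L_l(-1,0;L_s(B))$ is the mixed Lebesgue space with exponent $s$ in space and $l$ in time; $1/\infty=0$. Quantities: $$E_m(v,r)=\frac1{r^m}\int_{Q(r)}|\nabla v|^2dz,\qquad A_{m_1}(v,r)=\sup_{-r^2<t<0}\frac1{r^{m_1}}\int_{B(r)}|v(x,t)|^2dx,\qquad D_m(q,r)=\frac1{r^{2m}}\int_{Q(r)}|q|^{3/2}dz,$$ $$N^{s_1,l_1}(v,r)=\frac1{r^{\gamma_*l_1}}\int_{-r^2}^0\Big(\int_{B(r)}\big(|\nabla^2v|^{s_1}+|\partial_tv|^{s_1}\big)dx\Big)^{l_1/s_1}dt,\qquad\gamma_*=\gamma_*(s_1,m)=1-\Big(\frac3{2s_1}-1\Big)(1-m).$$ *)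

(* Defs.v *)
From HB Require Import structures.
From mathcomp Require Import all_boot all_order all_algebra.
From mathcomp Require Import all_classical all_reals all_analysis.
From mathcomp Require Import ess_sup_inf.

Set Implicit Arguments.
Unset Strict Implicit.
Unset Printing Implicit Defensive.

Import Order.TTheory GRing.Theory Num.Theory.
Import numFieldNormedType.Exports.

Local Open Scope classical_set_scope.
Local Open Scope ring_scope.

(* Iterated products carry both the Borel sigma-algebra and the normed-module
   structure that ['D_e f] and [differentiable] need.  The library norm on a
   product is the max norm, so Euclidean lengths are written out below. *)
Notation space R := (R * R * R)%type.
Notation spacetime R := (space R * R)%type.

(* In the library, the product of two sigma-finite measures is not found as a
   canonical sigma-finite measure. *)
Lemma sigma_finite_prod d1 d2 (T1 : measurableType d1) (T2 : measurableType d2)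
    (R : realType) (m1 : {sigma_finite_measure set T1 -> \bar R})
    (m2 : {sigma_finite_measure set T2 -> \bar R}) :
  sigma_finite setT (m1 \x m2)%E.
Proof.
have /sigma_finiteP[F [TF ndF Foo]] := sigma_finiteT m1.
have /sigma_finiteP[G [TG ndG Goo]] := sigma_finiteT m2.
exists (fun n => F n `*` G n).
  rewrite -setXTT TF TG predeqE => -[x y]; split.
    move=> [/= [n _ Fnx] [k _ Gky]]; exists (maxn n k) => //; split.
    - by move: x Fnx; exact/subsetPset/ndF/leq_maxl.
    - by move: y Gky; exact/subsetPset/ndG/leq_maxr.
  by move=> [n _ []/= ? ?]; split; exists n.
move=> k; have [? ?] := Foo k; have [? ?] := Goo k.
split; first exact: measurableX.
by rewrite product_measure1E// lte_mul_pinfty// ge0_fin_numE.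
Qed.

Definition leb2 (R : realType) := (@lebesgue_measure R \x @lebesgue_measure R)%E.
Arguments leb2 : clear implicits.
HB.instance Definition _ (R : realType) := Measure.on (leb2 R).
HB.instance Definition _ (R : realType) :=
  Measure_isSigmaFinite.Build _ _ _ (leb2 R) (sigma_finite_prod _ _).

Definition leb3 (R : realType) := (leb2 R \x @lebesgue_measure R)%E.
Arguments leb3 : clear implicits.
HB.instance Definition _ (R : realType) := Measure.on (leb3 R).
HB.instance Definition _ (R : realType) :=
  Measure_isSigmaFinite.Build _ _ _ (leb3 R) (sigma_finite_prod _ _).

Definition leb4 (R : realType) := (leb3 R \x @lebesgue_measure R)%E.
Arguments leb4 : clear implicits.
HB.instance Definition _ (R : realType) := Measure.on (leb4 R).
HB.instance Definition _ (R : realType) :=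
  Measure_isSigmaFinite.Build _ _ _ (leb4 R) (sigma_finite_prod _ _).

Definition enorm (R : realType) (I : finType) (a : I -> R) : R :=
  Num.sqrt (\sum_i a i ^+ 2).

Definition snorm (R : realType) (x : space R) : R :=
  Num.sqrt (x.1.1 ^+ 2 + x.1.2 ^+ 2 + x.2 ^+ 2).

Definition sball (R : realType) (r : R) : set (space R) :=
  [set x | snorm x < r].

Definition cylinder (R : realType) (r : R) : set (spacetime R) :=
  sball r `*` `](- r ^+ 2), 0[.

(* Vector fields are families of components.  For a field v, its derivatives
   are indexed by gv i j = d_j v_i and hv i j k = d_k d_j v_i. *)
Notation vfield R := ('I_3 -> spacetime R -> R).

Definition speed (R : realType) (v : vfield R) (z : spacetime R) : R :=
  enorm (fun i => v i z).

Definition gradnorm (R : realType) (gv : 'I_3 -> vfield R) (z : spacetime R) :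
    R :=
  enorm (fun ij : 'I_3 * 'I_3 => gv ij.1 ij.2 z).

Definition hessnorm (R : realType) (hv : 'I_3 -> 'I_3 -> vfield R)
    (z : spacetime R) : R :=
  enorm (fun a : 'I_3 * 'I_3 * 'I_3 => hv a.1.1 a.1.2 a.2 z).

Definition dir_x (R : realType) (i : 'I_3) : spacetime R :=
  ((i == 0%N :> nat)%:R, (i == 1%N :> nat)%:R, (i == 2%N :> nat)%:R, 0).

Definition dir_t (R : realType) : spacetime R := (0, 0, 0, 1).

Definition iter_derive (R : realType) (V : normedModType R) (s : seq V)
    (f : V -> R) : V -> R :=
  foldr (fun (e : V) (g : V -> R) => 'D_e g) f s.

Definition smooth (R : realType) (V : normedModType R) (f : V -> R) : Prop :=
  forall (s : seq V) (z : V), differentiable (iter_derive s f) z.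

Definition test_function (R : realType) (D : set (spacetime R))
    (phi : spacetime R -> R) : Prop :=
  smooth phi /\
  exists K : set (spacetime R),
    [/\ compact K, K `<=` D & forall z, ~ K z -> phi z = 0].

Definition loc_integrable (R : realType) (D : set (spacetime R))
    (f : spacetime R -> R) : Prop :=
  forall K : set (spacetime R), compact K -> K `<=` D ->
    (leb4 R).-integrable K (EFin \o f).

(* g is the derivative of f along e in D, in the sense of distributions *)
Definition weak_derivative (R : realType) (D : set (spacetime R))
    (e : spacetime R) (f g : spacetime R -> R) : Prop :=
  [/\ loc_integrable D f, loc_integrable D g &
    forall phi, test_function D phi ->
      \int[leb4 R]_(z in D) (f z * 'D_e phi z) =
      - \int[leb4 R]_(z in D) (g z * phi z)].

Definition laplacian (R : realType) (phi : spacetime R -> R) (z : spacetime R) :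
    R :=
  \sum_j 'D_(dir_x R j) ('D_(dir_x R j) phi) z.

(* The i-th momentum equation tested against phi.  As v is only in L_3, the
   product v . nabla v_i is the distribution sum_j d_j (v_j v_i), which is what
   it means for a divergence-free v. *)
Definition navier_stokes (R : realType) (D : set (spacetime R)) (v : vfield R)
    (q : spacetime R -> R) : Prop :=
  (forall (i : 'I_3) phi, test_function D phi ->
     \int[leb4 R]_(z in D)
       (v i z * 'D_(dir_t R) phi z
        + \sum_j (v j z * v i z * 'D_(dir_x R j) phi z)
        + v i z * laplacian phi z
        + q z * 'D_(dir_x R i) phi z) = 0) /\
  (forall phi, test_function D phi ->
     \int[leb4 R]_(z in D) (\sum_j (v j z * 'D_(dir_x R j) phi z)) = 0).

(* Elements of L_p are represented by Borel functions, and a vector-valued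
   function is in L_p when its components are.  Functions are extended by 0
   outside their domain, which does not change the norm, exponent +oo
   included. *)

Definition mem_L (R : realType) d (T : measurableType d)
    (mu : {measure set T -> \bar R}) (p : \bar R) (D : set T) (f : T -> R) :
    Prop :=
  f \_ D \in Lfun mu p.

(* f in L_l(D2; L_s(D1)) *)
Definition mem_mixed (R : realType) d1 d2 (T1 : measurableType d1)
    (T2 : measurableType d2) (mu1 : {measure set T1 -> \bar R})
    (mu2 : {measure set T2 -> \bar R}) (s l : \bar R) (D1 : set T1)
    (D2 : set T2) (f : T1 * T2 -> R) : Prop :=
  measurable_fun (D1 `*` D2) f /\
  ('N[mu2]_l[(fun t => 'N[mu1]_s[(fun x => (f (x, t))%:E) \_ D1]) \_ D2]
   < +oo)%E.

(* v in C([-d^2, 0]; L_2(B(d))): v agrees almost everywhere with a curve w of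
   L_2(B(d)) that is continuous up to both end points. *)
Definition mem_CL2 (R : realType) (d : R) (v : vfield R) : Prop :=
  exists w : R -> 'I_3 -> space R -> R,
    [/\ forall t, t \in `[(- d ^+ 2), 0] ->
          forall i, mem_L (leb3 R) 2%:E (sball d) (w t i),
        forall t0, t0 \in `[(- d ^+ 2), 0] ->
          ('N[leb3 R]_2%:E[(fun x : space R =>
             (enorm (fun i => (w t i x - w t0 i x)%R))%:E) \_ (sball d)])%E
          @[t --> within [set` `[(- d ^+ 2), 0]] (nbhs t0)] --> 0%E
      & {ae lebesgue_measure, forall t, t \in `](- d ^+ 2), 0[ ->
          {ae leb3 R, forall x, sball d x -> forall i, v i (x, t) = w t i x}}].

Definition qE (R : realType) (m : R) (gv : 'I_3 -> vfield R) (r : R) : \bar R :=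
  ((r `^ m)^-1%:E *
   \int[leb4 R]_(z in cylinder r) (gradnorm gv z ^+ 2)%:E)%E.

(* The supremum over t is essential: v is defined up to null sets. *)
Definition qA (R : realType) (m1 : R) (v : vfield R) (r : R) : \bar R :=
  ess_sup lebesgue_measure
    ((fun t : R => (r `^ m1)^-1%:E *
        \int[leb3 R]_(x in sball r) (speed v (x, t) ^+ 2)%:E)%E
      \_ `](- r ^+ 2), 0[).

Definition qD (R : realType) (m : R) (q : spacetime R -> R) (r : R) : \bar R :=
  ((r `^ (2 * m))^-1%:E *
   \int[leb4 R]_(z in cylinder r) (`|q z| `^ (3 / 2))%:E)%E.

Definition gamma_star (R : realType) (s1 m : R) : R :=
  1 - (3 / (2 * s1) - 1) * (1 - m).

Definition qN (R : realType) (m s1 l1 : R) (hv : 'I_3 -> 'I_3 -> vfield R)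
    (dtv : vfield R) (r : R) : \bar R :=
  ((r `^ (gamma_star s1 m * l1))^-1%:E *
   \int[lebesgue_measure]_(t in `](- r ^+ 2)%R, 0%R[)
     (\int[leb3 R]_(x in sball r)
        (hessnorm hv (x, t) `^ s1 + speed dtv (x, t) `^ s1)%:E)
     `^ (l1 / s1))%E.

Definition qM (R : realType) (m : R) (v : vfield R) (r : R) : \bar R :=
  ((r `^ (- (2 * m)))%:E *
   \int[leb4 R]_(z in sball r `*` `](- (r `^ (3 - m)))%R, 0%R[)
     (speed v z ^+ 3)%:E)%E.

(* Main.v *)
(* Write [f] for a component of [v], [alpha = 2 - m], [T = r ^ (3 - m)] and
   [P r] for the cube of side [2r] times ]-T, 0[.

   A weak derivative along [e] gives, for almost every [z] and [h > 0],
   |f (z)| <= |f (z + h e)| + \int_0^h |d_e f (z + s e)| ds.  Used in the three space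
   directions together with the Loomis-Whitney and Cauchy-Schwarz inequalities
   it yields a multiplicative Sobolev inequality on cubes, so that, by the
   bounds on A and E,
     X3 (r) <= C (eps + eps^-3 X2 (2r)),  X2 (r) <= C,
   for every [eps > 0], where X3, X2, X1 are the integrals of [|f|^3], [f^2],
   [|f|] over [P r] divided by [r^(2m)], [r^(m+2)], [r^4].  Since
   [f^2 <= k |f|^3 + |f| / k], it is enough to show that X1 tends to [0].

   If [l2] is finite, this is Hoelder's inequality and the absolute continuity
   of the integral of the mixed norm.  If [l2 = +oo], then [s2 = 3 / alpha], and
   the line inequality in time dominates [|f (x, t)|] by a trace [U x] at time
   [0], with [U^s2] integrable, plus the integral of [|d_t f|] over ]-T, 0[.  The
   bound on N makes the second term [O(r^(5-m)) = o(r^4)] after integration over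
   [P r]; the first one is [o(r^4)] because [U^s2] has small integral over small
   cubes. *)
From HB Require Import structures.
Require Import Defs.
From mathcomp Require Import all_boot all_order all_algebra.
From mathcomp Require Import all_classical all_reals all_analysis.
From mathcomp Require Import ess_sup_inf measurable_realfun ring lra.
Import Order.TTheory GRing.Theory Num.Theory.
Import numFieldNormedType.Exports.
Set Implicit Arguments.
Unset Strict Implicit.
Unset Printing Implicit Defensive.
Local Open Scope classical_set_scope.
Local Open Scope ring_scope.

(* The library measures live on [measurableTypeR R], whose display differs from
   the one inferred for [R]. *)
Notation mspace R := (measurableTypeR R * measurableTypeR R * measurableTypeR R)%type.
Notation mspacetime R := (mspace R * measurableTypeR R)%type.

(** * Smooth bump functions *)

(** The weights of X1, X2, X3 are those of a function of size r^-alpha: [P r] has measure of order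
    r^(6-m), and 6-m-alpha = 4, 6-m-2 alpha = m+2, 6-m-3 alpha = 2m. The mixed norm of exponents
    [s2], [l2] is invariant under the same scaling, time being scaled like r^(alpha+1), so Hoelder's
    inequality alone only bounds X1. Smallness has to come from the absolute continuity of an
    integral, over short times or over small cubes. The time derivative is better than scale
    invariant by the factor r^(1-m), which tends to 0 as m < 1; the same condition places ]-r^(3-m),
    0[ inside ]-r^2, 0[, where the bounds are given.

    Functions are known up to null sets and weak derivatives only through test functions.
    Inequalities along lines are therefore obtained from smooth approximations of indicators of
    boxes, and from the fact that boxes determine a measure.

    Splittings with a free parameter, such as u <= lam + lam^(1-p) u^p or 2s <= k a + b / k when s^2
    <= a b, take the place of sharper inequalities: being linear they can be integrated, and they
    make sense for infinite values. *)

Section bump_atoms.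
Variable R : realType.
Implicit Types (x y : R) (k : nat).

(** The exponent [k] makes the family stable under differentiation: the derivative of [ek k] is a
    combination of [ek k.+1] and [ek k.+2], at 0 included. The cut-off itself is [ek 0]. *)
Definition ek k x : R := if 0 < x then x^-1 ^+ k * expR (- x^-1) else 0.

Lemma ek_ge0 k x : 0 <= ek k x.
Proof.
by rewrite /ek; case: ifP => // x0; rewrite mulr_ge0 ?expR_ge0// exprn_ge0// invr_ge0 ltW.
Qed.

Lemma exprn_mul_expRN_le k y : 0 <= y -> y ^+ k * expR (- y) <= k.+1`!%:R.
Proof.
move=> y0; rewrite expRN ler_pdivrMr ?expR_gt0//.
case: k => [|k].
  by rewrite expr0 mul1r -[leLHS]addr0; apply: le_trans (expR_ge1Dx y); rewrite lerD2l.
have := expR_ge1Dxn k y0.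
rewrite addrC -lerBrDr ler_pdivrMr ?ltr0n ?fact_gt0// => h.
apply: (le_trans h); rewrite mulrC; apply: ler_pM => //.
- by rewrite subr_ge0 (le_trans _ (expR_ge1Dx y))// lerDl.
- by rewrite ler_nat; exact: leq_pmull.
- by rewrite gerBl.
Qed.

Lemma ek_le k x : ek k x <= k.+1`!%:R.
Proof.
rewrite /ek; case: ifPn => // x0.
by apply: exprn_mul_expRN_le; rewrite invr_ge0 ltW.
Qed.

Lemma ekS k x : 0 < x -> ek k x = x * ek k.+1 x.
Proof. by move=> x0; rewrite /ek x0 exprS !mulrA divff ?mul1r// gt_eqF. Qed.

(** Two powers of x are traded for an increase of the index by 2. A quadratic bound is what makes
    the difference quotient at 0 vanish. *)
Lemma ek_le_sqr k x : ek k x <= k.+3`!%:R * x ^+ 2.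
Proof.
have [x0|x0] := ltP 0 x; last first.
  by rewrite /ek ltNge x0/= mulr_ge0// sqr_ge0.
rewrite (ekS _ x0) (ekS _ x0) mulrA -expr2 mulrC ler_wpM2r ?sqr_ge0//.
exact: ek_le.
Qed.

Lemma is_derive_ek k x :
  is_derive x 1 (ek k) (- k%:R * ek k.+1 x + ek k.+2 x).
Proof.
have [x0|x0|<-] := ltgtP 0 x.
- apply: (@near_eq_is_derive _ _ _ (fun y => y^-1 ^+ k * expR (- y^-1))).
    have : \forall y \near x, 0 < y by exact: lt_nbhsr.
    by apply: filterS => y y0; rewrite /ek y0.
  have xneq0 : x != 0 by rewrite gt_eqF.
  have dV : is_derive x 1 (fun y : R => y^-1) (- x ^- 2 *: 1).
    exact: (@is_deriveV _ id).
  have dE : is_derive x 1 (expR \o (fun y : R => - y^-1)) (expR (- x^-1) * - (- x ^- 2 *: 1)).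
    by apply: is_derive1_comp.
  have -> : (fun y => y^-1 ^+ k * expR (- y^-1)) =
      (fun y : R => y^-1) ^+ k * (expR \o (fun y : R => - y^-1)).
    by apply/funext => y; rewrite mulrfctE exprfctE.
  apply: (is_derive_eq (is_deriveM (is_deriveX k dV) dE)); rewrite /ek x0 /= /GRing.scale /= fctE.
  case: k => [|k]; first by rewrite !expr0 /= !expr1 exprVn; field.
  by rewrite /= !exprS -!natr1 !exprVn; field; rewrite expf_neq0.
- apply: (@near_eq_is_derive _ _ _ (cst 0)).
    have : \forall y \near x, y < 0 by exact: lt_nbhsl.
    by apply: filterS => y y0; rewrite /ek ltNge ltW.
  rewrite /ek !ltNge ltW//= mulr0 addr0; exact: is_derive_cst.
(* At 0 both one-sided derivatives vanish: by [ek_le_sqr] the quotient is at most a constant times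
   |h|. *)
- have ek0 : ek k 0 = 0 by rewrite /ek ltxx.
  have lim0 : h^-1 *: ((ek k \o shift 0) (h *: 1) - ek k 0) @[h --> 0^'] --> (0 : R).
    have lin0 : (k.+3`!%:R * `|h|) @[h --> (0:R)^'] --> k.+3`!%:R * `|0:R|.
      apply: cvgM; first exact: cvg_cst.
      by apply: cvg_norm; apply: cvg_within.
    rewrite normr0 mulr0 in lin0.
    apply/norm_cvg0P; apply: (squeeze_cvgr _ (cvg_cst 0) lin0).
    near=> h; rewrite normr_ge0/= ek0 subr0 /= addr0 /GRing.scale /= mulr1.
    have h0 : h != 0 by near: h; exact: nbhs_dnbhs_neq.
    rewrite normrM normrV ?unitfE// ler_pdivrMl ?normr_gt0//.
    rewrite ger0_norm ?ek_ge0//; apply: (le_trans (ek_le_sqr k h)).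
    have -> : h ^+ 2 = `|h| * `|h| by rewrite -normrM -expr2 ger0_norm ?sqr_ge0.
    by rewrite mulrCA.
  apply: DeriveDef; first by apply/cvg_ex; exists 0.
  rewrite /ek ltxx mulr0 addr0; exact: cvg_lim.
Unshelve. all: by end_near.
Qed.

Lemma measurable_ek k : measurable_fun setT (ek k).
Proof.
have dk x : derivable (ek k) x 1 by have [] := is_derive_ek k x.
apply: continuous_measurable_fun => x.
by apply: differentiable_continuous; apply/derivable1_diffP.
Qed.

Lemma ek0_gt0 x : (0 < ek 0 x) = (0 < x).
Proof. by rewrite /ek; case: ifPn => x0; rewrite ?ltxx// expr0 mul1r expR_gt0. Qed.

Lemma ek0_le1 x : ek 0 x <= 1. Proof. exact: (ek_le 0). Qed.
End bump_atoms.

(** * Coordinates, boxes and the test functions attached to them *)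

Section smooth_bumps.
Variable R : realType.
Local Notation V := (spacetime R).
Implicit Types (a b z e : V).

(** Indexing the coordinates of the nested pair by a finite type lets boxes, products of atoms and
    translations be treated coordinate by coordinate. *)
Definition pr (i : 'I_4) z : R := nth 0 [:: z.1.1.1; z.1.1.2; z.1.2; z.2] i.

Lemma pr_linear i : linear (pr i : V -> R^o).
Proof.
move=> k z e; rewrite /pr; case: i => [[|[|[|[|n]]]]] //=.
Qed.
HB.instance Definition _ i := @GRing.isLinear.Build R V R^o _ (pr i) (pr_linear i).

Lemma prD i (z e : V) : pr i (z + e) = pr i z + pr i e.
Proof. exact: (linearD (pr i)). Qed.

Lemma prB i (z e : V) : pr i (z - e) = pr i z - pr i e.
Proof. exact: (linearB (pr i)). Qed.

Lemma prZ i k (z : V) : pr i (k *: z) = k * pr i z.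
Proof. by rewrite /pr; case: i => [[|[|[|[|n]]]]]. Qed.

Lemma pr_continuous i : continuous (pr i).
Proof.
have c1 : continuous (fun z : V => z.1) by move=> z; exact: cvg_fst.
have c11 : continuous (fun z : V => z.1.1).
  by move=> z; apply: (@continuous_comp _ _ _ (fun z : V => z.1) fst); [exact: c1|exact: cvg_fst].
rewrite /pr; case: i => [[|[|[|[|n]]]]] //= _ z.
- by apply: (@continuous_comp _ _ _ (fun z : V => z.1.1) fst); [exact: c11|exact: cvg_fst].
- by apply: (@continuous_comp _ _ _ (fun z : V => z.1.1) snd); [exact: c11|exact: cvg_snd].
- by apply: (@continuous_comp _ _ _ (fun z : V => z.1) snd); [exact: c1|exact: cvg_snd].
- exact: cvg_snd.
Qed.

Lemma measurable_pr i : measurable_fun setT (pr i : mspacetime R -> R).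
Proof.
rewrite /pr; case: i => [[|[|[|[|n]]]]] //= _.
- exact: (measurableT_comp measurable_fst (measurableT_comp measurable_fst measurable_fst)).
- exact: (measurableT_comp measurable_snd (measurableT_comp measurable_fst measurable_fst)).
- exact: (measurableT_comp measurable_snd measurable_fst).
- exact: measurable_snd.
Qed.

Lemma differentiable_pr i z : differentiable (pr i : V -> R) z.
Proof. exact: (@linear_differentiable _ _ _ (pr i) z (@pr_continuous i)). Qed.

Lemma derive_pr i z e : 'D_e (pr i : V -> R) z = pr i e.
Proof.
rewrite deriveE; last exact: differentiable_pr.
by rewrite (@diff_lin _ _ _ (pr i) z (@pr_continuous i)).
Qed.

(* The algebra generated by the functions [ek k (s * z_i + c)] is stable under
   directional derivatives, which makes smoothness a matter of induction. *)
Inductive bumpalg : (V -> R) -> Prop :=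
| bumpalg_cst c : bumpalg (fun=> c)
| bumpalg_atom k i s c : bumpalg (fun z => ek k (s * pr i z + c))
| bumpalg_add f g : bumpalg f -> bumpalg g -> bumpalg (fun z => f z + g z)
| bumpalg_mul f g : bumpalg f -> bumpalg g -> bumpalg (fun z => f z * g z).

Lemma bumpalg_diff f z : bumpalg f -> differentiable f z.
Proof.
move=> hf; elim: hf z => {f} [c|k i s c|f g _ df _ dg|f g _ df _ dg] z.
- exact: differentiable_cst.
- apply: (@differentiable_comp _ _ _ _ (fun z => s * pr i z + c) (ek k)).
    apply: differentiableD; last exact: differentiable_cst.
    apply: differentiableM; first exact: differentiable_cst.
    exact: differentiable_pr.
  by apply/derivable1_diffP; have [] := is_derive_ek k (s * pr i z + c).
- exact: differentiableD.
- exact: differentiableM.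
Qed.

Lemma bumpalg_derive f e : bumpalg f -> bumpalg ('D_e f).
Proof.
elim=> {f} [c|k i s c|f g hf df hg dg|f g hf df hg dg].
- have -> : 'D_e (fun=> c : R) = fun _ : V => 0.
    by apply/funext => z; rewrite derive_cst.
  exact: bumpalg_cst.
- have -> : 'D_e (fun z => ek k (s * pr i z + c)) =
    fun z => (s * pr i e) * (- k%:R * ek k.+1 (s * pr i z + c) + ek k.+2 (s * pr i z + c)).
    apply/funext => z.
    have dl : differentiable (fun z : V => s * pr i z + c) z.
      apply: differentiableD; last exact: differentiable_cst.
      apply: differentiableM; first exact: differentiable_cst.
      exact: differentiable_pr.
    have dek := is_derive_ek k (s * pr i z + c).
    have dd : differentiable (ek k) (s * pr i z + c).
      by apply/derivable1_diffP; case: dek.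
    rewrite deriveE; last exact: (@differentiable_comp _ _ _ _ (fun z => s * pr i z + c) (ek k)).
    rewrite (@diff_comp _ _ _ _ (fun z => s * pr i z + c) (ek k))//= -[in X in 'd _ _ X]deriveE//.
    have -> : 'D_e (fun z : V => s * pr i z + c) z = s * pr i e.
      rewrite (@deriveD _ _ _ (fun z => s * pr i z) (cst c)); last 2 first.
      + apply: diff_derivable; apply: differentiableM; first exact: differentiable_cst.
        exact: differentiable_pr.
      + exact: derivable_cst.
      rewrite derive_cst addr0 (@deriveMl _ _ (pr i) s) ?derive_pr//.
      exact/diff_derivable/differentiable_pr.
    rewrite -[X in 'd _ _ X](mulr1 (s * pr i e)) -[_ * 1]/((s * pr i e) *: (1 : R)) linearZ/=.
    rewrite -deriveE//; case: dek => _ ->; by [].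
  apply: bumpalg_mul; first exact: bumpalg_cst.
  apply: bumpalg_add; last exact: bumpalg_atom.
  apply: bumpalg_mul; first exact: bumpalg_cst.
  exact: bumpalg_atom.
- have -> : 'D_e (fun z => f z + g z) = fun z => 'D_e f z + 'D_e g z.
    by apply/funext => z; rewrite (@deriveD _ _ _ f g)//; apply: diff_derivable; exact: bumpalg_diff.
  exact: bumpalg_add.
- have -> : 'D_e (fun z => f z * g z) = fun z => f z * 'D_e g z + g z * 'D_e f z.
    by apply/funext => z; rewrite (@deriveM _ _ f g)//; apply: diff_derivable; exact: bumpalg_diff.
  by apply: bumpalg_add; apply: bumpalg_mul.
Qed.

Lemma bumpalg_smooth f : bumpalg f -> smooth f.
Proof.
move=> hf s z; suff : bumpalg (iter_derive s f) by exact: bumpalg_diff.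
by elim: s => //= e s; exact: bumpalg_derive.
Qed.

Lemma bumpalg_measurable f : bumpalg f -> measurable_fun setT (f : mspacetime R -> R).
Proof.
elim=> {f} [c|k i s c|f g _ mf _ mg|f g _ mf _ mg].
- exact: measurable_cst.
- apply: measurableT_comp; first exact: measurable_ek.
  apply: measurable_funD; last exact: measurable_cst.
  by apply: measurable_funM; [exact: measurable_cst|exact: measurable_pr].
- exact: measurable_funD.
- exact: measurable_funM.
Qed.

Lemma bumpalg_bounded f : bumpalg f -> exists M, 0 <= M /\ forall z, `|f z| <= M.
Proof.
elim=> {f} [c|k i s c|f g _ [M [M0 fM]] _ [N [N0 gN]]|f g _ [M [M0 fM]] _ [N [N0 gN]]].
- by exists `|c|.
- by exists (k.+1`!%:R); split=> // z; rewrite ger0_norm ?ek_ge0// ek_le.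
- exists (M + N); split; first exact: addr_ge0.
  by move=> z; apply: (le_trans (ler_normD _ _)); exact: lerD.
- exists (M * N); split; first exact: mulr_ge0.
  by move=> z; rewrite normrM; apply: ler_pM.
Qed.

Lemma bumpalg_exp f n : bumpalg f -> bumpalg (fun z => f z ^+ n).
Proof.
move=> hf; elim: n => [|n ih].
  have -> : (fun z => f z ^+ 0) = fun=> 1 by apply/funext => z; rewrite expr0.
  exact: bumpalg_cst.
have -> : (fun z => f z ^+ n.+1) = fun z => f z * f z ^+ n by apply/funext => z; rewrite exprS.
exact: bumpalg_mul.
Qed.

(** Positive exactly on the open box and at most 1, since [ek 0] is positive exactly on the positive
    half line and bounded by 1. *)
Definition boxfun a b z : R :=
  \prod_(i < 4) (ek 0 (pr i z - pr i a) * ek 0 (pr i b - pr i z)).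

Definition obox a b : set (mspacetime R) := [set z | forall i, pr i a < pr i z < pr i b].

Definition cbox a b : set (mspacetime R) := [set z | forall i, pr i a <= pr i z <= pr i b].

Lemma boxfun_bumpalg a b : bumpalg (boxfun a b).
Proof.
suff H n (F : 'I_n -> V -> R) : (forall i, bumpalg (F i)) -> bumpalg (fun z => \prod_(i < n) F i z).
  apply: H => i; apply: bumpalg_mul.
    have -> : (fun z => ek 0 (pr i z - pr i a)) = fun z => ek 0 (1 * pr i z + - pr i a).
      by apply/funext => z; rewrite mul1r.
    exact: bumpalg_atom.
  have -> : (fun z => ek 0 (pr i b - pr i z)) = fun z => ek 0 (- 1 * pr i z + pr i b).
    by apply/funext => z; rewrite mulN1r addrC.
  exact: bumpalg_atom.
elim: n F => [|n ih] F hF.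
  rewrite (_ : (fun z => _) = fun=> 1); first exact: bumpalg_cst.
  by apply/funext => z; rewrite big_ord0.
rewrite (_ : (fun z => _) = fun z => F ord0 z * \prod_(i < n) F (lift ord0 i) z).
  by apply: bumpalg_mul => //; apply: (ih (fun i => F (lift ord0 i))).
by apply/funext => z; rewrite big_ord_recl.
Qed.

Lemma boxfun_ge0 a b z : 0 <= boxfun a b z.
Proof. by apply: prodr_ge0 => i _; rewrite mulr_ge0// ek_ge0. Qed.

Lemma boxfun_le1 a b z : boxfun a b z <= 1.
Proof.
by apply: prodr_ile1 => i _; rewrite mulr_ge0 ?ek_ge0//= mulr_ile1 ?ek_ge0 ?ek0_le1.
Qed.

Lemma boxfun_gt0 a b z : obox a b z -> 0 < boxfun a b z.
Proof.
by move=> h; apply: prodr_gt0 => i _; have /andP[? ?] := h i; rewrite mulr_gt0// ek0_gt0 subr_gt0.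
Qed.

Lemma boxfun_out a b z : ~ obox a b z -> boxfun a b z = 0.
Proof.
move=> /existsNP[i /negP]; rewrite negb_and => h; apply/eqP/prodf_eq0; exists i => //.
rewrite mulf_eq0; case/orP: h; rewrite -subr_gt0 -ek0_gt0 -leNgt => h; apply/orP; [left|right];
  by rewrite eq_le h ek_ge0.
Qed.

(** As n grows, (1 - [boxfun])^n tends to 0 inside the box and stays 1 outside. This approximates
    the indicator of the box with a fixed support, a bound uniform in n, and without leaving
    [bumpalg]. *)
Definition bump n a b z : R := 1 - (1 - boxfun a b z) ^+ n.

Lemma bump_bumpalg n a b : bumpalg (bump n a b).
Proof.
rewrite (_ : bump n a b = fun z => 1 + (- 1) * (1 + (- 1) * boxfun a b z) ^+ n).
  apply: bumpalg_add; first exact: bumpalg_cst.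
  apply: bumpalg_mul; first exact: bumpalg_cst.
  apply: bumpalg_exp; apply: bumpalg_add; first exact: bumpalg_cst.
  by apply: bumpalg_mul; [exact: bumpalg_cst|exact: boxfun_bumpalg].
by apply/funext => z; rewrite /bump !mulN1r.
Qed.

Lemma bump_out n a b z : ~ obox a b z -> bump n a b z = 0.
Proof. by move=> h; rewrite /bump boxfun_out// subr0 expr1n subrr. Qed.

Lemma bump_norm_le1 n a b z : `|bump n a b z| <= 1.
Proof.
have h0 : 0 <= 1 - boxfun a b z by rewrite subr_ge0 boxfun_le1.
have h1 : 1 - boxfun a b z <= 1 by rewrite gerBl boxfun_ge0.
rewrite /bump ger0_norm; first by rewrite gerBl exprn_ge0.
by rewrite subr_ge0 exprn_ile1.
Qed.

Lemma bump_cvg a b z : bump n a b z @[n --> \oo] --> (\1_(obox a b) z : R).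
Proof.
rewrite indicE; case: (pselect (obox a b z)) => h.
  rewrite mem_set//= -[X in _ --> X]subr0.
  apply: cvgB; first exact: cvg_cst.
  apply: cvg_expr; rewrite ger0_norm ?subr_ge0 ?boxfun_le1//.
  by rewrite gtrBl boxfun_gt0.
rewrite memNset//=.
rewrite (_ : (fun n => _) = fun=> 0); first exact: cvg_cst.
by apply/funext => n; rewrite bump_out.
Qed.

Lemma cbox_compact a b : compact (cbox a b).
Proof.
rewrite (_ : cbox a b = ((`[a.1.1.1, b.1.1.1]%classic `*` `[a.1.1.2, b.1.1.2]%classic)
   `*` `[a.1.2, b.1.2]%classic) `*` `[a.2, b.2]%classic).
  by repeat apply: compact_setX; exact: segment_compact.
apply/seteqP; split=> z /=; rewrite !in_itv/=.
  move=> h; have := (h (inord 0), h (inord 1), h (inord 2), h (inord 3)).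
  by rewrite /pr !inordK//= => -[[[-> ->] ->] ->].
move=> [[[h0 h1] h2] h3] [[|[|[|[|n]]]]] //=.
Qed.

Lemma obox_cbox a b : obox a b `<=` cbox a b.
Proof. by move=> z h i; have /andP[? ?] := h i; rewrite !ltW. Qed.

Lemma bump_test n a b D : cbox a b `<=` D -> test_function D (bump n a b).
Proof.
move=> KD; split; first exact/bumpalg_smooth/bump_bumpalg.
exists (cbox a b); split=> //; first exact: cbox_compact.
by move=> z nz; apply: bump_out => /obox_cbox.
Qed.

Lemma bump_shift n a b e : (fun z => bump n a b (z - e)) = bump n (a + e) (b + e).
Proof.
apply/funext => z; rewrite /bump /boxfun; congr (1 - (1 - _) ^+ n).
apply: eq_bigr => i _; rewrite prB !prD.
by congr (ek 0 _ * ek 0 _); rewrite opprD ?addrA ?opprK addrAC.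
Qed.

Lemma bump_derive_out n a b e z : ~ cbox a b z -> 'D_e (bump n a b) z = 0.
Proof.
move=> nz; rewrite (@near_eq_derive _ _ _ _ (cst 0)) ?derive_cst//.
have oC : open (~` cbox a b).
  by apply: closed_openC; apply: compact_closed; [exact: norm_hausdorff|exact: cbox_compact].
have : nbhs z (~` cbox a b) by exact: open_nbhs_nbhs.
by apply: filterS => y ny; apply: bump_out => /obox_cbox.
Qed.
End smooth_bumps.

(** * Weak derivatives and translations *)

Section measure_preserving.
Local Open Scope ereal_scope.

Definition preserves d (T : measurableType d) (R : realType)
    (mu : set T -> \bar R) (phi : T -> T) :=
  measurable_fun setT phi /\ forall A, measurable A -> mu (phi @^-1` A) = mu A.

(** The image of the product measure agrees with it on measurable rectangles, and these determine
    it. Translations of spacetime thus reduce to translations of the line. *)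
Lemma preserves_prod d1 d2 (T1 : measurableType d1) (T2 : measurableType d2)
    (R : realType) (m1 : {sigma_finite_measure set T1 -> \bar R})
    (m2 : {sigma_finite_measure set T2 -> \bar R}) (f1 : T1 -> T1) (f2 : T2 -> T2) :
  preserves m1 f1 -> preserves m2 f2 ->
  preserves (m1 \x m2) (fun z => (f1 z.1, f2 z.2)).
Proof.
move=> [mf1 h1] [mf2 h2].
have mf : measurable_fun setT (fun z : T1 * T2 => (f1 z.1, f2 z.2)).
  apply: measurable_fun_pair.
  - exact: measurableT_comp measurable_fst.
  - exact: measurableT_comp measurable_snd.
split=> // X mX; apply/esym.
apply: (@product_measure_unique _ _ _ _ _ m1 m2 (pushforward (m1 \x m2) (fun z : T1 * T2 => (f1 z.1, f2 z.2)))) => //.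
move=> A B mA mB; transitivity ((m1 \x m2) ((f1 @^-1` A) `*` (f2 @^-1` B))); first by [].
rewrite product_measure1E//; last 2 first.
- by rewrite -[X in measurable X]setTI; exact: mf1.
- by rewrite -[X in measurable X]setTI; exact: mf2.
by congr (_ * _); [exact: h1|exact: h2].
Qed.

Lemma ge0_integral_preserves d (T : measurableType d) (R : realType)
    (mu : {measure set T -> \bar R}) (phi : T -> T) (f : T -> \bar R) :
  preserves mu phi -> measurable_fun setT f -> (forall x, 0 <= f x) ->
  \int[mu]_x f (phi x) = \int[mu]_x f x.
Proof.
move=> [mphi h] mf f0; rewrite -[LHS]/(\int[mu]_(x in phi @^-1` setT) (f \o phi) x).
rewrite -(@ge0_integral_pushforward _ _ _ _ _ phi mphi mu setT f)//.
by apply: eq_measure_integral => A mA _; exact: h.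
Qed.

Lemma integrable_preserves d (T : measurableType d) (R : realType)
    (mu : {measure set T -> \bar R}) (phi : T -> T) (f : T -> \bar R) :
  preserves mu phi -> mu.-integrable setT f -> mu.-integrable setT (f \o phi).
Proof.
move=> hphi /integrableP[mf fi]; apply/integrableP; split.
  by apply: measurableT_comp => //; case: hphi.
rewrite (@ge0_integral_preserves _ _ _ _ phi (fun x => `|f x|))//.
exact: measurableT_comp.
Qed.

Lemma integral_preserves d (T : measurableType d) (R : realType)
    (mu : {measure set T -> \bar R}) (phi : T -> T) (f : T -> \bar R) :
  preserves mu phi -> mu.-integrable setT f ->
  \int[mu]_x f (phi x) = \int[mu]_x f x.
Proof.
move=> hphi fi; have [mphi h] := hphi.
rewrite -[LHS]/(\int[mu]_(x in phi @^-1` setT) (f \o phi) x).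
rewrite -(@integral_pushforward _ _ _ _ _ phi mphi mu setT f)//.
- by apply: eq_measure_integral => A mA _; exact: h.
- exact: (measurable_int _ fi).
- exact: integrable_preserves.
Qed.

Lemma preserves_lebesgue_shift (R : realType) (c : R) :
  preserves (@lebesgue_measure R) (fun x => (x + c)%R).
Proof.
have mc : measurable_fun setT (fun x : measurableTypeR R => (x + c)%R : measurableTypeR R).
  exact: measurable_funD.
split=> // A mA; apply/esym.
apply: (@lebesgue_measure_unique R (pushforward (@lebesgue_measure R)
  (fun x : measurableTypeR R => (x + c)%R : measurableTypeR R))) => //= _ [[a b]] _ <-.
rewrite /pushforward (_ : _ @^-1` _ = `](a - c)%R, (b - c)%R]%classic); last first.
  by apply/seteqP; split=> x /=; rewrite !in_itv/= ltrBlDr lerBrDr.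
rewrite !lebesgue_measure_itv/= !lte_fin ltrD2r.
by case: ifPn => // _; rewrite -!EFinD; congr EFin; ring.
Qed.

Lemma preserves_leb4_shift (R : realType) (e : spacetime R) :
  preserves (leb4 R) (fun z => (z + e)%R).
Proof.
have h := @preserves_lebesgue_shift R.
have h2 := @preserves_prod _ _ _ _ R lebesgue_measure lebesgue_measure _ _ (h e.1.1.1) (h e.1.1.2).
have h3 := @preserves_prod _ _ _ _ R (leb2 R) lebesgue_measure _ _ h2 (h e.1.2).
exact: (@preserves_prod _ _ _ _ R (leb3 R) lebesgue_measure _ _ h3 (h e.2)).
Qed.

Lemma measurable_shift (R : realType) (e : spacetime R) :
  measurable_fun setT (fun z : mspacetime R => ((z : spacetime R) + e)%R : mspacetime R).
Proof. by have [] := preserves_leb4_shift e. Qed.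

End measure_preserving.

(** * Open boxes as a generating pi-system *)

Section boxes.
Variable R : realType.
Local Notation V := (spacetime R).

Definition mkv (f : 'I_4 -> R) : V := (f (inord 0), f (inord 1), f (inord 2), f (inord 3)).

Lemma pr_mkv f i : pr i (mkv f) = f i.
Proof.
case: i => [[|[|[|[|n]]]]] p //=; rewrite /pr/mkv/=; congr f; apply/val_inj;
  by rewrite /= inordK.
Qed.

Lemma prP (z e : V) : (forall i, pr i z = pr i e) -> z = e.
Proof.
move=> h; have := (h (inord 0), h (inord 1), h (inord 2), h (inord 3)).
rewrite /pr !inordK//=; case: z {h} => [[[? ?] ?] ?]; case: e => [[[? ?] ?] ?] /=.
by move=> [[[-> ->] ->] ->].
Qed.

Lemma oboxI (a b c d : V) : obox a b `&` obox c d =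
  obox (mkv (fun i => Num.max (pr i a) (pr i c))) (mkv (fun i => Num.min (pr i b) (pr i d))).
Proof.
apply/seteqP; split=> z /=.
  move=> [h1 h2] i; rewrite !pr_mkv gt_max lt_min.
  by have /andP[-> ->] := h1 i; have /andP[-> ->] := h2 i.
move=> h; split=> i; have := h i; rewrite !pr_mkv gt_max lt_min;
  by move=> /andP[/andP[? ?] /andP[? ?]]; apply/andP.
Qed.

Lemma measurable_obox (a b : V) : measurable (obox a b).
Proof.
rewrite (_ : obox a b = \bigcap_(i in [set: 'I_4]) (pr i @^-1` `]pr i a, pr i b[%classic)).
  apply: fin_bigcap_measurable => [|i _]; first exact: finite_finset.
  by rewrite -[X in measurable X]setTI; exact: measurable_pr.
apply/seteqP; split=> z /= h i; first by move=> _; rewrite /= in_itv/=.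
by have := h i I; rewrite /= in_itv.
Qed.

Lemma measurable_cbox (a b : V) : measurable (cbox a b).
Proof.
rewrite (_ : cbox a b = \bigcap_(i in [set: 'I_4]) (pr i @^-1` `[pr i a, pr i b]%classic)).
  apply: fin_bigcap_measurable => [|i _]; first exact: finite_finset.
  by rewrite -[X in measurable X]setTI; exact: measurable_pr.
apply/seteqP; split=> z /= h i; first by move=> _; rewrite /= in_itv/=.
by have := h i I; rewrite /= in_itv.
Qed.

Definition boxes : set (set (mspacetime R)) := [set A | A = setT \/ exists a b, A = obox a b].

Lemma boxes_setI : setI_closed boxes.
Proof.
move=> A B [->|[a [b ->]]] [->|[c [d ->]]].
- by left; rewrite setIT.
- by right; exists c, d; rewrite setTI.
- by right; exists a, b; rewrite setIT.
- by right; rewrite oboxI; eexists; eexists.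
Qed.

(** A half space c < z_i is a countable union of open boxes, so each coordinate, hence the identity
    map, is measurable for the generated sigma-algebra. *)
Lemma measurable_boxes (A : set (mspacetime R)) : measurable A -> <<s boxes >> A.
Proof.
move=> mA.
have mp i : measurable_fun setT (pr i : g_sigma_algebraType boxes -> R).
  apply: (measurability _ (RGenOInfty.measurableE R)) => _ [_ [c ->] <-].
  rewrite setTI.
  rewrite (_ : _ @^-1` _ = \bigcup_n obox
      (mkv (fun j => if j == i then c else - n%:R)) (mkv (fun=> n%:R))).
    apply: bigcup_measurable => n _; apply: sub_sigma_algebra; right.
    by eexists; eexists.
  apply/seteqP; split=> z /=; rewrite in_itv/= andbT.
    (* [M] dominates every coordinate of z in absolute value, so the box of half side the next
       integer, truncated at c in direction i, contains z. *)
    move=> cz; pose M := \sum_(j < 4) `|pr j z|.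
    exists (Num.truncn M).+1 => // j; rewrite !pr_mkv.
    have zM : `|pr j z| < (Num.truncn M).+1%:R.
      apply: le_lt_trans (truncnS_gt M); rewrite /M (bigD1 j)//= lerDl.
      exact: sumr_ge0.
    move: zM; rewrite ltr_norml => /andP[h1 h2].
    by case: eqVneq => [ji|_]; apply/andP; split; rewrite // ?ji.
  by move=> [n _ /(_ i)]; rewrite !pr_mkv eqxx => /andP[].
have mid : measurable_fun setT (id : g_sigma_algebraType boxes -> mspacetime R).
  apply/measurable_fun_pairP; split; last exact: (mp (inord 3)) || (by have := mp (@Ordinal 4 3 isT)).
  apply/measurable_fun_pairP; split; last by have := mp (@Ordinal 4 2 isT).
  apply/measurable_fun_pairP; split; first by have := mp (@Ordinal 4 0 isT).
  by have := mp (@Ordinal 4 1 isT).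
by have := mid measurableT A mA; rewrite setTI.
Qed.

Local Open Scope ereal_scope.

(** The measurable sets over which [H], extended by 0, has zero integral form a Dynkin system. It
    contains the boxes, which are stable under intersection, hence every measurable set. *)
Lemma null_boxes_ae (H : mspacetime R -> \bar R) (a b : V) :
  (leb4 R).-integrable (obox a b) H ->
  (forall c d, (forall i, pr i a <= pr i c)%R -> (forall i, pr i d <= pr i b)%R ->
    \int[leb4 R]_(z in obox c d) H z = 0) ->
  {ae leb4 R, forall z, obox a b z -> H z = 0}.
Proof.
move=> Hi H0; have mab := measurable_obox a b.
pose K := H \_ (obox a b).
have Ki : (leb4 R).-integrable setT K by exact: ((integrable_mkcond H mab).1 Hi).
have KE A : measurable A -> \int[leb4 R]_(z in A) K z = \int[leb4 R]_(z in A `&` obox a b) H z.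
  by move=> mA; rewrite /K -integral_mkcondr.
have KA A : measurable A -> (leb4 R).-integrable A K by move=> mA; apply: integrableS Ki.
pose P := [set A : set (mspacetime R) | measurable A /\ \int[leb4 R]_(z in A) K z = 0].
have PT : \int[leb4 R]_z K z = 0 by rewrite KE// setTI H0.
have dP : dynkin P.
  split.
  - by split.
  - move=> A [mA A0]; have mC := measurableC mA; split=> //.
    move: PT; rewrite -{1}(setvU A) integral_setU//; last 2 first.
    + by apply: measurable_funS (measurable_int _ Ki).
    + by rewrite disj_set_sym; apply/disj_setPS; rewrite setICr.
    by rewrite A0 adde0.
  - move=> F tF PF; have mF n : measurable (F n) by case: (PF n).
    split; first exact: bigcup_measurable.
    rewrite integral_bigcup//; last by apply: KA; exact: bigcup_measurable.
    by apply: eseries0 => n _ _; case: (PF n).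
have bP : boxes `<=` P.
  move=> A [->|[c [d ->]]]; first by split.
  split; first exact: measurable_obox.
  rewrite KE; last exact: measurable_obox.
  by rewrite oboxI; apply: H0 => i; rewrite pr_mkv ?le_max ?ge_min lexx orbT.
have mP A : measurable A -> P A.
  move=> /measurable_boxes; rewrite -setI_closed_g_dynkin_g_sigma_algebra; last exact: boxes_setI.
  by move=> /(_ P); apply.
apply: (@integral_ae_eq _ _ _ (leb4 R) (obox a b) mab (cst 0) H) => //.
move=> E Eab mE; rewrite integral0; have [_] := mP _ mE.
by rewrite KE// setIidl.
Qed.

End boxes.

Section directional_shift.
Variable R : realType.
Local Notation V := (spacetime R).
Local Notation mV := (mspacetime R).
Local Notation mR := (measurableTypeR R).
Variable e : V.

(** The factor [c] takes the values 1 and -1: test functions are translated backwards, the functions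
    they are tested against forwards. *)
Lemma measurable_line (c : R) :
  measurable_fun setT (fun p : mV * mR => ((p.1 : V) + (c * p.2) *: e) : mV).
Proof.
have m1 := @measurable_fst _ _ mV mR.
have ms : measurable_fun setT (fun p : mV * mR => c * p.2 : mR).
  exact: (measurable_funM (measurable_cst c) (@measurable_snd _ _ mV mR)).
have mc (k : R) (q : mV -> mR) : measurable_fun setT q ->
    measurable_fun setT (fun p : mV * mR => q p.1 + (c * p.2) * k : mR).
  move=> mq; apply: measurable_funD; first exact: (measurableT_comp mq m1).
  exact: (measurable_funM ms (measurable_cst k)).
have f1 : measurable_fun setT (fun z : mV => z.1) by exact: measurable_fst.
have f11 : measurable_fun setT (fun z : mV => z.1.1) by exact: (measurableT_comp measurable_fst f1).
apply: (@measurable_fun_pair _ _ _ _ (mspace R) mR); last first.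
  exact: (mc e.2 (fun z => z.2) measurable_snd).
apply: (@measurable_fun_pair _ _ _ _ (mR * mR)%type mR); last first.
  exact: (mc e.1.2 (fun z => z.1.2) (measurableT_comp measurable_snd f1)).
apply: (@measurable_fun_pair _ _ _ _ mR mR).
  exact: (mc e.1.1.1 (fun z => z.1.1.1) (measurableT_comp measurable_fst f11)).
exact: (mc e.1.1.2 (fun z => z.1.1.2) (measurableT_comp measurable_snd f11)).
Qed.

Lemma is_derive_line (phi : V -> R) (z : V) (x : R) : bumpalg phi ->
  is_derive x 1 (fun s : R => phi (z - s *: e)) (- 'D_e phi (z - x *: e)).
Proof.
move=> hphi.
have E : (fun h : R => h^-1 *: (((fun s : R => phi (z - s *: e)) \o shift x) (h *: 1) -
      phi (z - x *: e))) =
    (fun h : R => h^-1 *: ((phi \o shift (z - x *: e)) (h *: (- e)) - phi (z - x *: e))).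
  apply/funext => h /=; congr (_ *: (phi _ - _)).
  by rewrite [h *: 1]mulr1 scalerDl scalerN opprD addrCA.
have dphi := bumpalg_diff (z - x *: e) hphi.
apply: DeriveDef.
  rewrite /derivable E; exact: (diff_derivable (v := - e) dphi).
transitivity ('D_(- e) phi (z - x *: e)); first by rewrite /derive E.
by rewrite !deriveE// linearN.
Qed.

Lemma derive_shift (phi : V -> R) (w z : V) :
  'D_e (fun y => phi (y - w)) z = 'D_e phi (z - w).
Proof.
have E : (fun h : R => h^-1 *: (((fun y => phi (y - w)) \o shift z) (h *: e) - phi (z - w))) =
    (fun h : R => h^-1 *: ((phi \o shift (z - w)) (h *: e) - phi (z - w))).
  by apply/funext => h /=; rewrite addrA.
by rewrite /derive E.
Qed.

Lemma continuous_line (phi : V -> R) (z : V) : bumpalg phi ->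
  continuous (fun s : R => phi (z - s *: e)).
Proof.
move=> hphi s; apply: differentiable_continuous; apply/derivable1_diffP.
by have [] := is_derive_line z s hphi.
Qed.

Lemma line_FTC (phi : V -> R) (z : V) (h : R) : bumpalg phi -> 0 < h ->
  (\int[lebesgue_measure]_(s in `[0%R, h]) ('D_e phi (z - s *: e))%:E =
    (phi z - phi (z - h *: e))%:E)%E.
Proof.
move=> hphi h0; pose F (s : R) := - phi (z - s *: e).
have cF : continuous F.
  move=> s; apply: (@cvgN _ _ _ _ _ (fun s => phi (z - s *: e))); exact: continuous_line.
have dF (s : R) : is_derive s 1 F ('D_e phi (z - s *: e)).
  have := is_deriveN (is_derive_line z s hphi); rewrite opprK; exact.
rewrite (@continuous_FTC2 _ _ F)//.
- by rewrite /F scale0r subr0 -EFinB opprK addrC.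
- have cD := @continuous_line _ z (bumpalg_derive e hphi).
  exact: continuous_subspaceT cD.
- split.
  + by move=> x _; have [] := dF x.
  + by apply: cvg_at_right_filter; exact: cF.
  + by apply: cvg_at_left_filter; exact: cF.
- by move=> x _; rewrite derive1E; have [_] := dF x.
Qed.
End directional_shift.

Section integrable_extra.
Local Open Scope ereal_scope.
Context d (T : measurableType d) (R : realType) (mu : {measure set T -> \bar R}).

Lemma integrable_mul_bounded (F psi : T -> R) (M : R) :
  mu.-integrable setT (EFin \o F) -> measurable_fun setT psi ->
  (forall x, `|psi x| <= M)%R -> mu.-integrable setT (fun x => (F x * psi x)%:E).
Proof.
move=> iF mpsi hM.
have M0 : (0 <= `|M|)%R by [].
have mF : measurable_fun setT F by apply/measurable_EFinP; exact: measurable_int iF.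
apply: (@le_integrable _ _ _ mu setT _ _ (fun x => (`|M|)%:E * (F x)%:E)) => //.
- by apply/measurable_EFinP; exact: measurable_funM.
- move=> x _ /=; rewrite lee_fin !normrM normr_id mulrC ler_wpM2r//.
  by apply: (le_trans (hM x)); exact: ler_norm.
- exact: integrableZl.
Qed.

Lemma integrable_fine (f : T -> \bar R) :
  mu.-integrable setT f -> mu.-integrable setT (EFin \o (fine \o f)).
Proof.
move=> fi; apply: (@le_integrable _ _ _ mu setT _ _ f) => //.
  apply/measurable_EFinP; apply: measurableT_comp => //; exact: measurable_int fi.
by move=> x _ /=; case: (f x) => [r| |]//=; rewrite normr0 leey.
Qed.

Lemma integralN_integrable (f : T -> \bar R) :
  mu.-integrable setT f -> \int[mu]_x (- f x) = - \int[mu]_x f x.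
Proof. by move=> fi; rewrite integralN// integrable_add_def. Qed.
End integrable_extra.

(** * Integrating a weak derivative along a segment *)

Section weak_shift.
Variable R : realType.
Local Notation V := (spacetime R).
Local Notation mV := (mspacetime R).
Local Notation mR := (measurableTypeR R).
Local Notation mu := (leb4 R).
Local Notation leb := (@lebesgue_measure R).
Variables (e : V) (h : R).
Hypothesis h0 : 0 < h.
Local Open Scope ereal_scope.

(** A real factor rather than a domain of integration, so that the integrand lives on the whole
    product space and Fubini's theorem applies directly. *)
Definition window (s : mR) : R := \1_(`[0%R, h]%classic) s.
Local Notation u := window.

Local Arguments window : simpl never.

Lemma measurable_window : measurable_fun setT u.
Proof. by apply: measurable_indic; exact: measurable_itv. Qed.

Lemma window01 s : (0 <= u s <= 1)%R.
Proof. by rewrite /window indicE; case: (s \in _); rewrite /= ?lexx ?ler01. Qed.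

Lemma windowE (s : R) : u s = (s \in `[0%R, h])%:R.
Proof. by rewrite /window indicE mem_setE. Qed.

Lemma integral_window (f : mR -> R) :
  \int[leb]_s (f s * u s)%:E = \int[leb]_(s in `[0%R, h]) (f s)%:E.
Proof.
rewrite [RHS]integral_mkcond; apply: eq_integral => s _.
by rewrite /window indicE patchE; case: ifP => /=; rewrite ?mulr1 ?mulr0.
Qed.

Lemma integral_window1 : \int[leb]_s (u s)%:E = h%:E.
Proof.
rewrite (_ : (fun s => (u s)%:E) = (fun s => (1 * u s)%:E)); last first.
  by apply/funext => s; rewrite mul1r.
rewrite (integral_window (fun=> 1%R)) integral_cst// mul1e.
have H : leb `[0%R, h]%classic = h%:E.
  by rewrite lebesgue_measure_itv/= lte_fin h0 -EFinD subr0.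
exact: H.
Qed.

Lemma integrable_window (F : mV -> R) (psi : mV * mR -> R) (M : R) :
  mu.-integrable setT (EFin \o F) -> measurable_fun setT psi ->
  (forall p, `|psi p| <= M)%R ->
  (mu \x leb).-integrable setT (fun p : mV * mR => (F p.1 * psi p * u p.2)%:E).
Proof.
move=> iF mpsi hM.
have mF : measurable_fun setT F by apply/measurable_EFinP; exact: measurable_int iF.
have i1 : (mu \x leb).-integrable setT (EFin \o (fun p : mV * mR => (F p.1 * u p.2)%R)).
  apply/integrable12ltyP.
    apply/measurable_EFinP; apply: measurable_funM.
      exact: (measurableT_comp mF measurable_fst).
    exact: (measurableT_comp (measurable_window) measurable_snd).
  rewrite (eq_integral (fun x => `|F x|%:E * h%:E)).
    rewrite ge0_integralZr//; last by rewrite lee_fin ltW.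
      by have /integrableP[_ iFoo] := iF; rewrite muleC lte_mul_pinfty// lee_fin ltW.
    by apply/measurable_EFinP; exact: measurableT_comp.
  move=> x _; rewrite -integral_window1 -ge0_integralZl//.
  - apply: eq_integral => s _ /=; rewrite normrM EFinM; congr (_ * _).
    by rewrite ger0_norm//; case/andP: (window01 s).
  - by apply/measurable_EFinP; exact: measurable_window.
  - by move=> s _; rewrite lee_fin; case/andP: (window01 s).
have := integrable_mul_bounded i1 mpsi hM.
by apply: eq_integrable => // p _ /=; rewrite mulrAC.
Qed.

(** Integrate the tested identity in s over [0, h]. On the left the fundamental theorem of calculus
    gives phi z - phi (z - h e); translation invariance then moves the shifts from phi to [F] and
    [G]. *)
Lemma weak_shift (F G : mV -> R) (phi : V -> R) :
  mu.-integrable setT (EFin \o F) -> mu.-integrable setT (EFin \o G) ->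
  bumpalg phi ->
  (forall s, (0 <= s <= h)%R ->
    \int[mu]_z (F z * 'D_e phi ((z : V) - s *: e))%:E =
    \int[mu]_z (- (G z * phi ((z : V) - s *: e)%R))%:E) ->
  \int[mu]_z ((F z - F ((z : V) + h *: e)) * phi z)%:E =
  \int[mu]_z \int[leb]_s (- (G ((z : V) + s *: e) * phi z) * u s)%:E.
Proof.
move=> iF iG hphi hyp.
have mphi := bumpalg_measurable hphi.
have [M [M0 hM]] := bumpalg_bounded hphi.
have hD := bumpalg_derive e hphi.
have mD := bumpalg_measurable hD.
have [N [N0 hN]] := bumpalg_bounded hD.
have lineE (p : mV * mR) : ((p.1 : V) - (p.2 : R) *: e)%R = ((p.1 : V) + ((- 1)%R * p.2) *: e)%R.
  by rewrite mulN1r scaleNr.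
have mline (psi : mV -> R) : measurable_fun setT psi ->
    measurable_fun setT (fun p : mV * mR => psi ((p.1 : V) - (p.2 : R) *: e)%R).
  move=> mpsi; under eq_fun do rewrite lineE.
  exact: (measurableT_comp mpsi (measurable_line e (- 1)%R)).
have mF : measurable_fun setT F by apply/measurable_EFinP; exact: measurable_int iF.
have mG : measurable_fun setT G by apply/measurable_EFinP; exact: measurable_int iG.
pose K1 (p : mV * mR) := (F p.1 * 'D_e phi ((p.1 : V) - (p.2 : R) *: e) * u p.2)%:E.
have iK1 : (mu \x leb).-integrable setT K1.
  by apply: (integrable_window (psi := fun p => 'D_e phi ((p.1 : V) - (p.2 : R) *: e)%R) iF (mline _ mD) (M := N)).
pose K2 (p : mV * mR) := (G p.1 * (- phi ((p.1 : V) - (p.2 : R) *: e)) * u p.2)%:E.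
have iK2 : (mu \x leb).-integrable setT K2.
  apply: (integrable_window (psi := fun p => (- phi ((p.1 : V) - (p.2 : R) *: e))%R) iG _ (M := M)).
    exact: (measurableT_comp _ (mline _ mphi)).
  by move=> p; rewrite normrN.
(* [K1] and [K2] are the two sides of the tested identity, and [K3] is [K2] with z translated by s
   e. Slice by slice in s it has the same integral as [K2], so it inherits its integrability. *)
pose K3 (p : mV * mR) := (- (G ((p.1 : V) + (p.2 : R) *: e) * phi p.1) * u p.2)%:E.
have mK3 : measurable_fun setT K3.
  apply/measurable_EFinP; apply: measurable_funM; last first.
    exact: (measurableT_comp (measurable_window) measurable_snd).
  apply: measurableT_comp => //; apply: measurable_funM; last first.
    exact: (measurableT_comp mphi measurable_fst).
  have := measurableT_comp mG (measurable_line e 1%R).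
  by under [X in measurable_fun _ X -> _]eq_fun do rewrite /= mul1r.
have K23 (s : mR) (z : mV) : K3 (z, s) = K2 (((z : V) + s *: e)%R, s).
  by rewrite /K3 /K2 /= addrK mulrN.
have sh (s : mR) := preserves_leb4_shift ((s : R) *: e).
have iK3 : (mu \x leb).-integrable setT K3.
  apply/(integrable21ltyP _ _ mK3).
  move/(integrable21ltyP _ _ (measurable_int _ iK2)) : (iK2); apply: le_lt_trans.
  rewrite le_eqVlt; apply/orP; left; apply/eqP; apply: eq_integral => s _.
  under eq_integral do rewrite K23.
  apply: (@ge0_integral_preserves _ _ _ mu _ (fun z => `|K2 (z, s)|) (sh s)) => //.
  apply: measurableT_comp => //.
  exact: (measurableT_comp (measurable_int _ iK2) (measurable_pair2 s)).
have -> : \int[mu]_z \int[leb]_s (- (G ((z : V) + s *: e) * phi z) * u s)%:E =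
    \int[mu]_z \int[leb]_s K1 (z, s).
  rewrite -[LHS]/(\int[mu]_z \int[leb]_s K3 (z, s)).
  rewrite (Fubini iK3) (Fubini iK1); apply: eq_integral => s _.
  rewrite (eq_integral (fun z : mV => K2 (((z : V) + s *: e)%R, s))); last by move=> z _; rewrite K23.
  have mK2s : measurable_fun setT (fun z => K2 (z, s)).
    exact: (measurableT_comp (measurable_int _ iK2) (measurable_pair2 s)).
  have mps : measurable_fun setT (fun z : mV => phi ((z : V) - (s : R) *: e)%R).
    exact: (measurableT_comp mphi (measurable_shift (- ((s : R) *: e))%R)).
  have iK2s : mu.-integrable setT (fun z => K2 (z, s)).
    rewrite /K2 /=.
    apply: (integrable_mul_bounded _ (psi := fun=> u s) (F := fun z : mV => (G z * - phi ((z : V) - s *: e))%R) (M := 1%R)) => //.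
      apply: (integrable_mul_bounded iG (M := M)) => //; last by move=> z; rewrite normrN.
      exact: (measurableT_comp (@oppr_measurable R setT) mps).
    by move=> _; have /andP[? ?] := window01 s; rewrite ger0_norm.
  rewrite (integral_preserves (sh s) iK2s).
  have := windowE s; case: (boolP ((s : R) \in `[0%R, h])) => hs us; last first.
    by apply: eq_integral => z _; rewrite /K1 /K2 /= us !mulr0.
  transitivity (\int[mu]_z (- (G z * phi ((z : V) - (s : R) *: e)%R))%:E).
    by apply: eq_integral => z _; rewrite /K2 /= us mulr1 mulrN.
  rewrite -hyp; last by move: hs; rewrite in_itv.
  by apply: eq_integral => z _; rewrite /K1 /= us mulr1.
pose Fh (z : mV) : R := F ((z : V) + h *: e)%R.
have shh := preserves_leb4_shift (h *: e).
have iFh : mu.-integrable setT (EFin \o Fh) by exact: (integrable_preserves shh iF).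
have i1 : mu.-integrable setT (fun z => (F z * phi z)%:E) by exact: integrable_mul_bounded iF mphi hM.
have i2 : mu.-integrable setT (fun z => (Fh z * phi z)%:E) by exact: integrable_mul_bounded iFh mphi hM.
have i3 : mu.-integrable setT (fun z : mV => (F z * phi ((z : V) - h *: e))%:E).
  apply: (integrable_mul_bounded iF (M := M)) => //.
  exact: (measurableT_comp mphi (measurable_shift (- (h *: e))%R)).
transitivity (\int[mu]_z ((F z * phi z)%:E - (Fh z * phi z)%:E)).
  by apply: eq_integral => z _; rewrite -EFinB mulrBl.
rewrite integralB//.
have -> : \int[mu]_z (Fh z * phi z)%:E = \int[mu]_z (F z * phi ((z : V) - h *: e))%:E.
  rewrite -(integral_preserves shh i3); apply: eq_integral => z _.
  by rewrite addrK.
rewrite -integralB//; apply: eq_integral => z _.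
rewrite /K1 /= integral_window.
transitivity ((F z)%:E * \int[leb]_(s in `[0%R, h]) ('D_e phi ((z : V) - s *: e))%:E).
  by rewrite line_FTC// -EFinM -EFinB mulrBr.
rewrite -integralZl//.
apply: (@continuous_compact_integrable _ (fun s : R => 'D_e phi ((z : V) - s *: e)%R)).
  exact: segment_compact.
have cD := @continuous_line _ e _ z hD.
exact: continuous_subspaceT cD.
Qed.

End weak_shift.

Section weak_shift_ae.
Variable R : realType.
Local Notation V := (spacetime R).
Local Notation mV := (mspacetime R).
Local Notation mR := (measurableTypeR R).
Local Notation mu := (leb4 R).
Local Notation leb := (@lebesgue_measure R).
Variables (e : V) (h : R).
Hypothesis h0 : 0 < h.
Local Open Scope ereal_scope.
Local Notation u := (window h).

(* The weak derivative is tested against the translates [phi (z - s *: e)],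
   [0 <= s <= h], and the result is integrated in [s]. *)
Lemma weak_derivative_shift (D : set V) (f g : V -> R) (a b : V) :
  weak_derivative D e f g -> (forall i, 0 <= pr i e)%R ->
  cbox a (b + h *: e)%R `<=` D ->
  {ae mu, forall z : mV, obox a b z ->
    `|f z|%:E <= `|f ((z : V) + h *: e)%R|%:E +
      \int[leb]_(s in `[0%R, h]) `|g ((z : V) + s *: e)%R|%:E}.
Proof.
move=> [lf lg fg] e0 KD.
pose K : set mV := cbox a (b + h *: e)%R.
have mK : measurable K by exact: measurable_cbox.
have cK : compact K by exact: cbox_compact.
(* Cutting to the compact box [K] turns local integrability into integrability. Test functions
   supported in [K] do not see the cut, and [K] contains every translate that is used. *)
pose F : mV -> R := f \_ K; pose G : mV -> R := g \_ K.
have iF : mu.-integrable setT (EFin \o F).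
  have := (integrable_mkcond (EFin \o f : mV -> \bar R) mK).1 (lf _ cK KD).
  by apply: eq_integrable => // z _; rewrite /F /= !patchE; case: ifP.
have iG : mu.-integrable setT (EFin \o G).
  have := (integrable_mkcond (EFin \o g : mV -> \bar R) mK).1 (lg _ cK KD).
  by apply: eq_integrable => // z _; rewrite /G /= !patchE; case: ifP.
have mF : measurable_fun setT F by apply/measurable_EFinP; exact: measurable_int iF.
have mG : measurable_fun setT G by apply/measurable_EFinP; exact: measurable_int iG.
have test (psi : V -> R) (k : V -> R) : (forall z, ~ K z -> psi z = 0%R) ->
    (\int[mu]_(z in D) (k z * psi z))%R = fine (\int[mu]_z ((k \_ K) z * psi z)%:E).
  move=> psi0; rewrite Rintegral_mkcond /Rintegral; congr fine.
  apply: eq_integral => z _; congr EFin; rewrite !patchE.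
  have [zK|zK] := pselect (K z).
    by rewrite (mem_set zK) mem_set//; exact: KD.
  by rewrite psi0// mulr0; case: ifP; rewrite ?mulr0.

have kshift (s : R) c d : (0 <= s <= h)%R -> (forall i, pr i a <= pr i c)%R ->
    (forall i, pr i d <= pr i b)%R -> cbox (c + s *: e)%R (d + s *: e)%R `<=` K.
  move=> /andP[s0 sh] ac db z hz i; have /andP[] := hz i.
  rewrite /K !prD !prZ => h1 h2; apply/andP; split.
    by apply: le_trans h1; rewrite -[leLHS]addr0 lerD ?ac// mulr_ge0.
  by apply: (le_trans h2); rewrite lerD ?db// ler_wpM2r.
have mul_test n c d (s : R) : (0 <= s <= h)%R -> (forall i, pr i a <= pr i c)%R ->
    (forall i, pr i d <= pr i b)%R ->
    \int[mu]_z (F z * 'D_e (bump n c d) ((z : V) - s *: e))%:E =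
    \int[mu]_z (- (G z * bump n c d ((z : V) - s *: e)%R))%:E.
  move=> hs ac db; have sub := kshift s c d hs ac db.
  have bs := bump_bumpalg n (c + s *: e)%R (d + s *: e)%R.
  have bE (z : V) : bump n c d (z - s *: e)%R = bump n (c + s *: e)%R (d + s *: e)%R z.
    by rewrite -bump_shift.
  have dE (z : V) : 'D_e (bump n c d) (z - s *: e)%R =
      'D_e (bump n (c + s *: e)%R (d + s *: e)%R) z.
    by rewrite -bump_shift derive_shift.
  have := fg _ (bump_test n (subset_trans sub KD)).
  rewrite (test ('D_e (bump n (c + s *: e)%R (d + s *: e)%R) : V -> R) f); last first.
    by move=> z zK; apply: bump_derive_out => /sub.
  rewrite (test (bump n (c + s *: e)%R (d + s *: e)%R) g); last first.
    by move=> z zK; apply: bump_out => /obox_cbox /sub.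
  have [M [_ hM]] := bumpalg_bounded bs.
  have [N [_ hN]] := bumpalg_bounded (bumpalg_derive e bs).
  have j1 := integrable_mul_bounded iF (bumpalg_measurable (bumpalg_derive e bs)) hN.
  have j2 := integrable_mul_bounded iG (bumpalg_measurable bs) hM.
  move=> E0; have := congr1 (@EFin R) E0.
  rewrite EFinN !fineK; [move=> E1|exact: integrable_fin_num..].
  transitivity (\int[mu]_z (F z * 'D_e (bump n (c + s *: e)%R (d + s *: e)%R) z)%:E).
    by apply: eq_integral => z _; rewrite dE.
  rewrite E1 -(integralN_integrable j2); apply: eq_integral => z _.
  by rewrite bE EFinN.
pose K4 (p : mV * mR) := (G ((p.1 : V) + (p.2 : R) *: e)%R * u p.2)%:E.
have mK4 : measurable_fun setT K4.
  apply/measurable_EFinP; apply: measurable_funM; last first.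
    exact: (measurableT_comp (measurable_window h) measurable_snd).
  have := measurableT_comp mG (measurable_line e 1%R).
  by under [X in measurable_fun _ X -> _]eq_fun do rewrite /= mul1r.
have n1 (p : mV * mR) : (`|1%R : R| <= 1)%R by rewrite normr1.
have m1 : measurable_fun setT (fun p : mV * mR => 1%R : R) by exact: measurable_cst.
have iGu := integrable_window h0 iG m1 n1.
have iK4 : (mu \x leb).-integrable setT K4.
  apply/(integrable21ltyP _ _ mK4).
  move/(integrable21ltyP _ _ (measurable_int _ iGu)) : (iGu); apply: le_lt_trans.
  rewrite le_eqVlt; apply/orP; left; apply/eqP; apply: eq_integral => s _.
  pose q (z : mV) : \bar R := `|(G z * 1 * u s)%:E|.
  have mq : measurable_fun setT q.
    apply: measurableT_comp => //; apply/measurable_EFinP.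
    exact: (measurable_funM (measurable_funM mG (measurable_cst _)) (measurable_cst _)).
  have := ge0_integral_preserves (preserves_leb4_shift ((s : R) *: e)) mq (fun z => abse_ge0 _).
  move=> E2; transitivity (\int[mu]_z q ((z : V) + (s : R) *: e)%R); last exact: E2.
  by apply: eq_integral => z _; rewrite /q mulr1.
(* [J] may be infinite on a null set; [fine] makes it real there, and [aeJ] below removes the
   difference. *)
pose J z := \int[leb]_s K4 (z, s).
have iJ : mu.-integrable setT J by exact: integrable_fubini_F iK4.
have iJr := integrable_fine iJ.
pose A (z : mV) : R := (F z - F ((z : V) + h *: e)%R)%R.
have iFh : mu.-integrable setT (EFin \o (fun z : mV => F ((z : V) + h *: e)%R)).
  exact: (integrable_preserves (preserves_leb4_shift (h *: e)%R) iF).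
have iA : mu.-integrable setT (EFin \o A).
  by have := integrableB measurableT iF iFh; apply: eq_integrable.
(* [H] is the defect in F z = F (z + h e) - J z. Its integral against every admissible bump
   vanishes; dominated convergence in n then gives zero integral over every admissible box, and
   [null_boxes_ae] concludes. *)
pose H (z : mV) : R := (A z + fine (J z))%R.
have iH : mu.-integrable setT (EFin \o H).
  by have := integrableD measurableT iA iJr; apply: eq_integrable.
have mH : measurable_fun setT H by apply/measurable_EFinP; exact: measurable_int iH.
have aeJ : {ae mu, forall z, leb.-integrable setT (fun s => K4 (z, s))} by exact: ae_integrable1 iK4.
have H0 n c d : (forall i, pr i a <= pr i c)%R -> (forall i, pr i d <= pr i b)%R ->
    \int[mu]_z (H z * bump n c d z)%:E = 0.
  move=> ac db; have bs := bump_bumpalg n c d.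
  have [M [_ hM]] := bumpalg_bounded bs.
  have iAb := integrable_mul_bounded iA (bumpalg_measurable bs) hM.
  have iJb := integrable_mul_bounded iJr (bumpalg_measurable bs) hM.
  transitivity (\int[mu]_z ((A z * bump n c d z)%:E + (fine (J z) * bump n c d z)%:E)).
    by apply: eq_integral => z _; rewrite -EFinD mulrDl.
  rewrite integralD// (weak_shift h0 iF iG bs (fun s hs => mul_test n c d s hs ac db)).
  pose K5 (p : mV * mR) := (- (G ((p.1 : V) + (p.2 : R) *: e)%R * bump n c d p.1) * u p.2)%:E.
  have iK5 : (mu \x leb).-integrable setT K5.
    have mb : measurable_fun setT (fun p : mV * mR => - bump n c d p.1 : R)%R.
      apply: measurableT_comp => //.
      exact: (measurableT_comp (bumpalg_measurable bs) measurable_fst).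
    have hMb (p : mV * mR) : (`|- bump n c d p.1| <= M)%R by rewrite normrN.
    have := integrable_mul_bounded iK4 mb hMb.
    by apply: eq_integrable => // p _; rewrite /K5 mulrAC mulrN.
  have mK5 : measurable_fun setT (fun z => \int[leb]_s K5 (z, s)).
    exact: measurable_fubini_F iK5.
  pose K6 (z : mV) := - (fine (J z) * bump n c d z)%:E.
  have mK6 : measurable_fun setT K6.
    by apply: measurableT_comp => //; exact: measurable_int iJb.
  have ae56 : ae_eq mu setT (fun z => \int[leb]_s K5 (z, s)) K6.
    apply: filterS aeJ => z iz _.
    transitivity ((- bump n c d z)%:E * J z).
      rewrite /J -integralZl//; apply: eq_integral => s _.
      by rewrite /K4 /K5 /= -EFinM; congr EFin; rewrite mulrCA mulrA mulrN mulrC.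
    have Jf : J z \is a fin_num := integrable_fin_num measurableT iz.
    by rewrite /K6 EFinM fineK// EFinN mulNe muleC.
  have E5 := ae_eq_integral K6 _ measurableT mK5 mK6 ae56.
  rewrite [X in X + _](_ : _ = \int[mu]_z K6 z); last exact: E5.
  rewrite (integralN_integrable iJb).
  by rewrite addeC subee// integrable_fin_num.
have Hbox : {ae mu, forall z : mV, obox a b z -> (H z)%:E = 0}.
  apply: null_boxes_ae.
    by apply: integrableS iH => //; exact: measurable_obox.
  move=> c d ac db.
  have := @dominated_convergence _ mV R mu setT measurableT
    (fun n z => (H z * bump n c d z)%:E) (fun z => (H z * \1_(obox c d) z)%:E) (fun z => `|H z|%:E).
  case.
  - by move=> n; apply/measurable_EFinP; exact: (measurable_funM mH (bumpalg_measurable (bump_bumpalg n c d))).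
  - apply/measurable_EFinP; apply: measurable_funM => //; apply: measurable_indic.
    exact: measurable_obox.
  - apply: nearW => z _; apply: cvg_EFin; first exact: nearW.
    by apply: cvgM; [exact: cvg_cst|exact: bump_cvg].
  - by have := integrable_abse iH; apply: eq_integrable.
  - apply: nearW => z n _; rewrite /= lee_fin normrM -[leRHS]mulr1 ler_wpM2l//.
    exact: bump_norm_le1.
  move=> _ _; rewrite (_ : (fun n => _) = cst 0); last first.
    by apply/funext => n; exact: H0.
  move=> /(cvg_lim (@ereal_hausdorff R)); rewrite lim_cst// => E.
  rewrite integral_mkcond [RHS]E; apply: eq_integral => z _.
  by rewrite patchE indicE; case: ifP; rewrite ?mulr1 ?mulr0.
move: Hbox aeJ; apply: filterS2 => z Hz iz zab.
have zK : K z.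
  move=> i; have /andP[h1 h2] := zab i; rewrite (ltW h1)/= prD prZ.
  by apply: (le_trans (ltW h2)); rewrite lerDl mulr_ge0// ltW.
have zsK (s : R) : (0 <= s <= h)%R -> K ((z : V) + s *: e)%R.
  move=> /andP[s0 sh] i; have /andP[h1 h2] := zab i; rewrite !prD !prZ.
  apply/andP; split; first by rewrite -[leLHS]addr0 lerD ?(ltW h1)// mulr_ge0.
  by rewrite lerD ?(ltW h2)// ler_wpM2r.
have FE : F z = f z by rewrite /F patchE mem_set.
have FhE : F ((z : V) + h *: e)%R = f ((z : V) + h *: e)%R.
  by rewrite /F patchE mem_set//; apply: zsK; rewrite lexx ltW.
have fE : f z = (f ((z : V) + h *: e) - fine (J z))%R.
  have [] := Hz zab; rewrite /H /A FE FhE => /eqP.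
  by rewrite addr_eq0 subr_eq => /eqP ->; rewrite addrC.
rewrite fE; apply: (@le_trans _ _ (`|f ((z : V) + h *: e)%R|%:E + `|fine (J z)|%:E)).
  by rewrite -EFinD lee_fin; exact: ler_normB.
rewrite leeD2l// -abse_EFin fineK; last exact: integrable_fin_num.
apply: (le_trans (le_abse_integral _ measurableT (measurable_int _ iz))).
rewrite [leRHS]integral_mkcond le_eqVlt; apply/orP; left; apply/eqP; apply: eq_integral => s _.
rewrite patchE /K4 /= windowE; case: ifPn => hs.
  have hs' : (0 <= (s : R) <= h)%R by move: hs; rewrite inE/= in_itv.
  by rewrite in_itv/= hs' mulr1 /G patchE mem_set//; exact: zsK.
rewrite (_ : (s : R) \in `[0%R, h] = false) ?mulr0 ?normr0//.
by apply: contraNF hs => hs; rewrite inE.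
Qed.
End weak_shift_ae.

(** * The line inequality for almost every point and almost every length *)

Section ae_extra.
Local Open Scope ereal_scope.

(** By Tonelli the indicator of [N] has zero integral in either order. This turns a property holding
    for each h and almost every z into one holding for almost every z and almost every h. *)
Lemma ae_xsection d1 d2 (T1 : measurableType d1) (T2 : measurableType d2)
    (R : realType) (m1 : {sigma_finite_measure set T1 -> \bar R})
    (m2 : {sigma_finite_measure set T2 -> \bar R}) (N : set (T1 * T2)) :
  measurable N -> {ae m2, forall y, {ae m1, forall x, ~ N (x, y)}} ->
  {ae m1, forall x, {ae m2, forall y, ~ N (x, y)}}.
Proof.
move=> mN N0.
have mI : measurable_fun setT (fun p => (\1_N p : R)%:E).
  by apply/measurable_EFinP; exact: measurable_indic.
have mI1 : measurable_fun setT (fun x => \int[m2]_y (\1_N (x, y) : R)%:E).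
  by apply: (measurable_fun_fubini_tonelli_F (fun p => (\1_N p : R)%:E)) => //.
have mI2 : measurable_fun setT (fun y => \int[m1]_x (\1_N (x, y) : R)%:E).
  by apply: (measurable_fun_fubini_tonelli_G (fun p => (\1_N p : R)%:E)) => //.
have I0 : \int[m1]_x \int[m2]_y (\1_N (x, y) : R)%:E = 0.
  rewrite (fubini_tonelli (fun p => (\1_N p : R)%:E))//.
  rewrite -[RHS](integral0 m2 setT); apply: ae_eq_integral => //.
  apply: filterS N0 => y Ny _.
  rewrite -[RHS](integral0 m1 setT); apply: ae_eq_integral => //.
    exact: (measurableT_comp mI (measurable_pair2 y)).
  by apply: filterS Ny => x /= nN _; rewrite indicE memNset.
have := (ae_eq_integral_abs m1 measurableT mI1).1.
under eq_integral do rewrite gee0_abs ?integral_ge0//.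
move=> /(_ I0); apply: filterS => x /(_ I) Ix.
have mx : measurable_fun setT (fun y => (\1_N (x, y) : R)%:E).
  exact: (measurableT_comp mI (measurable_pair1 x)).
have := (ae_eq_integral_abs m2 measurableT mx).1.
under eq_integral do rewrite gee0_abs ?lee_fin//.
move=> /(_ Ix); apply: filterS => y /(_ I) /= + Nxy.
by rewrite indicE mem_set// => -[] /eqP; rewrite oner_eq0.
Qed.
End ae_extra.

Section reference_box.
Variable R : realType.
Local Notation V := (spacetime R).
Local Notation mV := (mspacetime R).
Local Notation mR := (measurableTypeR R).
Local Notation mu := (leb4 R).
Local Notation leb := (@lebesgue_measure R).

(** The spatial half side is 1/2, so the squared distance to the axis x = 0 is below 3/4 and the box
    lies in the unit cylinder. *)
Definition box_lo : V := (- 2^-1, - 2^-1, - 2^-1, - 1).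
Definition box_hi : V := (2^-1, 2^-1, 2^-1, 0).
Definition box1 : set mV := obox box_lo box_hi.

Lemma measurable_box1 : measurable box1. Proof. exact: measurable_obox. Qed.

Lemma box1E (z : V) : box1 z <->
  [/\ - 2^-1 < z.1.1.1 < 2^-1, - 2^-1 < z.1.1.2 < 2^-1, - 2^-1 < z.1.2 < 2^-1 & - 1 < z.2 < 0].
Proof.
split=> [h|[h0 h1 h2 h3]]; last by case=> [[|[|[|[|n]]]]].
by split; [have := h (@Ordinal 4 0 isT)|have := h (@Ordinal 4 1 isT)|
           have := h (@Ordinal 4 2 isT)|have := h (@Ordinal 4 3 isT)].
Qed.

Lemma box1_cylinder : box1 `<=` cylinder 1.
Proof.
move=> z /box1E[h0 h1 h2 h3]; split; last by rewrite /= in_itv/= expr1n.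
rewrite /sball/= /snorm -[ltRHS]sqrtr1 ltr_sqrt//.
have H (x : R) : - 2^-1 < x < 2^-1 -> x ^+ 2 <= 4^-1.
  by move=> /andP[? ?]; nra.
by have := H _ h0; have := H _ h1; have := H _ h2; lra.
Qed.

Lemma box1_convex (z e : V) (h s : R) : (forall i, 0 <= pr i e) -> 0 <= s <= h ->
  box1 z -> box1 (z + h *: e) -> box1 (z + s *: e).
Proof.
move=> e0 /andP[s0 sh] hz hh i; have /andP[a1 a2] := hz i; have /andP[b1 b2] := hh i.
rewrite !prD !prZ in b1 b2 *; apply/andP; split.
  by apply: (lt_le_trans a1); rewrite lerDl mulr_ge0.
by apply: le_lt_trans b2; rewrite lerD2l ler_wpM2r.
Qed.

(** Extension by 0 gives a function measurable on the whole space, whereas [f] itself is only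
    controlled on compact subsets of the cylinder. *)
Definition cut (f : V -> R) : mV -> R := f \_ box1.

Lemma cutE f z : box1 z -> cut f z = f z.
Proof. by move=> h; rewrite /cut patchE mem_set. Qed.

Lemma box1_exhaust (n : nat) :
  cbox (mkv (fun i => pr i box_lo + n.+1%:R^-1)) (mkv (fun i => pr i box_hi - n.+1%:R^-1))
  `<=` box1.
Proof.
move=> z hz i; have := hz i; rewrite !pr_mkv => /andP[h1 h2].
have n0 : (0 : R) < n.+1%:R^-1 by rewrite invr_gt0.
by apply/andP; split; [apply: lt_le_trans h1; rewrite ltrDl|apply: (le_lt_trans h2); rewrite gtrBl].
Qed.

(** Two points are treated at once: z is kept away from the lower faces and its translate z + h e
    from the upper ones, which is enough when e has nonnegative coordinates. *)
Lemma box1_exhausted (z w : V) : box1 z -> box1 w -> exists n : nat,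
  forall i, pr i box_lo + n.+1%:R^-1 < pr i z /\ pr i w < pr i box_hi - n.+1%:R^-1.
Proof.
move=> hz hw.
pose m : R := \big[Num.min/1]_(i < 4) Num.min (pr i z - pr i box_lo) (pr i box_hi - pr i w).
have m0 : 0 < m.
  apply: lt_bigmin => // i _; rewrite lt_min !subr_gt0.
  by have /andP[-> _] := hz i; have /andP[_ ->] := hw i.
have [n nm] : exists n : nat, n.+1%:R^-1 < m.
  exists (Num.truncn m^-1); rewrite -[ltRHS]invrK ltf_pV2 ?posrE ?invr_gt0// truncnS_gt//.
exists n => i; have := bigmin_le_cond 1 (fun i => Num.min (pr i z - pr i box_lo) (pr i box_hi - pr i w)) (isT : xpredT i).
rewrite -/m => /(lt_le_trans nm); rewrite lt_min ltrBrDl => /andP[-> h2].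
by split=> //; rewrite ltrBrDl -ltrBrDr.
Qed.

(** The open box is a countable union of compact boxes, on each of which [f] is integrable, hence
    measurable. *)
Lemma measurable_cut (f : V -> R) (D : set V) : loc_integrable D f -> box1 `<=` D ->
  measurable_fun setT (cut f).
Proof.
move=> lf BD.
pose K n : set mV := cbox (mkv (fun i => pr i box_lo + n.+1%:R^-1))
                          (mkv (fun i => pr i box_hi - n.+1%:R^-1)).
have KE : box1 = \bigcup_n K n.
  apply/seteqP; split=> z.
    move=> hz; have [n hn] := box1_exhausted hz hz; exists n => // i.
    by rewrite !pr_mkv; have [/ltW -> /ltW ->] := hn i.
  by move=> [n _]; exact: box1_exhaust.
apply/(measurable_restrictT f measurable_box1).
rewrite KE; apply/measurable_fun_bigcup.
  by move=> n; exact: measurable_cbox.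
move=> n; apply/measurable_EFinP.
have := lf (K n) (@cbox_compact R _ _) (subset_trans (@box1_exhaust n) BD).
exact: measurable_int.
Qed.

Local Open Scope ereal_scope.

(** The quantifier on h comes after the one on z: with z fixed, the inequality can be averaged over
    h along a single line. *)
Definition ae_line (F G : mV -> R) (e : V) (z : mV) : Prop :=
  box1 z -> {ae leb, forall h : mR, (0 < h)%R -> box1 ((z : V) + (h : R) *: e)%R ->
    `|F z|%:E <= `|F ((z : V) + (h : R) *: e)%R|%:E +
      \int[leb]_(s in `[0%R, h]) `|G ((z : V) + (s : R) *: e)%R|%:E}.

(** For each h, [weak_derivative_shift] gives the inequality at almost every z. The bad pairs (z, h)
    form a measurable set [N], so [ae_xsection] exchanges the two quantifiers. *)
Lemma ae_line_bound (D : set V) (e : V) (f g : V -> R) :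
  box1 `<=` D -> weak_derivative D e f g -> (forall i, 0 <= pr i e)%R ->
  {ae mu, forall z : mV, ae_line (cut f) (cut g) e z}.
Proof.
move=> BD wd e0; have [lf lg _] := wd.
have mF := measurable_cut lf BD; have mG := measurable_cut lg BD.
pose q1 (p : mV * mR) : \bar R := `|cut f p.1|%:E.
(* The condition 0 <= s <= h is put into the integrand as an indicator, which makes the integral
   over [0, h] a measurable function of (z, h). *)
pose k (w : (mV * mR) * mR) : \bar R :=
  (`|cut g ((w.1.1 : V) + (w.2 : R) *: e)%R| * \1_[set w : (mV * mR) * mR | (0 <= w.2)%R /\ (0 <= w.1.2 - w.2)%R] w)%:E.
pose q2 (p : mV * mR) : \bar R := `|cut f ((p.1 : V) + (p.2 : R) *: e)%R|%:E +
   \int[leb]_s k (p, s).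
have mline : measurable_fun setT (fun p : mV * mR => ((p.1 : V) + (p.2 : R) *: e)%R : mV).
  by have := measurable_line e 1%R; under [X in measurable_fun _ X -> _]eq_fun do rewrite mul1r.
have mq1 : measurable_fun setT q1.
  apply/measurable_EFinP; apply: measurableT_comp => //.
  exact: (measurableT_comp mF measurable_fst).
have mk : measurable_fun setT k.
  apply/measurable_EFinP; apply: measurable_funM.
    apply: measurableT_comp => //.
    have m3 : measurable_fun setT (fun w : (mV * mR) * mR => (w.1.1, w.2)).
      apply: measurable_fun_pair; last exact: measurable_snd.
      exact: (measurableT_comp measurable_fst measurable_fst).
    exact: (measurableT_comp mG (measurableT_comp mline m3)).
  apply: measurable_indic.
  have m1 : measurable_fun setT (fun w : (mV * mR) * mR => w.2 : R) by exact: measurable_snd.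
  have m2 : measurable_fun setT (fun w : (mV * mR) * mR => w.1.2 - w.2 : R)%R.
    apply: measurable_funB; last exact: m1.
    exact: (measurableT_comp measurable_snd measurable_fst).
  have i1 : measurable (`[0%R, +oo[%classic : set R) by exact: measurable_itv.
  have := measurableI _ _ (m1 measurableT _ i1) (m2 measurableT _ i1).
  rewrite !setTI; congr measurable; apply/seteqP; split=> w /=; rewrite !in_itv/= !andbT;
    by move=> [].
have k0 w : 0 <= k w by rewrite lee_fin mulr_ge0.
have kE (p : mV * mR) : \int[leb]_s k (p, s) =
    \int[leb]_(s in `[0%R, p.2]) `|cut g ((p.1 : V) + (s : R) *: e)%R|%:E.
  rewrite [RHS]integral_mkcond; apply: eq_integral => s _.
  rewrite patchE /k /= indicE; case: ifPn => hs.
    rewrite mem_set ?mulr1//=; move: hs; rewrite inE/= in_itv/= subr_ge0 => /andP[? ?].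
    by split.
  rewrite memNset ?mulr0//= => -[s0 sp]; move/negP: hs; apply.
  by rewrite inE/= in_itv/= s0 -subr_ge0.
have mq2 : measurable_fun setT q2.
  apply: emeasurable_funD.
    apply/measurable_EFinP; apply: measurableT_comp => //.
    exact: (measurableT_comp mF mline).
  exact: (measurable_fun_fubini_tonelli_F k mk k0).
pose N : set (mV * mR) := [set p | [/\ box1 p.1, (0 < p.2)%R,
   box1 ((p.1 : V) + (p.2 : R) *: e)%R & q2 p < q1 p]].
have mN : measurable N.
  rewrite (_ : N = (fst @^-1` box1 `&` ((snd : mV * mR -> R) @^-1` `]0%R, +oo[%classic)) `&`
     ((fun p : mV * mR => ((p.1 : V) + (p.2 : R) *: e)%R : mV) @^-1` box1 `&`
        (setT `&` [set p | q2 p < q1 p]))).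
    apply: measurableI; apply: measurableI.
    - rewrite -[X in measurable X]setTI; apply: measurable_fst => //; exact: measurable_box1.
    - rewrite -[X in measurable X]setTI.
      have m1 : measurable_fun setT (fun w : mV * mR => w.2 : R) by exact: measurable_snd.
      by apply: m1 => //; exact: measurable_itv.
    - rewrite -[X in measurable X]setTI; apply: mline => //; exact: measurable_box1.
    - exact: measurable_lte.
  apply/seteqP; split=> p /=; rewrite in_itv/= andbT.
    by move=> [? ? ? ?]; do !split.
  by move=> [[? ?] [? [_ ?]]].
have NE : {ae leb, forall h : mR, {ae mu, forall z : mV, ~ N (z, h)}}.
  apply: nearW => h; have [h0|h0] := ltP 0%R h; last first.
    by apply: nearW => z [_ /=]; rewrite ltNge h0.
  (* Countably many slightly smaller boxes: for the n-th one the segments of length h stay in a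
     compact subset of the domain. *)
  pose a n := mkv (fun i => pr i box_lo + n.+1%:R^-1)%R.
  pose c n := mkv (fun i => pr i box_hi - n.+1%:R^-1)%R.
  have sub n : cbox (a n) (c n - h *: e + h *: e)%R `<=` D.
    by rewrite subrK; apply: subset_trans BD; exact: box1_exhaust.
  have A n := weak_derivative_shift h0 wd e0 (sub n).
  have : {ae mu, forall (z : mV) n, obox (a n) (c n - h *: e)%R z ->
    `|f z|%:E <= `|f ((z : V) + h *: e)%R|%:E +
      \int[leb]_(s in `[0%R, h]) `|g ((z : V) + s *: e)%R|%:E}.
    exact/ae_foralln.
  apply: filterS => z hz [/= Bz _ Bh]; apply/negP; rewrite -leNgt.
  have [n hn] := box1_exhausted Bz Bh.
  have zn : obox (a n) (c n - h *: e)%R z.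
    move=> i; have [h1 h2] := hn i; rewrite prB prZ !pr_mkv h1/=.
    by move: h2; rewrite prD prZ -ltrBrDr addrAC.
  have := hz _ zn; rewrite /q1 /q2 kE /= !cutE//; congr (_ <= _ + _).
  apply: eq_integral => s; rewrite inE/= in_itv/= => hs; rewrite cutE//.
  exact: box1_convex hs Bz Bh.
have := ae_xsection mN NE; apply: filterS => z Nz Bz.
apply: filterS Nz => h Nh h0 Bh; rewrite leNgt; apply/negP => lt.
by apply: Nh; split => //; rewrite /q1 /q2 kE.
Qed.
End reference_box.
Arguments box1 {R}.

(** * Sobolev inequality on cubes *)

Section cauchy_schwarz.
Local Open Scope ereal_scope.
Context d (T : measurableType d) (R : realType) (mu : {measure set T -> \bar R}).

Lemma mule_le_amgm (s a b : \bar R) (k : R) : 0 <= s -> 0 <= a -> 0 <= b ->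
  (0 < k)%R -> s * s <= a * b -> s <= (k / 2)%:E * a + (k^-1 / 2)%:E * b.
Proof.
move=> s0 a0 b0 k0.
have k2 : (0 < k / 2)%R by rewrite divr_gt0.
have k2' : (0 < k^-1 / 2)%R by rewrite divr_gt0// invr_gt0.
case: a a0 => [a| |]//; last first.
  by move=> _ _; rewrite gt0_muley ?lte_fin// addye ?leey// gt_eqF// (lt_le_trans ltNy0)// mule_ge0// lee_fin ltW.
case: b b0 => [b| |]//; last first.
  by move=> _ _ _; rewrite gt0_muley ?lte_fin// addey ?leey// gt_eqF// ltNyr.
case: s s0 => [s| |]//.
rewrite -!EFinM -EFinD !lee_fin => s0 b0 a0 h.
set x := (k / 2 * a)%R; set y := (k^-1 / 2 * b)%R.
have x0 : (0 <= x)%R by rewrite mulr_ge0// ltW.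
have y0 : (0 <= y)%R by rewrite mulr_ge0// ltW.
have xy : (4 * (x * y) = a * b)%R by rewrite /x /y; field; rewrite gt_eqF.
rewrite -(@ler_pXn2r _ 2)// ?nnegrE ?addr_ge0// expr2 (le_trans h)// -xy.
by rewrite -subr_ge0 (_ : _ - _ = (x - y) ^+ 2)%R ?sqr_ge0//; ring.
Qed.

(** Integrate S <= k A / 2 + B / (2 k) and optimise in k. The hypothesis S^2 <= A B and the squared
    conclusion avoid square roots and any finiteness assumption. *)
Lemma cauchy_schwarz (S A B : T -> \bar R) :
  measurable_fun setT S -> measurable_fun setT A -> measurable_fun setT B ->
  (forall x, 0 <= S x) -> (forall x, 0 <= A x) -> (forall x, 0 <= B x) ->
  (forall x, S x * S x <= A x * B x) ->
  (\int[mu]_x S x) * (\int[mu]_x S x) <= (\int[mu]_x A x) * (\int[mu]_x B x).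
Proof.
move=> mS mA mB S0 A0 B0 SAB.
have iA0 : 0 <= \int[mu]_x A x by exact: integral_ge0.
have iB0 : 0 <= \int[mu]_x B x by exact: integral_ge0.
(* With the convention that 0 times infinity is 0, a factor of zero integral must force the integral
   of [S] to vanish even when the other one is infinite. *)
have zero (A' B' : T -> \bar R) : measurable_fun setT A' -> (forall x, 0 <= A' x) ->
    (forall x, S x * S x <= A' x * B' x) -> \int[mu]_x A' x = 0 -> \int[mu]_x S x = 0.
  move=> mA' A'0 h iA'.
  have /(_ _)/wrap[|aeA] := (ae_eq_integral_abs mu measurableT mA').1.
    by under eq_integral do rewrite gee0_abs//.
  rewrite -[RHS](integral0 mu setT); apply: ae_eq_integral => //.
  apply: filterS aeA => x /(_ I) Ax _; have := h x; rewrite Ax mul0e => SS.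
  apply/eqP; rewrite eq_le S0 andbT leNgt; apply/negP => Sx.
  by move: SS; rewrite leNgt mule_gt0.
have [a0|a0] := eqVneq (\int[mu]_x A x) 0.
  by rewrite (zero A B)// mul0e mule_ge0.
have [b0|b0] := eqVneq (\int[mu]_x B x) 0.
  by rewrite (zero B A)// ?mul0e ?mule_ge0// => x; rewrite muleC.
have key (k : R) : (0 < k)%R ->
    \int[mu]_x S x <= (k / 2)%:E * \int[mu]_x A x + (k^-1 / 2)%:E * \int[mu]_x B x.
  move=> k0.
  have k2 : (0 <= k / 2)%R by rewrite divr_ge0// ltW.
  have k2' : (0 <= k^-1 / 2)%R by rewrite divr_ge0// invr_ge0 ltW.
  rewrite -!ge0_integralZl//; rewrite ?lee_fin//.
  rewrite -ge0_integralD//; last 4 first.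
  - by move=> x _; rewrite mule_ge0.
  - exact: measurable_funeM.
  - by move=> x _; rewrite mule_ge0.
  - exact: measurable_funeM.
  apply: ge0_le_integral => //.
    by apply: emeasurable_funD; exact: measurable_funeM.
  by move=> x _; exact: mule_le_amgm.
move: key a0 b0 iA0 iB0.
move: (\int[mu]_x A x) (\int[mu]_x B x) => [a| |] [b| |] // key a0 b0 iA0 iB0; last 3 first.
- by rewrite gt0_muley ?leey// lt0e a0.
- by rewrite gt0_mulye ?leey// lt0e b0.
- by rewrite mulyy leey.
have {}a0 : (0 < a)%R by rewrite lt_neqAle eq_sym -eqe a0.
have {}b0 : (0 < b)%R by rewrite lt_neqAle eq_sym -eqe b0.
(* The minimiser of k a / 2 + b / (2 k), for which both terms are equal. *)
have k0 : (0 < Num.sqrt (b / a))%R by rewrite sqrtr_gt0 divr_gt0.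
have := key _ k0; have : 0 <= \int[mu]_x S x by exact: integral_ge0.
case: (\int[mu]_x S x) => [s| |]//; rewrite -!EFinM -EFinD !lee_fin => s0.
set k := Num.sqrt (b / a) => sk.
have ka : (k * k * a = b)%R.
  by rewrite -expr2 sqr_sqrtr ?divr_ge0 ?ltW//; field; rewrite gt_eqF.
have kab : (k / 2 * a + k^-1 / 2 * b = k * a)%R by rewrite -ka; field; rewrite gt_eqF.
rewrite kab in sk; rewrite -ka.
by apply: (le_trans (ler_pM s0 s0 sk sk)); rewrite le_eqVlt; apply/orP; left; apply/eqP; ring.
Qed.
End cauchy_schwarz.

(** * From bounds on lines to the cube of a function *)

Section loomis_whitney.
Local Open Scope ereal_scope.
Variable R : realType.
Local Notation mR := (measurableTypeR R).
Local Notation leb := (@lebesgue_measure R).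

(** On a slice x3 = c, K^3 is the product of K^2 and K: the integral of K^4 is at most that of M1
    (x2, c) M2 (x1, c), which splits, and K^2 is bounded by [M3]. A second Cauchy-Schwarz
    inequality, in c, puts the slices together. *)
Lemma loomis_whitney (K : mspace R -> R) (M1 M2 M3 : mR * mR -> \bar R) :
  measurable_fun setT K -> measurable_fun setT M1 -> measurable_fun setT M2 ->
  measurable_fun setT M3 ->
  (forall x, 0 <= K x)%R -> (forall y, 0 <= M1 y) -> (forall y, 0 <= M2 y) ->
  (forall y, 0 <= M3 y) ->
  (forall x, (K x ^+ 2)%:E <= M1 (x.1.2, x.2)) ->
  (forall x, (K x ^+ 2)%:E <= M2 (x.1.1, x.2)) ->
  (forall x, (K x ^+ 2)%:E <= M3 x.1) ->
  (\int[leb3 R]_x (K x ^+ 3)%:E) * (\int[leb3 R]_x (K x ^+ 3)%:E) <=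
  (\int[leb2 R]_y M1 y) * (\int[leb2 R]_y M2 y) * (\int[leb2 R]_y M3 y).
Proof.
move=> mK mM1 mM2 mM3 K0 M10 M20 M30 KM1 KM2 KM3.
have mKn n : measurable_fun setT (fun x => (K x ^+ n)%:E).
  by apply/measurable_EFinP; exact: measurable_funX.
have Kn0 n x : 0 <= (K x ^+ n)%:E by rewrite lee_fin exprn_ge0.
have mKs n (c : mR) : measurable_fun setT (fun y : mR * mR => (K (y, c) ^+ n)%:E).
  exact: (measurableT_comp (mKn n) (measurable_pair2 c)).
pose S (c : mR) := \int[leb2 R]_y (K (y, c) ^+ 3)%:E.
have SE : \int[leb3 R]_x (K x ^+ 3)%:E = \int[leb]_c S c.
  exact: (fubini_tonelli2 (fun x : mspace R => (K x ^+ 3)%:E)).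
have mS : measurable_fun setT S.
  exact: (measurable_fun_fubini_tonelli_G (fun x : mspace R => (K x ^+ 3)%:E)).
pose A1 (c : mR) := \int[leb]_b M1 (b, c).
pose A2 (c : mR) := \int[leb]_a M2 (a, c).
have mA1 : measurable_fun setT A1 by exact: measurable_fun_fubini_tonelli_G.
have mA2 : measurable_fun setT A2 by exact: measurable_fun_fubini_tonelli_G.
have A10 c : 0 <= A1 c by exact: integral_ge0.
have A20 c : 0 <= A2 c by exact: integral_ge0.
set N3 := \int[leb2 R]_y M3 y.
have N30 : 0 <= N3 by exact: integral_ge0.
have SS c : S c * S c <= (A1 c * N3) * A2 c.
  apply: le_trans (_ : (\int[leb2 R]_y (K (y, c) ^+ 4)%:E) * (\int[leb2 R]_y (K (y, c) ^+ 2)%:E) <= _).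
    apply: cauchy_schwarz => //.
    by move=> y; rewrite -!EFinM lee_fin -!exprD.
  rewrite muleAC; apply: lee_pmul => //; [exact: integral_ge0|exact: integral_ge0| |]; last first.
    by apply: ge0_le_integral => // y _; exact: KM3.
  apply: le_trans (_ : \int[leb2 R]_y (M1 (y.2, c) * M2 (y.1, c)) <= _).
    have m1 : measurable_fun setT (fun y : mR * mR => M1 (y.2, c)).
      exact: (measurableT_comp mM1 (measurableT_comp (measurable_pair2 c) measurable_snd)).
    have m2 : measurable_fun setT (fun y : mR * mR => M2 (y.1, c)).
      exact: (measurableT_comp mM2 (measurableT_comp (measurable_pair2 c) measurable_fst)).
    apply: ge0_le_integral => //; first exact: emeasurable_funM.
    move=> y _; apply: le_trans (_ : (K (y, c) ^+ 2)%:E * (K (y, c) ^+ 2)%:E <= _).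
      by rewrite -EFinM -exprD.
    by apply: lee_pmul; [exact: Kn0|exact: Kn0|exact: (KM1 (y, c))|exact: (KM2 (y, c))].
  have m12 : measurable_fun setT (fun y : mR * mR => M1 (y.2, c) * M2 (y.1, c)).
    apply: emeasurable_funM.
      exact: (measurableT_comp mM1 (measurableT_comp (measurable_pair2 c) measurable_snd)).
    exact: (measurableT_comp mM2 (measurableT_comp (measurable_pair2 c) measurable_fst)).
  have m12_0 (y : mR * mR) : 0 <= M1 (y.2, c) * M2 (y.1, c) by exact: mule_ge0.
  rewrite [leLHS](fubini_tonelli1 _ m12 m12_0) /fubini_F /=.
  have mc1 : measurable_fun setT (fun b => M1 (b, c)).
    exact: (measurableT_comp mM1 (measurable_pair2 c)).
  have mc2 : measurable_fun setT (fun a => M2 (a, c)).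
    exact: (measurableT_comp mM2 (measurable_pair2 c)).
  under eq_integral do rewrite ge0_integralZr//.
  by rewrite ge0_integralZl//; exact: integral_ge0.
rewrite SE.
have := @cauchy_schwarz _ _ _ leb S (fun c => A1 c * N3) A2.
have -> : \int[leb]_c (A1 c * N3) = (\int[leb2 R]_y M1 y) * N3.
  by rewrite ge0_integralZr// [in RHS](fubini_tonelli2 M1).
have -> : \int[leb]_c A2 c = \int[leb2 R]_y M2 y by rewrite [in RHS](fubini_tonelli2 M2).
rewrite muleAC; apply => //.
- exact: emeasurable_funM.
- by move=> c; exact: integral_ge0.
- by move=> c; exact: mule_ge0.
Qed.
End loomis_whitney.

Section slices.
Local Open Scope ereal_scope.

(** [P] need not be measurable: the argument runs on a measurable null set containing its
    failures. *)
Lemma ae_ysection d1 d2 (T1 : measurableType d1) (T2 : measurableType d2)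
    (R : realType) (m1 : {sigma_finite_measure set T1 -> \bar R})
    (m2 : {sigma_finite_measure set T2 -> \bar R}) (P : T1 * T2 -> Prop) :
  {ae (m1 \x m2), forall z, P z} ->
  {ae m2, forall y, {ae m1, forall x, P (x, y)}}.
Proof.
move=> [N [mN N0 PN]].
have mI : measurable_fun setT (fun p => (\1_N p : R)%:E).
  by apply/measurable_EFinP; exact: measurable_indic.
have I0p p : 0 <= (\1_N p : R)%:E by rewrite lee_fin.
have mI2 : measurable_fun setT (fun y => \int[m1]_x (\1_N (x, y) : R)%:E).
  exact: (measurable_fun_fubini_tonelli_G (fun p => (\1_N p : R)%:E)).
have I0 : \int[m2]_y \int[m1]_x (\1_N (x, y) : R)%:E = 0.
  by rewrite -(fubini_tonelli2 (fun p => (\1_N p : R)%:E))// integral_indic// setIT.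
have := (ae_eq_integral_abs m2 measurableT mI2).1.
under eq_integral do rewrite gee0_abs ?integral_ge0//.
move=> /(_ I0); apply: filterS => y /(_ I) Iy.
have my : measurable_fun setT (fun x => (\1_N (x, y) : R)%:E).
  exact: (measurableT_comp mI (measurable_pair2 y)).
have := (ae_eq_integral_abs m1 measurableT my).1.
under eq_integral do rewrite gee0_abs//.
move=> /(_ Iy); apply: filterS => x /(_ I) /= E0.
apply: contrapT => nP; move: E0; rewrite indicE mem_set; last exact: PN.
by move=> -[] /eqP; rewrite oner_eq0.
Qed.

Variable R : realType.
Local Notation mR := (measurableTypeR R).
Local Notation leb := (@lebesgue_measure R).

Lemma ge0_integral_shift_le (q : mR -> \bar R) (x : R) (J I : set mR) :
  measurable J -> measurable I -> measurable_fun setT q -> (forall s, 0 <= q s) ->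
  (forall h : R, J h -> I (x + h)%R) ->
  \int[leb]_(h in J) q (x + h)%R <= \int[leb]_(s in I) q s.
Proof.
move=> mJ mI mq q0 JI; rewrite integral_mkcond [leRHS]integral_mkcond.
have mqI : measurable_fun setT (q \_ I).
  by apply/(measurable_restrictT _ mI); exact: measurable_funS mq.
have qI0 s : 0 <= (q \_ I) s by rewrite patchE; case: ifP.
rewrite -(ge0_integral_preserves (preserves_lebesgue_shift x) mqI qI0).
have msh : measurable_fun setT (fun h : mR => (h + x)%R : mR).
  by have [] := preserves_lebesgue_shift x.
apply: ge0_le_integral => //.
- by move=> h _; rewrite patchE; case: ifP.
- apply/(measurable_restrictT _ mJ).
  have := measurable_funS measurableT (@subsetT _ J) (measurableT_comp mq msh).
  by under [X in measurable_fun _ X -> _]eq_fun do rewrite /= addrC.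
- exact: (measurableT_comp mqI msh).
- move=> h _; rewrite !patchE; case: ifPn => hJ; last by case: ifP.
  by rewrite mem_set addrC//; apply: JI; rewrite inE in hJ.
Qed.

(** Square the inequality, bound the square of the integral of |gam| by delta times that of gam^2,
    and average over h in ]0, delta[. As delta <= r, the points x + h stay in ]-2r, 2r[, whence the
    doubled interval. *)
Lemma line_average (phi gam : mR -> R) (x r delta : R) :
  measurable_fun setT phi -> measurable_fun setT gam ->
  (- r < x < r)%R -> (0 < delta <= r)%R ->
  {ae leb, forall h : mR, (0 < h)%R -> (h < r)%R ->
    `|phi x|%:E <= `|phi (x + h)%R|%:E + \int[leb]_(s in `[0%R, h]) `|gam (x + s)%R|%:E} ->
  (phi x ^+ 2)%:E <=
    (2 / delta)%:E * \int[leb]_(s in `](- (2 * r))%R, (2 * r)%R[) (phi s ^+ 2)%:E +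
    (2 * delta)%:E * \int[leb]_(s in `](- (2 * r))%R, (2 * r)%R[) (gam s ^+ 2)%:E.
Proof.
move=> mphi mgam /andP[xr1 xr2] /andP[d0 dr] H.
pose I : set mR := `](- (2 * r))%R, (2 * r)%R[%classic.
pose J : set mR := `]0%R, delta[%classic.
pose Jc : set mR := `[0%R, delta]%classic.
have mI : measurable I by exact: measurable_itv.
have mJ : measurable J by exact: measurable_itv.
have mJc : measurable Jc by exact: measurable_itv.
have msq (k : mR -> R) : measurable_fun setT k -> measurable_fun setT (fun s => (k s ^+ 2)%:E).
  by move=> mk; apply/measurable_EFinP; exact: measurable_funX.
have msh (k : mR -> R) : measurable_fun setT k -> measurable_fun setT (fun h : mR => k (x + h)%R).
  have m1 : measurable_fun setT (fun h : mR => (h + x)%R : mR).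
    by have [] := preserves_lebesgue_shift x.
  move=> mk; have := measurableT_comp mk m1.
  by under [X in measurable_fun _ X -> _]eq_fun do rewrite /= addrC.
set P := \int[leb]_(s in I) (phi s ^+ 2)%:E.
set Gm := \int[leb]_(s in I) (gam s ^+ 2)%:E.
have P0 : 0 <= P by apply: integral_ge0 => s _; rewrite lee_fin sqr_ge0.
have Gm0 : 0 <= Gm by apply: integral_ge0 => s _; rewrite lee_fin sqr_ge0.
have d2 : (0 < 2 * delta)%R by rewrite mulr_gt0.
have [Gmy|Gmy] := eqVneq Gm +oo.
  rewrite Gmy gt0_muley ?lte_fin// addey ?leey// gt_eqF// (lt_le_trans ltNy0)//.
  by rewrite mule_ge0// lee_fin divr_ge0// ltW.
set g := \int[leb]_(s in Jc) `|gam (x + s)%R|%:E.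
have g0 : 0 <= g by apply: integral_ge0 => s _; rewrite lee_fin.
have JcI (h : R) : Jc h -> I (x + h)%R.
  by rewrite /Jc /I /= !in_itv/= => /andP[? ?]; apply/andP; split; lra.
have JI (h : R) : J h -> I (x + h)%R.
  by rewrite /J /I /= !in_itv/= => /andP[? ?]; apply/andP; split; lra.
have lenJc : leb Jc = delta%:E.
  have -> : leb Jc = leb (`[0%R, delta]%classic : set R) by [].
  by rewrite lebesgue_measure_itv/= lte_fin d0 -EFinD subr0.
have lenJ : leb J = delta%:E.
  have -> : leb J = leb (`]0%R, delta[%classic : set R) by [].
  by rewrite lebesgue_measure_itv/= lte_fin d0 -EFinD subr0.
(* Cauchy-Schwarz against the indicator of [0, delta]. *)
have gg : g * g <= delta%:E * Gm.
  have -> : g = \int[leb]_s (`|gam (x + s)%R| * \1_Jc s)%:E.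
    rewrite /g integral_mkcond; apply: eq_integral => s _.
    by rewrite patchE indicE; case: ifP => _; rewrite ?mulr1 ?mulr0.
  apply: le_trans (_ : (\int[leb]_s (\1_Jc s : R)%:E) *
      (\int[leb]_s (gam (x + s)%R ^+ 2 * \1_Jc s)%:E) <= _).
    apply: cauchy_schwarz.
    - apply/measurable_EFinP; apply: measurable_funM; last exact: measurable_indic.
      by apply: measurableT_comp => //; exact: msh.
    - by apply/measurable_EFinP; exact: measurable_indic.
    - apply/measurable_EFinP; apply: measurable_funM; last exact: measurable_indic.
      by apply: measurable_funX; exact: msh.
    - by move=> s; rewrite lee_fin mulr_ge0.
    - by move=> s; rewrite lee_fin.
    - by move=> s; rewrite lee_fin mulr_ge0// sqr_ge0.
    - move=> s; rewrite -!EFinM lee_fin indicE; case: (s \in Jc); rewrite /= ?mulr0// !mulr1 mul1r.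
      by rewrite -expr2 real_normK ?num_real.
  have -> : \int[leb]_s (\1_Jc s : R)%:E = delta%:E.
    by rewrite integral_indic// setIT; exact: lenJc.
  rewrite lee_pmul2l ?lte_fin//.
  have -> : \int[leb]_s (gam (x + s)%R ^+ 2 * \1_Jc s)%:E =
      \int[leb]_(s in Jc) (gam (x + s)%R ^+ 2)%:E.
    rewrite [RHS]integral_mkcond; apply: eq_integral => s _.
    by rewrite patchE indicE; case: ifP => _; rewrite ?mulr1 ?mulr0.
  apply: (ge0_integral_shift_le (q := fun s => (gam s ^+ 2)%:E)) => //; first exact: msq.
  by move=> s; rewrite lee_fin sqr_ge0.
have gfin : g \is a fin_num.
  rewrite ge0_fin_numE//; case: g g0 gg => [s _ _| _ |//]; first exact: ltry.
  rewrite mulyy.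
  by rewrite leye_eq => /eqP E; move: Gmy; move: E Gm0; case: Gm.
set g' := fine g.
have step : (delta * phi x ^+ 2)%:E <= 2%:E * P + (2 * delta * g' ^+ 2)%:E.
  have -> : (delta * phi x ^+ 2)%:E = \int[leb]_(h in J) (cst (phi x ^+ 2)%:E) h.
    rewrite integral_cst// EFinM muleC; congr (_ * _); exact/esym.
  apply: le_trans (_ : \int[leb]_(h in J) (2%:E * (phi (x + h)%R ^+ 2)%:E + (2 * g' ^+ 2)%:E) <= _).
    have m1 : measurable_fun J (fun h : mR => 2%:E * (phi (x + h)%R ^+ 2)%:E).
      apply: measurable_funTS; apply: measurable_funeM; apply: msq; exact: msh.
    apply: ae_ge0_le_integral => //.
    - by move=> h _; rewrite lee_fin sqr_ge0.
    - by move=> h _; rewrite -EFinM -EFinD lee_fin addr_ge0// mulr_ge0// sqr_ge0.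
    - by apply: emeasurable_funD => //; exact: measurable_cst.
    - apply: filterS H => h Hh; rewrite /J/= in_itv/= => /andP[h0 hd].
      have gh : \int[leb]_(s in `[0%R, h]) `|gam (x + s)%R|%:E <= g.
        apply: ge0_subset_integral => //.
        + apply: measurable_funTS; apply/measurable_EFinP; apply: measurableT_comp => //.
          exact: msh.
        + by move=> s; rewrite /Jc /= !in_itv/= => /andP[-> /le_trans]; apply; exact: ltW.
      have := le_trans (Hh h0 (lt_le_trans hd dr)) (leeD2l _ gh).
      rewrite -(fineK gfin) -EFinD -EFinM -EFinD !lee_fin -/g' => h1.
      have p0 : (0 <= `|phi x|)%R by [].
      have q0 : (0 <= `|phi (x + h)%R|)%R by [].
      have g'0 : (0 <= g')%R by rewrite fine_ge0.
      rewrite -(real_normK (num_real (phi x))) -(real_normK (num_real (phi (x + h)%R))).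
      have := ler_pM p0 p0 h1 h1; have := sqr_ge0 (`|phi (x + h)%R| - g')%R.
      by rewrite !expr2; lra.
  have m1 : measurable_fun J (fun h : mR => (phi (x + h)%R ^+ 2)%:E).
    by apply: measurable_funTS; apply: msq; exact: msh.
  have p0 (h : mR) : J h -> 0 <= (phi (x + h)%R ^+ 2)%:E by rewrite lee_fin sqr_ge0.
  have m2 : measurable_fun J (fun h : mR => 2%:E * (phi (x + h)%R ^+ 2)%:E).
    exact: measurable_funeM.
  have q0 (h : mR) : J h -> 0 <= 2%:E * (phi (x + h)%R ^+ 2)%:E.
    by move=> hJ; rewrite mule_ge0// p0.
  have c0 (h : mR) : J h -> 0 <= (2 * g' ^+ 2)%:E by rewrite lee_fin mulr_ge0// sqr_ge0.
  rewrite (ge0_integralD leb mJ q0 m2 c0 (measurable_cst _)) (ge0_integralZl leb mJ m1 p0)//.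
  apply: leeD.
    rewrite lee_pmul2l ?lte_fin//.
    apply: (ge0_integral_shift_le (q := fun s => (phi s ^+ 2)%:E)) => //; first exact: msq.
    by move=> s; rewrite lee_fin sqr_ge0.
  rewrite integral_cst//; have E : leb J = delta%:E := lenJ.
  by rewrite [X in _ * X]E -EFinM lee_fin mulrAC.
rewrite -(@lee_pmul2l _ delta%:E)// ?lte_fin// -EFinM.
have A0 : 0 <= (2 / delta)%:E * P by rewrite mule_ge0// lee_fin divr_ge0// ltW.
have B0 : 0 <= (2 * delta)%:E * Gm by rewrite mule_ge0// lee_fin ltW.
apply: (le_trans step); rewrite (ge0_muleDr delta%:E A0 B0).
rewrite !muleA -!EFinM; apply: leeD.
  by have -> : (delta * (2 / delta) = 2)%R; [field; rewrite gt_eqF|].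
have -> : (2 * delta * g' ^+ 2)%:E = (2 * delta)%:E * (g * g).
  by rewrite -(fineK gfin) -!EFinM expr2.
rewrite (_ : (delta * (2 * delta))%:E = (2 * delta)%:E * delta%:E); last by rewrite -EFinM mulrC.
by rewrite -muleA lee_pmul2l ?lte_fin.
Qed.

End slices.

Section sobolev_slice.
Variable R : realType.
Local Notation mR := (measurableTypeR R).
Local Notation leb := (@lebesgue_measure R).
Local Open Scope ereal_scope.

Definition scube (r : R) : set (mspace R) :=
  [set x | [/\ - r < x.1.1 < r, - r < x.1.2 < r & - r < x.2 < r]%R].

Lemma scubeE (r : R) : scube r = (`](- r)%R, r[%classic `*` `](- r)%R, r[%classic) `*` `](- r)%R, r[%classic
  :> set (mspace R).
Proof.
apply/seteqP; split=> x /=; rewrite !in_itv/=; first by move=> [? ? ?]; do !split.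
by move=> [[? ?] ?]; split.
Qed.

Lemma measurable_scube r : measurable (scube r).
Proof. by rewrite scubeE; do 2?apply: measurableX; exact: measurable_itv. Qed.

Lemma scubeS (r1 r2 : R) : (r1 <= r2)%R -> scube r1 `<=` scube r2.
Proof.
move=> r12 x; have w (a : R) : (- r1 < a < r1)%R -> (- r2 < a < r2)%R.
  by rewrite -!ltr_norml => /lt_le_trans; apply.
by move=> [c1 c2 c3]; split; exact: w.
Qed.

Lemma tonelli_x1 (F : mspace R -> \bar R) : measurable_fun setT F -> (forall x, 0 <= F x) ->
  \int[leb2 R]_y \int[leb]_s F ((s, y.1), y.2) = \int[leb3 R]_x F x.
Proof.
move=> mF F0; rewrite [RHS](fubini_tonelli2 F mF F0) /fubini_G.
have m3 : measurable_fun setT (fun w : (mR * mR) * mR => ((w.2, w.1.1), w.1.2) : mspace R).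
  apply: measurable_fun_pair; last exact: (measurableT_comp measurable_snd measurable_fst).
  apply: measurable_fun_pair; first exact: measurable_snd.
  exact: (measurableT_comp measurable_fst measurable_fst).
have mG : measurable_fun setT (fun y : mR * mR => \int[leb]_s F ((s, y.1), y.2)).
  exact: (measurable_fun_fubini_tonelli_F (fun w : (mR * mR) * mR => F ((w.2, w.1.1), w.1.2))
    (measurableT_comp mF m3)).
have G0 (y : mR * mR) : 0 <= \int[leb]_s F ((s, y.1), y.2) by exact: integral_ge0.
rewrite [LHS](fubini_tonelli2 _ mG G0); apply: eq_integral => c _.
have mFc : measurable_fun setT (fun y => F (y, c)) by exact: (measurableT_comp mF (measurable_pair2 c)).
by rewrite [RHS](fubini_tonelli2 _ mFc).
Qed.

Lemma tonelli_x2 (F : mspace R -> \bar R) : measurable_fun setT F -> (forall x, 0 <= F x) ->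
  \int[leb2 R]_y \int[leb]_s F ((y.1, s), y.2) = \int[leb3 R]_x F x.
Proof.
move=> mF F0; rewrite [RHS](fubini_tonelli2 F mF F0) /fubini_G.
have m3 : measurable_fun setT (fun w : (mR * mR) * mR => ((w.1.1, w.2), w.1.2) : mspace R).
  apply: measurable_fun_pair; last exact: (measurableT_comp measurable_snd measurable_fst).
  apply: measurable_fun_pair; last exact: measurable_snd.
  exact: (measurableT_comp measurable_fst measurable_fst).
have mG : measurable_fun setT (fun y : mR * mR => \int[leb]_s F ((y.1, s), y.2)).
  exact: (measurable_fun_fubini_tonelli_F (fun w : (mR * mR) * mR => F ((w.1.1, w.2), w.1.2))
    (measurableT_comp mF m3)).
have G0 (y : mR * mR) : 0 <= \int[leb]_s F ((y.1, s), y.2) by exact: integral_ge0.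
rewrite [LHS](fubini_tonelli2 _ mG G0); apply: eq_integral => c _.
have mFc : measurable_fun setT (fun y => F (y, c)) by exact: (measurableT_comp mF (measurable_pair2 c)).
by rewrite [RHS](fubini_tonelli1 _ mFc).
Qed.

Lemma tonelli_x3 (F : mspace R -> \bar R) : measurable_fun setT F -> (forall x, 0 <= F x) ->
  \int[leb2 R]_y \int[leb]_s F (y, s) = \int[leb3 R]_x F x.
Proof. by move=> mF F0; rewrite [RHS](fubini_tonelli1 F mF F0). Qed.

(** One proof for the three directions: [p] reads the moving coordinate, [q] the other two, and [io]
    puts them back together. The majorant is constant along the line, as Loomis-Whitney requires. *)
Lemma line_majorant (io : mR * mR -> mR -> mspace R) (p : mspace R -> R)
    (q : mspace R -> mR * mR) (phi gam : mspace R -> R) (r delta : R) :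
  measurable_fun setT (fun w : (mR * mR) * mR => io w.1 w.2) ->
  (forall x, io (q x) (p x) = x) ->
  (forall x, scube r x -> - r < p x < r)%R ->
  (forall x s, scube r x -> (- (2 * r) < s < 2 * r)%R -> scube (2 * r) (io (q x) s)) ->
  (forall F : mspace R -> \bar R, measurable_fun setT F -> (forall x, 0 <= F x) ->
    \int[leb2 R]_y \int[leb]_s F (io y s) = \int[leb3 R]_x F x) ->
  measurable_fun setT phi -> measurable_fun setT gam -> (0 < delta <= r)%R ->
  {ae leb3 R, forall x, scube r x -> {ae leb, forall h : mR, (0 < h)%R -> (h < r)%R ->
    `|phi x|%:E <= `|phi (io (q x) (p x + h)%R)|%:E +
      \int[leb]_(s in `[0%R, h]) `|gam (io (q x) (p x + s)%R)|%:E}} ->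
  exists M : mR * mR -> \bar R, [/\ measurable_fun setT M, forall y, 0 <= M y,
    {ae leb3 R, forall x, scube r x -> (phi x ^+ 2)%:E <= M (q x)} &
    \int[leb2 R]_y M y = (2 / delta)%:E * \int[leb3 R]_(x in scube (2 * r)) (phi x ^+ 2)%:E +
      (2 * delta)%:E * \int[leb3 R]_(x in scube (2 * r)) (gam x ^+ 2)%:E].
Proof.
move=> mio ioE prange iorange tonelli mphi mgam hd H.
have /andP[d0 dr] := hd.
have d1 : (0 <= 2 / delta)%R by rewrite divr_ge0// ltW.
have d2 : (0 <= 2 * delta)%R by rewrite mulr_ge0// ltW.
have mC := measurable_scube (2 * r).
pose sq (f : mspace R -> R) : mspace R -> \bar R := (fun x => (f x ^+ 2)%:E) \_ (scube (2 * r)).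
have msq f : measurable_fun setT f -> measurable_fun setT (sq f).
  move=> mf; apply/(measurable_restrictT _ mC); apply: measurable_funTS.
  by apply/measurable_EFinP; exact: measurable_funX.
have sq0 f x : 0 <= sq f x by rewrite /sq patchE; case: ifP => // _; rewrite lee_fin sqr_ge0.
pose L f (y : mR * mR) := \int[leb]_s sq f (io y s).
have mL f : measurable_fun setT f -> measurable_fun setT (L f).
  move=> mf; apply: (measurable_fun_fubini_tonelli_F (fun w : (mR * mR) * mR => sq f (io w.1 w.2))) => //.
  exact: (measurableT_comp (msq _ mf) mio).
have L0 f y : 0 <= L f y by exact: integral_ge0.
have iL f : measurable_fun setT f -> \int[leb2 R]_y L f y = \int[leb3 R]_(x in scube (2 * r)) (f x ^+ 2)%:E.
  by move=> mf; rewrite tonelli//; [rewrite [RHS]integral_mkcond|exact: msq].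
exists (fun y => (2 / delta)%:E * L phi y + (2 * delta)%:E * L gam y); split.
- by apply: emeasurable_funD; apply: measurable_funeM; exact: mL.
- by move=> y; rewrite adde_ge0// mule_ge0.
- apply: filterS H => x Hx xr.
  have mline (f : mspace R -> R) : measurable_fun setT f -> measurable_fun setT (fun s : mR => f (io (q x) s)).
    move=> mf; exact: (measurableT_comp mf (measurableT_comp mio (measurable_pair1 (q x)))).
  have := line_average (phi := fun s => phi (io (q x) s)) (gam := fun s => gam (io (q x) s))
    (mline _ mphi) (mline _ mgam) (prange _ xr) hd.
  rewrite ioE => /(_ (Hx xr)) /le_trans; apply.
  have key (f : mspace R -> R) : measurable_fun setT f ->
      \int[leb]_(s in `](- (2 * r))%R, (2 * r)%R[) (f (io (q x) s) ^+ 2)%:E <= L f (q x).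
    move=> mf; rewrite integral_mkcond; apply: ge0_le_integral => //.
    + by move=> s _; rewrite patchE; case: ifP => // _; rewrite lee_fin sqr_ge0.
    + apply/(measurable_restrictT _ (measurable_itv _)); apply: measurable_funTS.
      by apply/measurable_EFinP; apply: measurable_funX; exact: mline.
    + exact: (measurableT_comp (msq _ mf) (measurableT_comp mio (measurable_pair1 (q x)))).
    + move=> s _; rewrite patchE; case: ifPn => // sI; rewrite /sq patchE mem_set//.
      by apply: iorange => //; move: sI; rewrite inE/= in_itv.
  by apply: leeD; apply: lee_wpmul2l; rewrite ?lee_fin//; exact: key.
- rewrite ge0_integralD//; last 4 first.
  + by move=> y _; rewrite mule_ge0.
  + by apply: measurable_funeM; exact: mL.
  + by move=> y _; rewrite mule_ge0.
  + by apply: measurable_funeM; exact: mL.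
  rewrite !ge0_integralZl//; try exact: mL.
  by rewrite !iL.
Qed.

Definition line_energy (r delta : R) (phi g : mspace R -> R) : \bar R :=
  (2 / delta)%:E * \int[leb3 R]_(x in scube (2 * r)) (phi x ^+ 2)%:E +
  (2 * delta)%:E * \int[leb3 R]_(x in scube (2 * r)) (g x ^+ 2)%:E.

(** The three majorants of phi^2, one for each direction, are fed to [loomis_whitney]. The parameter
    [delta] stays free, to be optimised according to the size of the two integrals in
    [line_energy]. *)
Lemma sobolev_slice (phi g1 g2 g3 : mspace R -> R) (r delta : R) :
  measurable_fun setT phi -> measurable_fun setT g1 -> measurable_fun setT g2 ->
  measurable_fun setT g3 -> (0 < delta <= r)%R ->
  {ae leb3 R, forall x, scube r x -> {ae leb, forall h : mR, (0 < h)%R -> (h < r)%R ->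
    `|phi x|%:E <= `|phi ((x.1.1 + h)%R, x.1.2, x.2)|%:E +
      \int[leb]_(s in `[0%R, h]) `|g1 ((x.1.1 + s)%R, x.1.2, x.2)|%:E}} ->
  {ae leb3 R, forall x, scube r x -> {ae leb, forall h : mR, (0 < h)%R -> (h < r)%R ->
    `|phi x|%:E <= `|phi (x.1.1, (x.1.2 + h)%R, x.2)|%:E +
      \int[leb]_(s in `[0%R, h]) `|g2 (x.1.1, (x.1.2 + s)%R, x.2)|%:E}} ->
  {ae leb3 R, forall x, scube r x -> {ae leb, forall h : mR, (0 < h)%R -> (h < r)%R ->
    `|phi x|%:E <= `|phi (x.1.1, x.1.2, (x.2 + h)%R)|%:E +
      \int[leb]_(s in `[0%R, h]) `|g3 (x.1.1, x.1.2, (x.2 + s)%R)|%:E}} ->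
  (\int[leb3 R]_(x in scube r) (`|phi x| ^+ 3)%:E) *
    (\int[leb3 R]_(x in scube r) (`|phi x| ^+ 3)%:E) <=
  line_energy r delta phi g1 * line_energy r delta phi g2 * line_energy r delta phi g3.
Proof.
move=> mphi mg1 mg2 mg3 hd H1 H2 H3.
set c := \int[leb3 R]_(x in scube r) _; set X := line_energy r delta phi.
have /andP[d0 dr] := hd; have r0 : (0 < r)%R := lt_le_trans d0 dr.
have lr (s : R) : (- r < s < r)%R -> (- (2 * r) < s < 2 * r)%R.
  by move=> /andP[? ?]; apply/andP; split; lra.
have mw1 : measurable_fun setT (fun w : (mR * mR) * mR => ((w.2, w.1.1), w.1.2) : mspace R).
  apply: measurable_fun_pair; last exact: (measurableT_comp measurable_snd measurable_fst).
  apply: measurable_fun_pair; first exact: measurable_snd.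
  exact: (measurableT_comp measurable_fst measurable_fst).
have mw2 : measurable_fun setT (fun w : (mR * mR) * mR => ((w.1.1, w.2), w.1.2) : mspace R).
  apply: measurable_fun_pair; last exact: (measurableT_comp measurable_snd measurable_fst).
  apply: measurable_fun_pair; last exact: measurable_snd.
  exact: (measurableT_comp measurable_fst measurable_fst).
have mw3 : measurable_fun setT (fun w : (mR * mR) * mR => (w.1, w.2) : mspace R).
  by apply: measurable_fun_pair; [exact: measurable_fst|exact: measurable_snd].
have [M1 [mM1 M10 aM1 iM1]] : exists M : mR * mR -> \bar R, [/\ measurable_fun setT M, forall y, 0 <= M y,
    {ae leb3 R, forall x, scube r x -> (phi x ^+ 2)%:E <= M (x.1.2, x.2)} &
    \int[leb2 R]_y M y = X g1].
  apply: (line_majorant (io := fun y s => ((s, y.1), y.2)) (p := fun x => x.1.1)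
    (q := fun x => (x.1.2, x.2))) => //.
  - by move=> [[]].
  - by move=> x [].
  - by move=> x s [_ /lr h2 /lr h3] hs; split.
  - exact: tonelli_x1.
have [M2 [mM2 M20 aM2 iM2]] : exists M : mR * mR -> \bar R, [/\ measurable_fun setT M, forall y, 0 <= M y,
    {ae leb3 R, forall x, scube r x -> (phi x ^+ 2)%:E <= M (x.1.1, x.2)} &
    \int[leb2 R]_y M y = X g2].
  apply: (line_majorant (io := fun y s => ((y.1, s), y.2)) (p := fun x => x.1.2)
    (q := fun x => (x.1.1, x.2))) => //.
  - by move=> [[]].
  - by move=> x [].
  - by move=> x s [/lr h1 _ /lr h3] hs; split.
  - exact: tonelli_x2.
have [M3 [mM3 M30 aM3 iM3]] : exists M : mR * mR -> \bar R, [/\ measurable_fun setT M, forall y, 0 <= M y,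
    {ae leb3 R, forall x, scube r x -> (phi x ^+ 2)%:E <= M x.1} &
    \int[leb2 R]_y M y = X g3].
  apply: (line_majorant (io := fun y s => (y, s)) (p := fun x => x.2)
    (q := fun x => x.1)) => //.
  - by move=> [].
  - by move=> x [].
  - by move=> x s [/lr h1 /lr h2 _] hs; split.
  - exact: tonelli_x3.
  - by apply: filterS H3 => -[[x1 x2] x3].
have mp12 : measurable_fun setT (fun x : mspace R => (x.1.2, x.2) : mR * mR).
  apply: measurable_fun_pair; last exact: measurable_snd.
  exact: (measurableT_comp measurable_snd measurable_fst).
have mp02 : measurable_fun setT (fun x : mspace R => (x.1.1, x.2) : mR * mR).
  apply: measurable_fun_pair; last exact: measurable_snd.
  exact: (measurableT_comp measurable_fst measurable_fst).
have msq : measurable_fun setT (fun x => (phi x ^+ 2)%:E).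
  by apply/measurable_EFinP; exact: measurable_funX.
have mM1' := measurableT_comp mM1 mp12; have mM2' := measurableT_comp mM2 mp02.
have mM3' : measurable_fun setT (fun x : mspace R => M3 x.1) := measurableT_comp mM3 measurable_fst.
have mle (M : mspace R -> \bar R) : measurable_fun setT M ->
    measurable [set x | (phi x ^+ 2)%:E <= M x].
  by move=> mM; rewrite -[X in measurable X]setTI; exact: measurable_lee.
(* Loomis-Whitney needs the bounds everywhere, so |phi| is set to 0 off the set where all three
   hold; inside the cube this changes it on a null set only. *)
pose Gd : set (mspace R) := scube r `&` ([set x | (phi x ^+ 2)%:E <= M1 (x.1.2, x.2)] `&`
  ([set x | (phi x ^+ 2)%:E <= M2 (x.1.1, x.2)] `&` [set x | (phi x ^+ 2)%:E <= M3 x.1])).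
have mGd : measurable Gd.
  apply: measurableI; first exact: measurable_scube.
  by apply: measurableI; [exact: mle mM1'|apply: measurableI; [exact: mle mM2'|exact: mle mM3']].
pose K : mspace R -> R := (fun x => `|phi x|%R) \_ Gd.
have mK : measurable_fun setT K.
  apply/(measurable_restrictT _ mGd); apply: measurable_funTS.
  exact: measurableT_comp.
have K0 x : (0 <= K x)%R by rewrite /K patchE; case: ifP.
have KM (M : mspace R -> \bar R) x : 0 <= M x -> (Gd x -> (phi x ^+ 2)%:E <= M x) -> (K x ^+ 2)%:E <= M x.
  move=> Mx h; rewrite /K patchE; case: ifPn => hx; last by rewrite expr0n.
  by rewrite real_normK ?num_real//; apply: h; rewrite inE in hx.
have cE : c = \int[leb3 R]_x (K x ^+ 3)%:E.
  rewrite /c integral_mkcond; apply: ae_eq_integral => //.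
  - apply/(measurable_restrictT _ (measurable_scube r)); apply: measurable_funTS.
    by apply/measurable_EFinP; apply: measurable_funX; exact: measurableT_comp.
  - by apply/measurable_EFinP; exact: measurable_funX.
  - move: aM1 aM2 aM3; apply: filterS3 => x h1 h2 h3 _.
    rewrite /K !patchE; case: ifPn => hx.
      rewrite inE in hx; rewrite mem_set//; split=> //.
      by split; [exact: h1|split; [exact: h2|exact: h3]].
    rewrite memNset ?expr0n// => -[hr _]; move/negP: hx; apply; exact: mem_set.
have := loomis_whitney mK mM1 mM2 mM3 K0 M10 M20 M30.
rewrite -cE iM1 iM2 iM3; apply => x.
- by apply: (KM (fun x => M1 (x.1.2, x.2))) => // -[_ []].
- by apply: (KM (fun x => M2 (x.1.1, x.2))) => // -[_ [_ []]].
- by apply: (KM (fun x => M3 x.1)) => // -[_ [_ []]].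
Qed.
End sobolev_slice.

Section interpolation_real.
Variable R : realType.

(** The best delta is sqrt (a / b), which may exceed r. Raising b to B = b + A / r^2 repairs this,
    because a <= A. The result is c^4 <= 4^6 a^3 B^3, where a^2 <= A^2 leaves one factor a. *)
Lemma interpolation_real (c a b A r eps : R) : 0 <= c -> 0 <= b ->
  0 < a <= A -> 0 < r -> 0 < eps ->
  (forall delta, 0 < delta <= r -> c ^+ 2 <= (2 / delta * a + 2 * delta * b) ^+ 3) ->
  c <= eps * (b + A / r ^+ 2) + 4 ^+ 6 * A ^+ 2 / eps ^+ 3 * a.
Proof.
move=> c0 b0 /andP[a0 aA] r0 e0 H.
set B := b + A / r ^+ 2.
have A0 : 0 < A := lt_le_trans a0 aA.
have Ar0 : 0 < A / r ^+ 2 by rewrite divr_gt0// exprn_gt0.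
have B0 : 0 < B by rewrite ltr_wpDl.
pose delta := Num.sqrt (a / B).
have delta0 : 0 < delta by rewrite sqrtr_gt0 divr_gt0.
have d2 : delta ^+ 2 * B = a.
  by rewrite sqr_sqrtr ?divr_ge0 ?ltW// divfK// gt_eqF.
have deltar : delta <= r.
  rewrite -[leRHS]gtr0_norm// -sqrtr_sqr ler_sqrt ?sqr_ge0// ler_pdivrMr// (le_trans aA)//.
  rewrite /B mulrDr [X in _ + X]mulrC divfK ?expf_neq0 ?gt_eqF// lerDr.
  by rewrite mulr_ge0// sqr_ge0.
have := H delta; rewrite delta0 deltar => /(_ isT) Hd.
have X0 : 0 <= 2 / delta * a + 2 * delta * b.
  by rewrite addr_ge0// mulr_ge0// ?divr_ge0 ?mulr_ge0// ltW.
have XB : 2 / delta * a + 2 * delta * b <= 4 * (delta * B).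
  have -> : 2 / delta * a = 2 * (delta * B) by rewrite -d2; field; rewrite gt_eqF.
  have bB : b <= B by rewrite lerDl ltW.
  by have := ler_wpM2l (ltW delta0) bB; lra.
have dB0 : 0 <= 4 * (delta * B) by rewrite !mulr_ge0// ltW.
have c2 : c ^+ 2 <= (4 * (delta * B)) ^+ 3.
  by apply: (le_trans Hd); rewrite lerXn2r.
have c4 : c ^+ 4 <= 4 ^+ 6 * a ^+ 3 * B ^+ 3.
  rewrite (_ : c ^+ 4 = (c ^+ 2) ^+ 2); last by rewrite -exprM.
  apply: (@le_trans _ _ (((4 * (delta * B)) ^+ 3) ^+ 2)).
    by rewrite lerXn2r// ?nnegrE ?sqr_ge0// exprn_ge0.
  by rewrite -d2 le_eqVlt; apply/orP; left; apply/eqP; ring.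
(* The two terms of the goal. They are normalised so that c^4 <= x y^3, which is at most (x +
   y)^4. *)
set y := eps * B; set x := 4 ^+ 6 * A ^+ 2 / eps ^+ 3 * a.
have y0 : 0 <= y by rewrite mulr_ge0// ltW.
have e3 : 0 < eps ^+ 3 by exact: exprn_gt0.
have x0 : 0 <= x.
  apply: mulr_ge0; last exact: ltW.
  by apply: divr_ge0; [apply: mulr_ge0; [exact: exprn_ge0|exact: sqr_ge0]|exact: ltW].
have xy3 : x * y ^+ 3 = 4 ^+ 6 * A ^+ 2 * a * B ^+ 3.
  by rewrite /x /y; field; rewrite gt_eqF.
have cxy : c ^+ 4 <= x * y ^+ 3.
  rewrite xy3 (le_trans c4)// ler_wpM2r ?exprn_ge0 ?(ltW B0)//.
  rewrite -mulrA; apply: ler_wpM2l; first exact: exprn_ge0.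
  rewrite (exprSr a 2); apply: ler_wpM2r; first exact: ltW.
  by rewrite lerXn2r// ?nnegrE ltW.
rewrite addrC -(@ler_pXn2r _ 4)// ?nnegrE ?addr_ge0//.
apply: (le_trans cxy); rewrite [leRHS]exprS; apply: ler_pM => //.
- exact: exprn_ge0.
- by rewrite lerDl.
- by rewrite lerXn2r ?nnegrE ?addr_ge0// lerDr.
Qed.

Local Open Scope ereal_scope.

Lemma interpolation_ereal (c a b : \bar R) (A r eps : R) : 0 <= c -> 0 <= a -> 0 <= b ->
  a <= A%:E -> (0 < A)%R -> (0 < r)%R -> (0 < eps)%R ->
  (forall delta, (0 < delta <= r)%R ->
    forall X, X = (2 / delta)%:E * a + (2 * delta)%:E * b -> c * c <= X * X * X) ->
  c <= eps%:E * (b + (A / r ^+ 2)%:E) + (4 ^+ 6 * A ^+ 2 / eps ^+ 3)%:E * a.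
Proof.
move=> c0 a0 b0 aA A0 r0 e0 H.
have Ar0 : (0 < A / r ^+ 2)%R by rewrite divr_gt0// exprn_gt0.
have K0 : (0 < 4 ^+ 6 * A ^+ 2 / eps ^+ 3)%R.
  by rewrite divr_gt0 ?exprn_gt0// mulr_gt0// exprn_gt0.
case: b b0 H => [b| |]// b0 H; last first.
  rewrite addye// gt0_muley ?lte_fin// addye ?leey// gt_eqF//.
  by rewrite (lt_le_trans ltNy0)// mule_ge0// lee_fin ltW.
case: a a0 aA H => [a| |]// a0; rewrite lee_fin => aA H.
have XE d : (2 / d)%:E * a%:E + (2 * d)%:E * b%:E = (2 / d * a + 2 * d * b)%:E by [].
have cfin : c \is a fin_num.
  have := H r; rewrite r0 lexx => /(_ isT _ erefl).
  rewrite XE -!EFinM; case: c c0 {H} => [s _ _| _ |//]; first by [].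
  by rewrite mulyy leye_eq.
rewrite -(fineK cfin) in c0 H *; set c' := fine c in c0 H *.
rewrite !lee_fin in c0 a0 b0.
have Hr a' : (a <= a')%R -> forall delta, (0 < delta <= r)%R ->
    (c' ^+ 2 <= (2 / delta * a' + 2 * delta * b) ^+ 3)%R.
  move=> aa' delta hd; have /andP[/ltW d0 _] := hd; have := H _ hd _ erefl.
  have a'0 : (0 <= a')%R := le_trans a0 aa'.
  rewrite XE -!EFinM lee_fin -expr2 => /le_trans; apply.
  rewrite -expr2 -exprSr lerXn2r// ?nnegrE.
  - by apply: addr_ge0; apply: mulr_ge0; rewrite ?divr_ge0 ?mulr_ge0.
  - by apply: addr_ge0; apply: mulr_ge0; rewrite ?divr_ge0 ?mulr_ge0.
  - by rewrite lerD2r ler_wpM2l// divr_ge0.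
rewrite -[leRHS]/((eps * (b + A / r ^+ 2) + 4 ^+ 6 * A ^+ 2 / eps ^+ 3 * a)%:E) lee_fin.
have [a0'|a0'] := eqVneq a 0%R; last first.
  by apply: interpolation_real => //; [rewrite lt_neqAle eq_sym a0' a0|exact: Hr].
(* When [a = 0] no optimal [delta] exists; let [a' > 0] tend to [0]. *)
rewrite a0' mulr0 addr0; apply/ler_addgt0Pr => eta eta0.
set K := (4 ^+ 6 * A ^+ 2 / eps ^+ 3)%R in K0.
pose a' : R := Num.min A (eta / K)%R.
have a'0 : (0 < a')%R by rewrite lt_min A0 divr_gt0.
apply: (@le_trans _ _ (eps * (b + A / r ^+ 2) + K * a')%R).
  apply: interpolation_real => //; first by rewrite a'0 ge_min lexx.
  by apply: Hr; rewrite a0' ltW.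
rewrite lerD2l mulrC -ler_pdivlMr//; by rewrite ge_min lexx orbT.
Qed.
End interpolation_real.

(** * Space-time integrals and the Sobolev inequality on slabs *)

Section sobolev_box.
Variable R : realType.
Local Notation V := (spacetime R).
Local Notation mV := (mspacetime R).
Local Notation mR := (measurableTypeR R).
Local Notation leb := (@lebesgue_measure R).
Local Open Scope ereal_scope.

Lemma tonelli_spacetime (X : set (mspace R)) (J : set mR) (F : mV -> \bar R) :
  measurable X -> measurable J -> measurable_fun setT F -> (forall z, 0 <= F z) ->
  \int[leb4 R]_(z in X `*` J) F z = \int[leb]_(t in J) \int[leb3 R]_(x in X) F (x, t).
Proof.
move=> mX mJ mF F0; rewrite integral_mkcond.
have mFr : measurable_fun setT (F \_ (X `*` J)).
  by apply/(measurable_restrictT _ (measurableX mX mJ)); exact: measurable_funTS.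
have Fr0 z : 0 <= (F \_ (X `*` J)) z by rewrite patchE; case: ifP.
rewrite (fubini_tonelli2 _ mFr Fr0) [RHS]integral_mkcond; apply: eq_integral => t _.
rewrite /fubini_G patchE; case: ifPn => tJ.
  rewrite [RHS]integral_mkcond; apply: eq_integral => x _; rewrite !patchE.
  rewrite inE in tJ; case: ifPn => [|/negP xX].
    by rewrite inE => -[/= xX _]; rewrite mem_set.
  rewrite memNset// => hx; apply: xX; rewrite inE; split => //.
rewrite integral0_eq// => x _; rewrite patchE memNset// => -[_ /= h].
by move/negP: tJ; apply; rewrite inE.
Qed.

Lemma measurable_slice_integral (X : set (mspace R)) (F : mV -> \bar R) :
  measurable X -> measurable_fun setT F -> (forall z, 0 <= F z) ->
  measurable_fun setT (fun t : mR => \int[leb3 R]_(x in X) F (x, t)).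
Proof.
move=> mX mF F0.
have mXT : measurable (X `*` [set: mR]) by exact: measurableX.
have mFr : measurable_fun setT (F \_ (X `*` [set: mR])).
  by apply/(measurable_restrictT _ mXT); exact: measurable_funTS.
have Fr0 z : 0 <= (F \_ (X `*` [set: mR])) z by rewrite patchE; case: ifP.
have := measurable_fun_fubini_tonelli_G (m1 := leb3 R) _ mFr Fr0.
congr measurable_fun; apply/funext => t; rewrite /fubini_G [RHS]integral_mkcond.
apply: eq_integral => x _; rewrite !patchE; case: ifPn => [|/negP xX].
  by rewrite inE => -[/= xX _]; rewrite mem_set.
by rewrite memNset// => hx; apply: xX; rewrite inE; split.
Qed.

Let j1 : 'I_3 := @Ordinal 3 0 isT.
Let j2 : 'I_3 := @Ordinal 3 1 isT.
Let j3 : 'I_3 := @Ordinal 3 2 isT.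

Lemma dir_x_ge0 (j : 'I_3) i : (0 <= pr i (dir_x R j))%R.
Proof. by case: i => [[|[|[|[|n]]]]] //= p; rewrite /pr/= ?lexx ?ler0n. Qed.

Lemma shift_x1 (z : V) (h : R) : (z + h *: dir_x R j1 = ((z.1.1.1 + h, z.1.1.2, z.1.2), z.2))%R.
Proof.
apply: prP => i; rewrite prD prZ; case: i => [[|[|[|[|n]]]]] // p;
  by rewrite /pr /dir_x /= ?mulr1 ?mulr0 ?addr0.
Qed.

Lemma shift_x2 (z : V) (h : R) : (z + h *: dir_x R j2 = ((z.1.1.1, z.1.1.2 + h, z.1.2), z.2))%R.
Proof.
apply: prP => i; rewrite prD prZ; case: i => [[|[|[|[|n]]]]] // p;
  by rewrite /pr /dir_x /= ?mulr1 ?mulr0 ?addr0.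
Qed.

Lemma shift_x3 (z : V) (h : R) : (z + h *: dir_x R j3 = ((z.1.1.1, z.1.1.2, z.1.2 + h), z.2))%R.
Proof.
apply: prP => i; rewrite prD prZ; case: i => [[|[|[|[|n]]]]] // p;
  by rewrite /pr /dir_x /= ?mulr1 ?mulr0 ?addr0.
Qed.

Definition slab (r T : R) : set mV := scube r `*` (`](- T)%R, 0%R[%classic : set mR).

Definition energy (r T : R) (g : V -> R) : \bar R :=
  \int[leb4 R]_(z in slab (2 * r) T) (cut g z ^+ 2)%:E.

Lemma quarter_range (r u h : R) : (r <= 4^-1)%R -> (- r < u < r)%R -> (0 <= h < r)%R ->
  (- 2^-1 < u + h < 2^-1)%R.
Proof. by move=> ? /andP[? ?] /andP[? ?]; apply/andP; split; lra. Qed.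

(** The uniform bound [A] on time slices makes the interpolated inequality linear in the slice
    integrals of f^2 and of the squared gradient, so it can be integrated in time. Lines start in
    the cube of half side r and have length below r, so r <= 1/4 keeps them in [box1]. *)
Lemma sobolev_box (D : set V) (f g1 g2 g3 : V -> R) (r T A eps : R) :
  @box1 R `<=` D -> weak_derivative D (dir_x R j1) f g1 ->
  weak_derivative D (dir_x R j2) f g2 -> weak_derivative D (dir_x R j3) f g3 ->
  (0 < r <= 4^-1)%R -> (0 < T <= 1)%R -> (0 < A)%R -> (0 < eps)%R ->
  {ae leb, forall t : mR, (- T < t < 0)%R ->
    \int[leb3 R]_(x in scube (2 * r)) (cut f (x, t) ^+ 2)%:E <= A%:E} ->
  \int[leb4 R]_(z in slab r T) (`|cut f z| ^+ 3)%:E <=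
    eps%:E * (energy r T g1 + energy r T g2 + energy r T g3 + (T * (A / r ^+ 2))%:E) +
    (4 ^+ 6 * A ^+ 2 / eps ^+ 3)%:E * energy r T f.
Proof.
move=> BD w1 w2 w3 /andP[r0 r4] /andP[T0 T1] A0 e0 hA.
pose J : set mR := `](- T)%R, 0%R[%classic.
have [lf lg1 _] := w1; have [_ lg2 _] := w2; have [_ lg3 _] := w3.
have mf := measurable_cut lf BD; have mg1 := measurable_cut lg1 BD.
have mg2 := measurable_cut lg2 BD; have mg3 := measurable_cut lg3 BD.
have mJ : measurable J by exact: measurable_itv.
have mC := measurable_scube r; have mC2 := measurable_scube (2 * r).
have m2 (g : V -> R) : measurable_fun setT (cut g) -> measurable_fun setT (fun z => (cut g z ^+ 2)%:E).
  by move=> mg; apply/measurable_EFinP; exact: measurable_funX.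
have m3 : measurable_fun setT (fun z => (`|cut f z| ^+ 3)%:E).
  by apply/measurable_EFinP; apply: measurable_funX; exact: measurableT_comp.
have p2 (g : V -> R) z : 0 <= (cut g z ^+ 2)%:E by rewrite lee_fin sqr_ge0.
have p3 z : 0 <= (`|cut f z| ^+ 3)%:E by rewrite lee_fin exprn_ge0.
pose a (g : V -> R) (t : mR) := \int[leb3 R]_(x in scube (2 * r)) (cut g (x, t) ^+ 2)%:E.
pose c (t : mR) := \int[leb3 R]_(x in scube r) (`|cut f (x, t)| ^+ 3)%:E.
have a0 g t : 0 <= a g t by apply: integral_ge0 => x _; exact: p2.
have c0 t : 0 <= c t by apply: integral_ge0 => x _; exact: p3.
have ma g : measurable_fun setT (cut g) -> measurable_fun setT (a g).
  move=> mg; exact: (measurable_slice_integral mC2 (m2 _ mg) (p2 g)).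
have mc : measurable_fun setT c by exact: (measurable_slice_integral mC m3 p3).
have energyE g : measurable_fun setT (cut g) -> energy r T g = \int[leb]_(t in J) a g t.
  by move=> mg; rewrite /energy tonelli_spacetime//; exact: m2.
rewrite !energyE// tonelli_spacetime// -/c.
pose b t := a g1 t + a g2 t + a g3 t.
have b0 t : 0 <= b t by apply: adde_ge0; [exact: adde_ge0|].
have mb : measurable_fun setT b by apply: emeasurable_funD; [apply: emeasurable_funD|]; exact: ma.
have key : {ae leb, forall t : mR, J t ->
    c t <= eps%:E * (b t + (A / r ^+ 2)%:E) + (4 ^+ 6 * A ^+ 2 / eps ^+ 3)%:E * a f t}.
  have L1 := ae_ysection (m1 := leb3 R) (m2 := leb) (ae_line_bound BD w1 (dir_x_ge0 j1)).
  have L2 := ae_ysection (m1 := leb3 R) (m2 := leb) (ae_line_bound BD w2 (dir_x_ge0 j2)).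
  have L3 := ae_ysection (m1 := leb3 R) (m2 := leb) (ae_line_bound BD w3 (dir_x_ge0 j3)).
  suff main (t : mR) : ((- T < t < 0)%R -> a f t <= A%:E) ->
      {ae leb3 R, forall x, ae_line (cut f) (cut g1) (dir_x R j1) (x, t)} ->
      {ae leb3 R, forall x, ae_line (cut f) (cut g2) (dir_x R j2) (x, t)} ->
      {ae leb3 R, forall x, ae_line (cut f) (cut g3) (dir_x R j3) (x, t)} ->
      J t -> c t <= eps%:E * (b t + (A / r ^+ 2)%:E) + (4 ^+ 6 * A ^+ 2 / eps ^+ 3)%:E * a f t.
    have L12 : {ae leb, forall t : mR,
        ((- T < t < 0)%R -> a f t <= A%:E) /\
        {ae leb3 R, forall x, ae_line (cut f) (cut g1) (dir_x R j1) (x, t)}}.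
      by move: hA L1; apply: filterS2 => t; split.
    move: L12 L2 L3; apply: filterS3 => t [h1 h2] h3 h4; exact: main.
  move=> hAt {}L1 {}L2 {}L3.
  rewrite /J/= in_itv/= => tJ.
  have box (x : mspace R) (h1 h2 h3 : R) : scube r x -> (0 <= h1 < r)%R -> (0 <= h2 < r)%R ->
      (0 <= h3 < r)%R -> box1 (((x.1.1 + h1, x.1.2 + h2, x.2 + h3), t) : V)%R.
    move=> [x1 x2 x3] y1 y2 y3; apply/box1E; split=> /=.
    - exact: (quarter_range r4 x1 y1).
    - exact: (quarter_range r4 x2 y2).
    - exact: (quarter_range r4 x3 y3).
    - by have /andP[t1 ->] := tJ; rewrite (le_lt_trans _ t1)// lerN2.
  have r00 : (0%R <= 0%R :> R)%R && (0 < r)%R by rewrite lexx r0.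
  have bx x : scube r x -> box1 ((x, t) : V).
    by move=> xr; have := box x 0%R 0%R 0%R xr r00 r00 r00; rewrite !addr0; case: x xr => [[]].
  apply: interpolation_ereal => //; first exact: hAt.
  move=> delta hd X XE; have /andP[d0 dr] := hd.
  have ms (g : V -> R) : measurable_fun setT (cut g) -> measurable_fun setT (fun x : mspace R => cut g (x, t)).
    by move=> mg; exact: (measurableT_comp mg (measurable_pair2 t)).
  have sob := sobolev_slice (phi := fun x => cut f (x, t)) (g1 := fun x => cut g1 (x, t))
    (g2 := fun x => cut g2 (x, t)) (g3 := fun x => cut g3 (x, t)) (r := r) (delta := delta)
    (ms _ mf) (ms _ mg1) (ms _ mg2) (ms _ mg3) hd.
  have mdir (g : V -> R) (e : V) (x : mspace R) : measurable_fun setT (cut g) ->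
      measurable_fun setT (fun s : mR => `|cut g (((x, t) : V) + (s : R) *: e)%R|%:E).
    move=> mg; apply/measurable_EFinP; apply: measurableT_comp => //.
    have := measurable_line e 1%R; under [X in measurable_fun _ X -> _]eq_fun do rewrite mul1r.
    by move=> ml; exact: (measurableT_comp mg (measurableT_comp ml (measurable_pair1 (x, t)))).
  have S1 : {ae leb3 R, forall x, scube r x -> {ae leb, forall h : mR, (0 < h)%R -> (h < r)%R ->
      `|cut f (x, t)|%:E <= `|cut f ((x.1.1 + h)%R, x.1.2, x.2, t)|%:E +
      \int[leb]_(s in `[0%R, h]) `|cut g1 ((x.1.1 + s)%R, x.1.2, x.2, t)|%:E}}.
    apply: filterS L1 => x Lx xr; apply: filterS (Lx (bx _ xr)) => h Lh h0 hr.
    have := Lh h0; rewrite shift_x1.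
    under eq_integral do rewrite shift_x1.
    apply; have := box x h 0%R 0%R xr; rewrite !addr0; apply; rewrite ?lexx ?(ltW h0) ?r0//.
  have S2 : {ae leb3 R, forall x, scube r x -> {ae leb, forall h : mR, (0 < h)%R -> (h < r)%R ->
      `|cut f (x, t)|%:E <= `|cut f (x.1.1, (x.1.2 + h)%R, x.2, t)|%:E +
      \int[leb]_(s in `[0%R, h]) `|cut g2 (x.1.1, (x.1.2 + s)%R, x.2, t)|%:E}}.
    apply: filterS L2 => x Lx xr; apply: filterS (Lx (bx _ xr)) => h Lh h0 hr.
    have := Lh h0; rewrite shift_x2.
    under eq_integral do rewrite shift_x2.
    apply; have := box x 0%R h 0%R xr; rewrite !addr0; apply; rewrite ?lexx ?(ltW h0) ?r0//.
  have S3 : {ae leb3 R, forall x, scube r x -> {ae leb, forall h : mR, (0 < h)%R -> (h < r)%R ->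
      `|cut f (x, t)|%:E <= `|cut f (x.1.1, x.1.2, (x.2 + h)%R, t)|%:E +
      \int[leb]_(s in `[0%R, h]) `|cut g3 (x.1.1, x.1.2, (x.2 + s)%R, t)|%:E}}.
    apply: filterS L3 => x Lx xr; apply: filterS (Lx (bx _ xr)) => h Lh h0 hr.
    have := Lh h0; rewrite shift_x3.
    under eq_integral do rewrite shift_x3.
    apply; have := box x 0%R 0%R h xr; rewrite !addr0; apply; rewrite ?lexx ?(ltW h0) ?r0//.
  apply: le_trans (sob S1 S2 S3) _.
  have Xle (g : V -> R) : a g t <= b t ->
      line_energy r delta (fun x => cut f (x, t)) (fun x => cut g (x, t)) <= X.
    move=> gb; rewrite /line_energy XE leeD2l// lee_wpmul2l// lee_fin.
    by rewrite mulr_ge0// ltW.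
  have X0 g : 0 <= line_energy r delta (fun x => cut f (x, t)) (fun x => cut g (x, t)).
    by apply: adde_ge0; apply: mule_ge0; rewrite ?a0// lee_fin ?divr_ge0 ?mulr_ge0// ltW.
  apply: lee_pmul; [by rewrite mule_ge0|exact: X0| |].
    apply: lee_pmul; [exact: X0|exact: X0| |]; apply: Xle; rewrite /b.
      by rewrite -addeA leeDl// adde_ge0.
    by rewrite addeAC leeDr// adde_ge0.
  by apply: Xle; rewrite /b leeDr// adde_ge0.
have k0 : (0 <= 4 ^+ 6 * A ^+ 2 / eps ^+ 3)%R.
  apply: divr_ge0; [apply: mulr_ge0; [exact: exprn_ge0|exact: sqr_ge0]|].
  by rewrite exprn_ge0// ltW.
have Ar : (0 <= A / r ^+ 2)%R by rewrite divr_ge0// ?sqr_ge0// ltW.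
have mbA : measurable_fun setT (fun t => b t + (A / r ^+ 2)%:E).
  by apply: emeasurable_funD => //; exact: measurable_cst.
have bA0 t : 0 <= b t + (A / r ^+ 2)%:E by rewrite adde_ge0.
have h1 : 0 <= eps%:E by rewrite lee_fin ltW.
have mTS (F : mR -> \bar R) : measurable_fun setT F -> measurable_fun J F.
  by move=> mF; exact: measurable_funTS.
have maf := ma _ mf.
have m1 : measurable_fun J (fun t => eps%:E * (b t + (A / r ^+ 2)%:E)).
  by apply: mTS; exact: measurable_funeM.
have m4 : measurable_fun J (fun t => (4 ^+ 6 * A ^+ 2 / eps ^+ 3)%:E * a f t).
  by apply: mTS; exact: measurable_funeM.
have p1 t : J t -> 0 <= eps%:E * (b t + (A / r ^+ 2)%:E) by move=> _; rewrite mule_ge0.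
have p4 t : J t -> 0 <= (4 ^+ 6 * A ^+ 2 / eps ^+ 3)%:E * a f t.
  by move=> _; apply: mule_ge0; [rewrite lee_fin|].
apply: (@le_trans _ _ (\int[leb]_(t in J) (eps%:E * (b t + (A / r ^+ 2)%:E) +
   (4 ^+ 6 * A ^+ 2 / eps ^+ 3)%:E * a f t))).
  apply: (ae_ge0_le_integral mJ (fun t _ => c0 t) (mTS _ mc) _ (emeasurable_funD m1 m4) key).
  by move=> t tJ; apply: adde_ge0; [exact: p1|exact: p4].
rewrite (ge0_integralD leb mJ p1 m1 p4 m4).
rewrite (ge0_integralZl leb mJ (mTS _ mbA))// (ge0_integralZl leb mJ (mTS _ maf))//.
apply: leeD => //; apply: lee_wpmul2l => //.
have b0' t : J t -> 0 <= b t by [].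
have Ar' (t : mR) : J t -> 0 <= (A / r ^+ 2)%:E by rewrite lee_fin.
rewrite (ge0_integralD leb mJ b0' (mTS _ mb) Ar' (measurable_cst _)).
rewrite integral_cst//; apply: leeD.
  have m1' := mTS _ (ma _ mg1); have m2' := mTS _ (ma _ mg2); have m3' := mTS _ (ma _ mg3).
  have q1 t : J t -> 0 <= a g1 t + a g2 t by move=> _; exact: adde_ge0.
  rewrite (ge0_integralD leb mJ q1 (emeasurable_funD m1' m2') (fun t _ => a0 g3 t) m3').
  by rewrite (ge0_integralD leb mJ (fun t _ => a0 g1 t) m1' (fun t _ => a0 g2 t) m2').
have lJ : leb J = T%:E.
  have -> : leb J = leb (`](- T)%R, 0%R[%classic : set R) by [].
  by rewrite lebesgue_measure_itv/= lte_fin oppr_lt0 T0 -EFinD sub0r opprK.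
rewrite [X in _ * X](_ : _ = T%:E); last exact: lJ.
by rewrite -EFinM mulrC.
Qed.
End sobolev_box.

(** * Mixed norms and the trace in time *)

Section young_powers.
Variable R : realType.

(** Either u <= lam, or u / lam > 1 and its power p - 1 is at least 1. The free threshold [lam]
    replaces Hoelder's inequality, with p = 1 included. *)
Lemma le_powR_split (u lam p : R) : 0 <= u -> 0 < lam -> 1 <= p ->
  u <= lam + lam `^ (1 - p) * u `^ p.
Proof.
move=> u0 l0 p1; have p0 : 0 < p := lt_le_trans ltr01 p1.
have [ul|lu] := leP u lam; first by rewrite (le_trans ul)// lerDl mulr_ge0// powR_ge0.
apply: ler_wpDl; first exact: ltW.
rewrite -(mulr_powRB1 u0 p0) mulrCA -[leLHS]mulr1 ler_wpM2l//.
have E : lam `^ (1 - p) * lam `^ (p - 1) = 1.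
  rewrite -powRD; last by rewrite (gt_eqF l0) implybT.
  by rewrite (_ : 1 - p + (p - 1) = 0) ?powRr0//; ring.
rewrite -[leLHS]E ler_wpM2l ?powR_ge0//.
by rewrite ge0_ler_powR ?nnegrE ?subr_ge0// ltW.
Qed.

Local Open Scope ereal_scope.

Lemma le_poweR_split (y : \bar R) (lam p : R) : 0 <= y -> (0 < lam)%R -> (1 <= p)%R ->
  y <= lam%:E + (lam `^ (1 - p))%:E * y `^ p.
Proof.
case: y => [u| |]//; first by rewrite !lee_fin => u0 l0 p1; exact: le_powR_split.
move=> _ l0 p1; rewrite poweRyr ?gt_eqF ?(lt_le_trans ltr01 p1)//.
by rewrite gt0_muley ?lte_fin ?powR_gt0// addey.
Qed.
End young_powers.

(** * Absolute continuity and mixed norms on slabs *)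

Section absolute_continuity.
Local Open Scope ereal_scope.

(** Dominated convergence along a decreasing sequence of sets whose intersection is negligible. *)
Lemma small_integral d (T : measurableType d) (R : realType)
    (mu : {measure set T -> \bar R}) (A : (set T)^nat) (k : T -> \bar R) (eta : R) :
  (forall n, measurable (A n)) -> (forall m n, (m <= n)%N -> A n `<=` A m) ->
  {ae mu, forall x, exists n, ~ A n x} ->
  measurable_fun setT k -> (forall x, 0 <= k x) -> \int[mu]_x k x < +oo -> (0 < eta)%R ->
  exists n, \int[mu]_(x in A n) k x <= eta%:E.
Proof.
move=> mA decA A0 mk k0 ik eta0.
have intk : mu.-integrable setT k.
  by apply/integrableP; split => //; under eq_integral do rewrite gee0_abs//.
have mAn n : measurable_fun setT (k \_ (A n)).
  by apply/(measurable_restrictT _ (mA n)); exact: measurable_funTS.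
have := @dominated_convergence _ _ _ mu setT measurableT (fun n => k \_ (A n)) (cst 0) k mAn
  (measurable_cst _).
case.
- apply: filterS A0 => x [N xN] _; apply: cvg_near_cst; near=> n.
  rewrite patchE memNset// => xn; apply: xN; apply: decA xn; near: n.
  exact: nbhs_infty_ge.
- exact: intk.
- apply: nearW => x n _; rewrite patchE; case: ifP => _; first by rewrite gee0_abs.
  by rewrite abse0.
move=> _ _; rewrite integral0 => /fine_cvgP[_ /cvgrPdist_le /(_ _ eta0)] [N _ /(_ N)] /=.
have fN : \int[mu]_x (k \_ (A N)) x \is a fin_num.
  rewrite ge0_fin_numE; last by apply: integral_ge0 => x _; rewrite patchE; case: ifP.
  apply: le_lt_trans ik; apply: ge0_le_integral => //.
  - by move=> x _; rewrite patchE; case: ifP.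
  - by move=> x _; rewrite patchE; case: ifP.
move=> /(_ (leqnn _)); rewrite sub0r normrN => h; exists N.
rewrite integral_mkcond -(fineK fN) lee_fin (le_trans _ h)//; exact: ler_norm.
Unshelve. all: by end_near.
Qed.
End absolute_continuity.

Section slab_estimates.
Variable R : realType.
Local Notation V := (spacetime R).
Local Notation mV := (mspacetime R).
Local Notation mR := (measurableTypeR R).
Local Notation leb := (@lebesgue_measure R).
Local Open Scope ereal_scope.

Lemma leb3_scube (r : R) : (0 < r)%R -> leb3 R (scube r) = (8 * r ^+ 3)%:E.
Proof.
move=> r0; pose I : set mR := `](- r)%R, r[%classic.
have mI : measurable I by exact: measurable_itv.
have lI : leb I = (2 * r)%:E.
  have -> : leb I = leb (`](- r)%R, r[%classic : set R) by [].
  by rewrite lebesgue_measure_itv/= lte_fin gtrN// -EFinD; congr EFin; ring.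
rewrite scubeE -/I; transitivity ((leb2 R) (I `*` I) * leb I).
  exact: (product_measure1E (leb2 R) leb (measurableX mI mI) mI).
have -> : leb2 R (I `*` I) = leb I * leb I by exact: (product_measure1E leb leb mI mI).
rewrite [X in X * _](_ : _ = (2 * r)%:E * (2 * r)%:E); last by rewrite lI.
rewrite [X in _ * X](_ : _ = (2 * r)%:E); last exact: lI.
by rewrite -!EFinM; congr EFin; ring.
Qed.

Lemma leb3_gt0 : 0 < leb3 R setT.
Proof.
apply: (@lt_le_trans _ _ (leb3 R (scube 1))).
  by rewrite leb3_scube// lte_fin mulr_gt0// exprn_gt0.
by apply: le_measure; rewrite ?inE//; exact: measurable_scube.
Qed.

(** Hoelder's inequality against the indicator of the cube; 8 bounds the power 1 - 1/s of 8. The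
    inverse of an infinite exponent is 0, so one formula covers every s. *)
Lemma integral_scube_Lnorm (g : mspace R -> R) (s : \bar R) (r : R) :
  measurable_fun setT g -> 1 <= s -> (0 < r)%R ->
  \int[leb3 R]_(x in scube r) `|g x|%:E <=
    (8 * r `^ (3 * (1 - fine s^-1)))%:E * 'N[leb3 R]_s[EFin \o g].
Proof.
move=> mg s1 r0.
have mC := measurable_scube r.
have mag : measurable_fun setT (fun x => `|g x|%:E).
  by apply/measurable_EFinP; exact: measurableT_comp.
case: s s1 => [p| |]//.
  rewrite lee_fin => p1; have p0 : (0 < p)%R := lt_le_trans ltr01 p1.
  rewrite inver gt_eqF//=.
  (* The conjugate exponent of 1 is not a real number. *)
  have [->|p1'] := eqVneq p 1%R.
    rewrite invr1 subrr mulr0 powRr0 mulr1 Lnorm1.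
    apply: (@le_trans _ _ (1 * \int[leb3 R]_x `|g x|%:E)).
      by rewrite mul1e; apply: ge0_subset_integral.
    by rewrite lee_wpmul2r ?lee_fin ?ler1n//; exact: integral_ge0.
  have {}p1 : (1 < p)%R by rewrite lt_neqAle eq_sym p1'.
  pose q : R := ((1 - p^-1)^-1)%R.
  have q'0 : (0 < 1 - p^-1)%R by rewrite subr_gt0 invf_lt1.
  have q0 : (0 < q)%R by rewrite invr_gt0.
  have pq : (p^-1 + q^-1 = 1)%R by rewrite invrK addrC subrK.
  have mI : measurable_fun setT (\1_(scube r) : mspace R -> R) by exact: measurable_indic.
  have := hoelder (leb3 R) mg mI p0 q0 pq.
  rewrite Lnorm1.
  have -> : \int[leb3 R]_x `|(EFin \o (g \* \1_(scube r))%R) x| =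
      \int[leb3 R]_(x in scube r) `|g x|%:E.
    rewrite [RHS]integral_mkcond; apply: eq_integral => x _.
    by rewrite patchE /= indicE; case: ifP => _; rewrite ?mulr1 ?mulr0 ?normr0.
  move=> /le_trans; apply; rewrite muleC lee_wpmul2r ?Lnorm_ge0//.
  rewrite unlock.
  have -> : \int[leb3 R]_x `|(EFin \o (\1_(scube r) : mspace R -> R)) x| `^ q = (8 * r ^+ 3)%:E.
    rewrite -leb3_scube// -[in RHS](setIT (scube r)) -integral_indic//.
    apply: eq_integral => x _ /=; rewrite indicE; case: (x \in scube r) => /=.
      by rewrite normr1 powR1.
    by rewrite normr0 powR0// gt_eqF.
  rewrite poweR_EFin lee_fin powRM ?exprn_ge0 ?(ltW r0)// invrK.
  apply: ler_pM; rewrite ?powR_ge0//.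
    by apply: ler1_powR; rewrite ?ler1n// gerBl invr_ge0 ltW.
  by rewrite -powR_mulrn ?(ltW r0)// -powRrM.
move=> _; rewrite invey /= subr0 mulr1.
have mu0 := leb3_gt0.
rewrite unlock mu0.
set N := ess_sup _ _.
have N0 : 0 <= N by apply: ess_sup_gee => //; apply: nearW => x /=.
have ae : {ae leb3 R, forall x, scube r x -> `|g x|%:E <= cst N x}.
  by have := ess_sup_ge (leb3 R) (abse \o (EFin \o g)); apply: filterS => x h _.
apply: (@le_trans _ _ (\int[leb3 R]_(x in scube r) cst N x)).
  apply: ae_ge0_le_integral => //.
  exact: measurable_funTS.
rewrite integral_cst// [X in N * X]leb3_scube// muleC.
by rewrite (_ : r `^ 3 = r ^+ 3)%R// -powR_mulrn// ltW.
Qed.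

(** For finite s this is Tonelli. For s = +oo, the norm of a slice is below c exactly when, for some
    n, the slice of the set |F| > c - 1/(n+1) is negligible, and the measure of a slice is a
    measurable function of t. *)
Lemma measurable_Lnorm_slice (F : mV -> R) (s : \bar R) : measurable_fun setT F -> 1 <= s ->
  measurable_fun setT (fun t : mR => 'N[leb3 R]_s[(fun x => (F (x, t))%:E)]).
Proof.
move=> mF; case: s => [p| |]// s1.
  rewrite (_ : (fun t => _) =
     (fun t => (\int[leb3 R]_x (`|F (x, t)| `^ p)%:E) `^ p^-1)); last first.
    by apply/funext => t; rewrite unlock.
  have mFp : measurable_fun setT (fun z => (`|F z| `^ p)%:E).
    apply/measurable_EFinP; apply: (measurableT_comp (measurable_powR _)).
    exact: measurableT_comp.
  apply: (measurableT_comp (measurable_poweR _)).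
  apply: (measurable_fun_fubini_tonelli_G (fun z => (`|F z| `^ p)%:E) mFp) => z.
  by rewrite lee_fin powR_ge0.
have mu0 := leb3_gt0.
apply: (measurability _ (ErealGenInftyO.measurableE R)) => _ [_ [c ->] <-].
rewrite setTI; pose B (n : nat) : set mV := [set z | c - n.+1%:R^-1 < `|F z|]%R.
have mB n : measurable (B n).
  have mabs : measurable_fun setT (fun z => `|F z|%R) by exact: measurableT_comp.
  have mI : measurable (`](c - n.+1%:R^-1)%R, +oo[%classic : set R) by exact: measurable_itv.
  have := mabs measurableT _ mI; rewrite setTI; congr measurable.
  by apply/seteqP; split=> z /=; rewrite in_itv/= andbT.
rewrite (_ : _ @^-1` _ = \bigcup_n ((fun t => leb3 R (ysection (B n) t)) @^-1` [set 0])).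
  apply: bigcup_measurable => n _; rewrite -[X in measurable X]setTI.
  by apply: (measurable_fun_ysection (leb3 R) (mB n)).
have LE (t : mR) (n : nat) : leb3 R (ysection (B n) t) = 0 <->
    ess_sup (leb3 R) (abse \o (fun x => (F (x, t))%:E)) <= (c - n.+1%:R^-1)%:E.
  have mFt : measurable_fun setT (abse \o (fun x : mspace R => (F (x, t))%:E)).
    by apply: measurableT_comp => //; apply/measurable_EFinP; exact: (measurableT_comp mF (measurable_pair2 t)).
  have E : ysection (B n) t =
      (abse \o (fun x : mspace R => (F (x, t))%:E)) @^-1` `](c - n.+1%:R^-1)%:E, +oo[%classic.
    by apply/seteqP; split=> x /=; rewrite /ysection /B /= inE /= in_itv/= andbT lte_fin.
  rewrite E; split=> [h|/ess_supP h].
    by apply/ess_supP; exact: ((@ae_le_measureP _ _ _ (leb3 R) _ _ mFt).2 h).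
  exact: ((@ae_le_measureP _ _ _ (leb3 R) _ _ mFt).1 h).
apply/seteqP; split=> t /=; rewrite unlock mu0 in_itv/=; set N := ess_sup _ _.
  move=> Nc; have N0 : 0 <= N by apply: ess_sup_gee => //; apply: nearW => x /=.
  have Nfin : N \is a fin_num by rewrite ge0_fin_numE// (lt_trans Nc)// ltry.
  have d0 : (0 < c - fine N)%R by rewrite subr_gt0 -lte_fin fineK.
  exists (Num.truncn (c - fine N)^-1) => //=; apply/LE; rewrite -/N -(fineK Nfin) lee_fin.
  rewrite lerBrDl -lerBrDr -[leRHS]invrK lef_pV2 ?posrE ?invr_gt0//.
  exact/ltW/truncnS_gt.
move=> [n _ /= /LE h]; apply: (le_lt_trans h).
by rewrite lte_fin gtrBl invr_gt0.
Qed.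

Lemma lebesgue_measure_window (T : R) : (0 < T)%R ->
  leb (`](- T)%R, 0%R[%classic : set mR) = T%:E.
Proof.
move=> T0; have E : leb (`](- T)%R, 0%R[%classic : set R) = T%:E.
  by rewrite lebesgue_measure_itv/= lte_fin oppr_lt0 T0 -EFinD sub0r opprK.
exact: E.
Qed.

(** Hoelder in space, [le_poweR_split] in time. The parameter [lam] is fixed by the users of the
    lemma, according to the scaling of the time integral. *)
Lemma slab_mixed_le (F : mV -> R) (s : \bar R) (l r T lam : R) :
  measurable_fun setT F -> 1 <= s -> (1 <= l)%R -> (0 < r)%R -> (0 < T)%R -> (0 < lam)%R ->
  \int[leb4 R]_(z in slab r T) `|F z|%:E <=
    (8 * r `^ (3 * (1 - fine s^-1)))%:E * ((T * lam)%:E + (lam `^ (1 - l))%:E *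
      \int[leb]_(t in `](- T)%R, 0%R[) 'N[leb3 R]_s[(fun x => (F (x, t))%:E)] `^ l).
Proof.
move=> mF s1 l1 r0 T0 lam0.
pose J : set mR := `](- T)%R, 0%R[%classic.
have mJ : measurable J by exact: measurable_itv.
have mC := measurable_scube r.
pose n (t : mR) := 'N[leb3 R]_s[(fun x => (F (x, t))%:E)].
have mn : measurable_fun setT n by exact: measurable_Lnorm_slice.
have n0 t : 0 <= n t by exact: Lnorm_ge0.
set c := (8 * r `^ _)%R; have c0 : (0 <= c)%R by rewrite mulr_ge0// powR_ge0.
have mabs : measurable_fun setT (fun z => `|F z|%:E).
  by apply/measurable_EFinP; exact: measurableT_comp.
have abs0 z : 0 <= `|F z|%:E by rewrite lee_fin.
rewrite (tonelli_spacetime mC mJ mabs abs0).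
have mnl : measurable_fun J (fun t => n t `^ l).
  by apply: measurable_funTS; apply: (measurableT_comp (measurable_poweR _)).
have nl0 (t : mR) : J t -> 0 <= n t `^ l by rewrite poweR_ge0.
have lam1 : (0 <= lam `^ (1 - l))%R by exact: powR_ge0.
have m1 : measurable_fun J (fun t => (lam `^ (1 - l))%:E * n t `^ l) by exact: measurable_funeM.
have p1 (t : mR) : J t -> 0 <= (lam `^ (1 - l))%:E * n t `^ l.
  by move=> tJ; apply: mule_ge0; [rewrite lee_fin|exact: nl0].
have lamJ (t : mR) : J t -> 0 <= lam%:E by rewrite lee_fin ltW.
apply: (@le_trans _ _ (\int[leb]_(t in J) (c%:E * (lam%:E + (lam `^ (1 - l))%:E * n t `^ l)))).
  have m2 : measurable_fun J (fun t => \int[leb3 R]_(x in scube r) `|F (x, t)|%:E).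
    by apply: measurable_funTS; exact: (measurable_slice_integral mC mabs abs0).
  apply: ge0_le_integral => //.
  - by move=> t _; exact: integral_ge0.
  - by apply: measurable_funeM; apply: emeasurable_funD => //; exact: measurable_cst.
  - move=> t tJ; have mFt : measurable_fun setT (fun x => F (x, t)).
      exact: (measurableT_comp mF (measurable_pair2 t)).
    apply: le_trans (integral_scube_Lnorm mFt s1 r0) _.
    by apply: lee_wpmul2l; [rewrite lee_fin|exact: (le_poweR_split (n0 t) lam0 l1)].
have m3 : measurable_fun J (fun t => lam%:E + (lam `^ (1 - l))%:E * n t `^ l).
  by apply: emeasurable_funD => //; exact: measurable_cst.
have p3 (t : mR) : J t -> 0 <= lam%:E + (lam `^ (1 - l))%:E * n t `^ l.
  by move=> tJ; apply: adde_ge0; [exact: (lamJ t)|exact: p1].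
rewrite (ge0_integralZl leb mJ m3 p3)// lee_wpmul2l ?lee_fin//.
rewrite (ge0_integralD leb mJ lamJ (measurable_cst _) p1 m1) integral_cst//.
rewrite (ge0_integralZl leb mJ mnl nl0)// leeD2r//.
by rewrite [X in _ * X]lebesgue_measure_window// -EFinM mulrC.
Qed.

Lemma small_time_integral (k : mR -> \bar R) (eta : R) :
  measurable_fun setT k -> (forall t, 0 <= k t) -> \int[leb]_t k t < +oo -> (0 < eta)%R ->
  exists2 d : R, (0 < d)%R & forall T, (0 < T <= d)%R ->
    \int[leb]_(t in `](- T)%R, 0%R[) k t <= eta%:E.
Proof.
move=> mk k0 ik eta0.
pose A (n : nat) : set mR := `](- n.+1%:R^-1)%R, 0%R[%classic.
have mA n : measurable (A n) by exact: measurable_itv.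
have decA m n : (m <= n)%N -> A n `<=` A m.
  move=> mn t; rewrite /A /= !in_itv/= => /andP[h ->]; rewrite andbT; apply: le_lt_trans h.
  by rewrite lerN2 lef_pV2 ?posrE// ler_nat.
have A0 : {ae leb, forall t : mR, exists n, ~ A n t}.
  apply: nearW => t; have [t0|t0] := ltP (t : R) 0%R; last first.
    by exists 0%N; rewrite /A /= in_itv/= [(t < 0)%R]ltNge t0 andbF.
  exists (Num.truncn (- t)^-1); rewrite /A /= in_itv/= => /andP[+ _].
  apply/negP; rewrite -leNgt lerNr -[leRHS]invrK lef_pV2 ?posrE ?invr_gt0 ?oppr_gt0//.
  exact/ltW/truncnS_gt.
have [n hn] := small_integral mA decA A0 mk k0 ik eta0.
exists (n.+1%:R^-1)%R; first by rewrite invr_gt0.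
move=> T /andP[T0 Tn]; apply: le_trans hn; apply: ge0_subset_integral => //.
- exact: measurable_funTS.
- move=> t; rewrite /A /= !in_itv/= => /andP[h ->]; rewrite andbT.
  by apply: le_lt_trans h; rewrite lerN2.
Qed.

Lemma small_space_integral (k : mspace R -> \bar R) (eta : R) :
  measurable_fun setT k -> (forall x, 0 <= k x) -> \int[leb3 R]_x k x < +oo -> (0 < eta)%R ->
  exists2 d : R, (0 < d)%R & forall r, (0 < r <= d)%R ->
    \int[leb3 R]_(x in scube r) k x <= eta%:E.
Proof.
move=> mk k0 ik eta0.
pose A (n : nat) := @scube R (n.+1%:R^-1)%R.
have mA n : measurable (A n) by exact: measurable_scube.
have decA m n : (m <= n)%N -> A n `<=` A m.
  by move=> mn; apply: scubeS; rewrite lef_pV2 ?posrE// ler_nat.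
(* The cubes shrink to the origin; the larger null set x3 = 0 is a convenient exceptional set. *)
have A0 : {ae leb3 R, forall x : mspace R, exists n, ~ A n x}.
  exists ((setT `*` [set 0%R]) : set (mspace R)); split.
  - by apply: measurableX => //; exact: measurable_set1.
  - transitivity ((leb2 R) setT * leb [set 0%R]).
      exact: (product_measure1E (leb2 R) leb measurableT (measurable_set1 _)).
    by rewrite [X in _ * X](_ : _ = 0) ?mule0//; exact: lebesgue_measure_set1.
  - move=> x /= nx; split=> //=; apply: contrapT => x0; apply: nx.
    have x0' : (0 < `|x.2 : R|)%R by rewrite normr_gt0; exact/eqP.
    exists (Num.truncn (`|x.2 : R|)^-1) => -[_ _].
    rewrite -ltr_norml; apply/negP; rewrite -leNgt -[leRHS]invrK lef_pV2 ?posrE ?invr_gt0//.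
    exact/ltW/truncnS_gt.
have [n hn] := small_integral mA decA A0 mk k0 ik eta0.
exists (n.+1%:R^-1)%R; first by rewrite invr_gt0.
move=> r /andP[r0 rn]; apply: le_trans hn; apply: ge0_subset_integral => //.
- exact: measurable_scube.
- exact: measurable_funTS.
- exact: scubeS.
Qed.

(** The exponent relation makes the product of the space and time factors exactly r^4. Smallness
    comes only from the integral of the slice norm over the short interval ]-r^be, 0[. *)
Lemma slab_small_finite (F : mV -> R) (s : \bar R) (l be eta : R) :
  measurable_fun setT F -> 1 <= s -> (1 <= l)%R -> (0 < be)%R ->
  (3 * (1 - fine s^-1) + be * (1 - l^-1) = 4)%R ->
  \int[leb]_t 'N[leb3 R]_s[(fun x => (F (x, t))%:E)] `^ l < +oo -> (0 < eta)%R ->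
  exists2 d : R, (0 < d)%R & forall r, (0 < r <= d)%R ->
    \int[leb4 R]_(z in slab r (r `^ be)) `|F z|%:E <= (eta * r ^+ 4)%:E.
Proof.
move=> mF s1 l1 be0 expo hn eta0; have l0 : (0 < l)%R := lt_le_trans ltr01 l1.
(* 16 = 8 + 8: the constant 8 of the space estimate, for each of the two terms of the splitting in
   time. *)
pose kap : R := (eta / 16)%R; have kap0 : (0 < kap)%R by rewrite divr_gt0.
pose n (t : mR) := 'N[leb3 R]_s[(fun x => (F (x, t))%:E)].
have mn : measurable_fun setT (fun t => n t `^ l).
  by apply: (measurableT_comp (measurable_poweR _)); exact: measurable_Lnorm_slice.
have n0 t : 0 <= n t `^ l by exact: poweR_ge0.
have kl0 : (0 < kap `^ l)%R by exact: powR_gt0.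
have [d d0 hd] := small_time_integral mn n0 hn kl0.
exists (d `^ be^-1)%R; first exact: powR_gt0.
move=> r /andP[r0 rd].
have T0 : (0 < r `^ be)%R by exact: powR_gt0.
have Td : (r `^ be <= d)%R.
  have -> : d = ((d `^ be^-1) `^ be)%R by rewrite -powRrM mulVf ?gt_eqF// powRr1// ltW.
  by rewrite ge0_ler_powR ?nnegrE ?powR_ge0// ltW.
(* Chosen so that both terms of the splitting become kap times r^(be (1 - 1/l)), once the time
   integral is below kap^l. *)
pose lam : R := (kap * r `^ (- (be / l)))%R.
have lam0 : (0 < lam)%R by rewrite mulr_gt0// powR_gt0.
apply: le_trans (slab_mixed_le mF s1 l1 r0 T0 lam0) _.
have E1 : (r `^ be * lam = kap * r `^ (be * (1 - l^-1)))%R.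
  rewrite /lam mulrCA -powRD; last by rewrite (gt_eqF r0) implybT.
  by congr (_ * _ `^ _)%R; ring.
have E2 : (lam `^ (1 - l) = kap `^ (1 - l) * r `^ (be * (1 - l^-1)))%R.
  rewrite /lam powRM ?powR_ge0 ?(ltW kap0)// -powRrM; congr (_ * _ `^ _)%R.
  by field; rewrite gt_eqF.
have E3 : (kap `^ (1 - l) * kap `^ l = kap)%R.
  rewrite -powRD; last by rewrite (gt_eqF kap0) implybT.
  by rewrite subrK powRr1// ltW.
have Td' : (0 < r `^ be <= d)%R by rewrite T0.
apply: (@le_trans _ _ ((8 * r `^ (3 * (1 - fine s^-1)))%:E *
    ((r `^ be * lam)%:E + (lam `^ (1 - l))%:E * (kap `^ l)%:E))).
  rewrite lee_wpmul2l ?lee_fin ?mulr_ge0 ?powR_ge0// leeD2l// lee_wpmul2l ?lee_fin ?powR_ge0//.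
  exact: hd.
rewrite -[leLHS]/((8 * r `^ (3 * (1 - fine s^-1)) *
  (r `^ be * lam + lam `^ (1 - l) * kap `^ l))%:E) lee_fin E1 E2.
set X := (r `^ (3 * _))%R; set Y := (r `^ (be * (1 - l^-1)))%R.
have XY : (X * Y = r ^+ 4)%R.
  rewrite -powRD; last by rewrite (gt_eqF r0) implybT.
  by rewrite expo -powR_mulrn// ltW.
rewrite (_ : (_ * (_ + _) = 8 * (X * Y) * (kap + kap `^ (1 - l) * kap `^ l))%R); last by ring.
by rewrite E3 XY /kap le_eqVlt; apply/orP; left; apply/eqP; field.
Qed.
End slab_estimates.

Section limn_einf_bounds.
Local Open Scope ereal_scope.
Variable R : realType.
Implicit Types (w : (\bar R)^nat) (c : \bar R).

Lemma limn_einf_sup_einfs w : limn_einf w = ereal_sup (range (einfs w)).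
Proof. by rewrite limn_einf_lim; apply/cvg_lim => //; exact: cvg_einfs_sup. Qed.

Lemma limn_einf_ge w c k : (forall n, (k <= n)%N -> c <= w n) -> c <= limn_einf w.
Proof.
move=> h; rewrite limn_einf_sup_einfs.
apply: (@le_trans _ _ (einfs w k)); last by apply: ereal_sup_ubound; exists k.
by apply: le_ereal_inf_tmp => _ [n /= kn <-]; exact: h.
Qed.

Lemma limn_einf_le w c : (forall n, w n <= c) -> limn_einf w <= c.
Proof.
move=> h; rewrite limn_einf_sup_einfs; apply: ub_ereal_sup => _ [n _ <-].
apply: le_trans (h n); apply: ereal_inf_lbound; exists n => //=; exact: leqnn.
Qed.
End limn_einf_bounds.

(** * The time derivative and the trace at time 0 *)

Section time_derivative.
Variable R : realType.
Local Notation V := (spacetime R).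
Local Notation mV := (mspacetime R).
Local Notation mR := (measurableTypeR R).
Local Notation leb := (@lebesgue_measure R).
Local Open Scope ereal_scope.

(** The same balance as in [slab_small_finite], but with a time integral that is only bounded by a
    power of r; [lam] absorbs that power. *)
Lemma slab_derivative_le (G : mV -> R) (s l be gam K r : R) :
  measurable_fun setT G -> (1 <= s)%R -> (1 <= l)%R -> (0 < r)%R ->
  (3 * (1 - s^-1) + gam + be * (1 - l^-1) = 2)%R ->
  \int[leb]_(t in `](- r `^ be)%R, 0%R[)
    (\int[leb3 R]_(x in scube r) (`|G (x, t)| `^ s)%:E) `^ (l / s) <= (K * r `^ (gam * l))%:E ->
  \int[leb4 R]_(z in slab r (r `^ be)) `|G z|%:E <= (8 * (1 + K) * r ^+ 2)%:E.
Proof.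
move=> mG s1 l1 r0 expo hK.
have s0 : (0 < s)%R := lt_le_trans ltr01 s1.
have l0 : (0 < l)%R := lt_le_trans ltr01 l1.
have mX : measurable (scube r `*` [set: mR]) by apply: measurableX => //; exact: measurable_scube.
(* Cut in space only: the slice norms of [F] are then the norms of [G] over the cube. *)
pose F : mV -> R := G \_ (scube r `*` [set: mR]).
have mF : measurable_fun setT F.
  by apply/(measurable_restrictT _ mX); exact: measurable_funTS.
have FE : \int[leb4 R]_(z in slab r (r `^ be)) `|G z|%:E = \int[leb4 R]_(z in slab r (r `^ be)) `|F z|%:E.
  apply: eq_integral => z; rewrite inE => -[zr _].
  by rewrite /F patchE mem_set//; split.
have T0 : (0 < r `^ be)%R by exact: powR_gt0.
pose lam : R := (r `^ (gam - be / l))%R.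
have lam0 : (0 < lam)%R by exact: powR_gt0.
have s1e : 1 <= s%:E by rewrite lee_fin.
rewrite FE; apply: le_trans (slab_mixed_le mF s1e l1 r0 T0 lam0) _.
have nE (t : mR) : 'N[leb3 R]_s%:E[(fun x => (F (x, t))%:E)] `^ l =
    (\int[leb3 R]_(x in scube r) (`|G (x, t)| `^ s)%:E) `^ (l / s).
  have I : \int[leb3 R]_x (`|F (x, t)| `^ s)%:E = \int[leb3 R]_(x in scube r) (`|G (x, t)| `^ s)%:E.
    rewrite [RHS]integral_mkcond; apply: eq_integral => x _.
    rewrite patchE /F patchE; case: (boolP (x \in scube r)) => xr.
      by rewrite inE in xr; rewrite mem_set.
    rewrite memNset; first by rewrite normr0 powR0 ?gt_eqF.
    by move=> -[h _]; move/negP: xr; apply; rewrite inE.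
  rewrite -I mulrC (poweRrM _ s^-1 l).
  by rewrite [in LHS]unlock.
rewrite (eq_integral (fun t : mR => (\int[leb3 R]_(x in scube r) (`|G (x, t)| `^ s)%:E) `^ (l / s))); last first.
  by move=> t _; exact: nE.
rewrite inver gt_eqF//=.
apply: (@le_trans _ _ ((8 * r `^ (3 * (1 - s^-1)))%:E *
    ((r `^ be * lam)%:E + (lam `^ (1 - l))%:E * (K * r `^ (gam * l))%:E))).
  by rewrite lee_wpmul2l ?lee_fin ?mulr_ge0 ?powR_ge0// leeD2l// lee_wpmul2l ?lee_fin ?powR_ge0.
have rn x : (x == 0)%R ==> (r != 0)%R by rewrite (gt_eqF r0) implybT.
have E1 : (r `^ be * lam = r `^ (gam + be * (1 - l^-1)))%R.
  by rewrite /lam -powRD ?rn//; congr (_ `^ _)%R; ring.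
have E2 : (lam `^ (1 - l) * r `^ (gam * l) = r `^ (gam + be * (1 - l^-1)))%R.
  rewrite /lam -powRrM -powRD ?rn//; congr (_ `^ _)%R.
  by field; rewrite gt_eqF.
have E3 : (r `^ (3 * (1 - s^-1)) * r `^ (gam + be * (1 - l^-1)) = r ^+ 2)%R.
  by rewrite -powRD ?rn// addrA expo -powR_mulrn// ltW.
rewrite -[leLHS]/((8 * r `^ (3 * (1 - s^-1)) *
  (r `^ be * lam + lam `^ (1 - l) * (K * r `^ (gam * l))))%:E) lee_fin.
rewrite [(lam `^ _ * _)%R]mulrCA E1 E2 -E3 le_eqVlt; apply/orP; left; apply/eqP; ring.
Qed.

Lemma tonelli_spacetime_swap (X : set (mspace R)) (J : set mR) (F : mV -> \bar R) :
  measurable X -> measurable J -> measurable_fun setT F -> (forall z, 0 <= F z) ->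
  \int[leb4 R]_(z in X `*` J) F z = \int[leb3 R]_(x in X) \int[leb]_(t in J) F (x, t).
Proof.
move=> mX mJ mF F0; rewrite integral_mkcond.
have mFr : measurable_fun setT (F \_ (X `*` J)).
  by apply/(measurable_restrictT _ (measurableX mX mJ)); exact: measurable_funTS.
have Fr0 z : 0 <= (F \_ (X `*` J)) z by rewrite patchE; case: ifP.
rewrite (fubini_tonelli1 _ mFr Fr0) [RHS]integral_mkcond; apply: eq_integral => x _.
rewrite /fubini_F patchE; case: ifPn => xX.
  rewrite [RHS]integral_mkcond; apply: eq_integral => t _; rewrite !patchE.
  rewrite inE in xX; case: ifPn => [|/negP tJ].
    by rewrite inE => -[/= _ tJ]; rewrite mem_set.
  by rewrite memNset// => ht; apply: tJ; rewrite inE; split.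
rewrite integral0_eq// => t _; rewrite patchE memNset// => -[/= h _].
by move/negP: xX; apply; rewrite inE.
Qed.

Lemma measurable_time_integral (J : set mR) (F : mV -> \bar R) :
  measurable J -> measurable_fun setT F -> (forall z, 0 <= F z) ->
  measurable_fun setT (fun x : mspace R => \int[leb]_(t in J) F (x, t)).
Proof.
move=> mJ mF F0.
have mTJ : measurable ([set: mspace R] `*` J) by exact: measurableX.
have mFr : measurable_fun setT (F \_ ([set: mspace R] `*` J)).
  by apply/(measurable_restrictT _ mTJ); exact: measurable_funTS.
have Fr0 z : 0 <= (F \_ ([set: mspace R] `*` J)) z by rewrite patchE; case: ifP.
have := measurable_fun_fubini_tonelli_F (m2 := leb) _ mFr Fr0.
congr measurable_fun; apply/funext => x; rewrite /fubini_F [RHS]integral_mkcond.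
apply: eq_integral => t _; rewrite !patchE; case: ifPn => [|/negP tJ].
  by rewrite inE => -[/= _ tJ]; rewrite mem_set.
by rewrite memNset// => ht; apply: tJ; rewrite inE; split.
Qed.

Lemma shift_t (z : V) (h : R) : (z + h *: dir_t R = (z.1, z.2 + h))%R.
Proof.
apply: prP => i; rewrite prD prZ; case: i => [[|[|[|[|n]]]]] // p;
  by rewrite /pr /dir_t /= ?mulr1 ?mulr0 ?addr0.
Qed.

(* The function [u] plays the role of [|v(x, 0)|^s]: it is the lower limit of
   the averages of [|F(x, t)|^s] over short time intervals ending at [0]. *)
Lemma trace_majorant (F G : mV -> R) (s N : R) :
  measurable_fun setT F -> measurable_fun setT G -> (1 <= s)%R -> (0 <= N)%R ->
  {ae leb4 R, forall z, ae_line F G (dir_t R) z} ->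
  {ae leb, forall t : mR, (- 1 < t < 0)%R ->
    \int[leb3 R]_(x in scube 2^-1) (`|F (x, t)| `^ s)%:E <= N%:E} ->
  exists u : mspace R -> \bar R, [/\ measurable_fun setT u, forall x, 0 <= u x,
    \int[leb3 R]_(x in scube 2^-1) u x <= N%:E &
    {ae leb4 R, forall z : mV, box1 z -> forall T lam : R, (- T < z.2)%R -> (0 < lam)%R ->
      `|F z|%:E <= \int[leb]_(t in `](- T)%R, 0%R[) `|G (z.1, t)|%:E +
         lam%:E + (lam `^ (1 - s))%:E * u z.1}].
Proof.
move=> mF mG s1 N0 HL HN; have s0 : (0 < s)%R := lt_le_trans ltr01 s1.
pose Fs (z : mV) : \bar R := (`|F z| `^ s)%:E.
have mFs : measurable_fun setT Fs.
  apply/measurable_EFinP; apply: (measurableT_comp (measurable_powR _)).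
  exact: measurableT_comp.
have Fs0 z : 0 <= Fs z by rewrite lee_fin powR_ge0.
pose eps (k : nat) : R := (k.+1%:R^-1)%R.
have eps0 k : (0 < eps k)%R by rewrite invr_gt0.
have eps1 k : (eps k <= 1)%R by rewrite invf_le1// ler1n.
pose J k : set mR := `](- eps k)%R, 0%R[%classic.
have mJ k : measurable (J k) by exact: measurable_itv.
pose W k (x : mspace R) := (k.+1%:R)%:E * \int[leb]_(t in J k) Fs (x, t).
have mW k : measurable_fun setT (W k).
  by apply: measurable_funeM; exact: measurable_time_integral.
have W0 k x : 0 <= W k x by apply: mule_ge0; [rewrite lee_fin|exact: integral_ge0].
have mQ := @measurable_scube R 2^-1.
exists (fun x => limn_einf (W ^~ x)); split.
- apply: (emeasurable_fun_cvg (fun k x => einfs (W ^~ x) k)).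
    by move=> k; apply: measurable_fun_einfs => n; exact: mW.
  by move=> x _; rewrite limn_einf_sup_einfs; exact: cvg_einfs_sup.
- by move=> x; apply: (limn_einf_ge (k := 0)) => n _; exact: W0.
(* Fatou's lemma: by Tonelli each average has integral at most N over the cube. *)
- apply: le_trans (fatou (leb3 R) mQ (fun n => measurable_funTS (mW n)) (fun n x _ => W0 n x)) _.
  apply: limn_einf_le => k; rewrite /W.
  have mk : measurable_fun (@scube R 2^-1) (fun x => \int[leb]_(t in J k) Fs (x, t)).
    by apply: measurable_funTS; exact: measurable_time_integral.
  have pk (x : mspace R) : scube 2^-1 x -> 0 <= \int[leb]_(t in J k) Fs (x, t).
    by move=> _; exact: integral_ge0.
  rewrite (ge0_integralZl (leb3 R) mQ mk pk)//.
  rewrite -(tonelli_spacetime_swap mQ (mJ k) mFs Fs0) (tonelli_spacetime mQ (mJ k) mFs Fs0).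
  apply: (@le_trans _ _ (k.+1%:R%:E * \int[leb]_(t in J k) (cst N%:E t))).
    rewrite lee_wpmul2l//; apply: ae_ge0_le_integral => //.
    + by move=> t _; exact: integral_ge0.
    + by apply: measurable_funTS; exact: measurable_slice_integral.
    + apply: filterS HN => t Nt; rewrite /J /= in_itv/= => /andP[t1 t2]; apply: Nt.
      by rewrite t2 (le_lt_trans _ t1)// lerN2.
  rewrite integral_cst// [X in _ * (_ * X)]lebesgue_measure_window//.
  by rewrite -!EFinM lee_fin /eps mulrCA mulfV ?mulr1// pnatr_eq0.
apply: filterS HL => -[x t] Hz zbox T lam; rewrite [(_, _).2]/= [(_, _).1]/= => Tt lam0.
have /box1E[/= _ _ _ /andP[t1 t0]] := zbox.
set g := \int[leb]_(tau in _) _.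
have g0 : 0 <= g by apply: integral_ge0 => tau _; rewrite lee_fin.
have U0 : 0 <= limn_einf (W ^~ x) by apply: (limn_einf_ge (k := 0)) => n _; exact: W0.
have lU0 : 0 <= (lam `^ (1 - s))%:E * limn_einf (W ^~ x).
  by rewrite mule_ge0// lee_fin powR_ge0.
have [gy|gy] := eqVneq g +oo.
  have D0 : 0 <= lam%:E + (lam `^ (1 - s))%:E * limn_einf (W ^~ x).
    by rewrite adde_ge0// lee_fin ltW.
  rewrite gy -addeA addye ?leey// gt_eqF//; exact: lt_le_trans ltNy0 D0.
have gfin : g \is a fin_num.
  by move: g0 gy; case: g.
(* The value for which |F (x, t)| equals g + lam + lam^(1-s) c. The line inequality and
   [le_powR_split] give c <= |F (x, t + h)|^s for almost every later time, so c is below all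
   averages close to time 0 and below their lower limit. *)
pose c : R := ((`|F (x, t)| - fine g - lam) * lam `^ (s - 1))%R.
have EL : (lam `^ (1 - s) * lam `^ (s - 1) = 1)%R.
  rewrite -powRD; last by rewrite (gt_eqF lam0) implybT.
  by rewrite (_ : 1 - s + (s - 1) = 0)%R ?powRr0//; ring.
have ls0 : (0 < lam `^ (s - 1))%R by exact: powR_gt0.
have line : {ae leb, forall h : mR, (0 < h < - t)%R -> c%:E <= Fs (x, t + h)%R}.
  apply: filterS (Hz zbox) => h Hh /andP[h0 ht].
  have zh : box1 (((x, t) : V) + h *: dir_t R)%R.
    rewrite shift_t; apply/box1E; have /box1E[/= b1 b2 b3 _] := zbox.
    by split => //=; apply/andP; split; lra.
  have {}Hh := Hh h0 zh; rewrite shift_t /= in Hh.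
  have mGx : measurable_fun setT (fun tau : mR => `|G (x, tau)|%:E).
    apply/measurable_EFinP; apply: measurableT_comp => //.
    exact: (measurableT_comp mG (measurable_pair1 x)).
  have gh : \int[leb]_(a in `[0%R, h]) `|G ((x, t) + a *: dir_t R)%R|%:E <= g.
    apply: (le_trans _ (ge0_integral_shift_le (q := fun tau => `|G (x, tau)|%:E) (x := t)
      (J := `[0%R, h]%classic) (I := `](- T)%R, 0%R[%classic) _ _ mGx _ _)).
    - by rewrite le_eqVlt; apply/orP; left; apply/eqP; apply: eq_integral => a _; rewrite shift_t.
    - exact: measurable_itv.
    - exact: measurable_itv.
    - by move=> a; rewrite lee_fin.
    - by move=> a /=; rewrite !in_itv/= => /andP[? ?]; apply/andP; split; lra.
  have := le_trans Hh (leeD2l _ gh).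
  rewrite -(fineK gfin) -EFinD !lee_fin => h1.
  have h2 := le_powR_split (normr_ge0 (F (x, (t + h)%R))) lam0 s1.
  rewrite /c -(ler_pM2r (powR_gt0 (1 - s) lam0)) -mulrA [(lam `^ (s - 1) * _)%R]mulrC EL mulr1.
  by rewrite [leRHS]mulrC; lra.
have cW : c%:E <= limn_einf (W ^~ x).
  have [c0|c0] := leP c 0%R; first by apply: le_trans U0; rewrite lee_fin.
  have nt0 : (0 < - t)%R by rewrite oppr_gt0.
  (* From this index on, the averaging interval lies after time t. *)
  apply: (limn_einf_ge (k := Num.truncn (- t)^-1)) => k kt.
  have ekt : (eps k <= - t)%R.
    rewrite /eps -[leRHS]invrK lef_pV2 ?posrE ?invr_gt0//.
    by apply/ltW/(lt_le_trans (truncnS_gt _)); rewrite ler_nat.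
  pose I : set mR := `](- t - eps k)%R, (- t)%R[%classic.
  have mI : measurable I by exact: measurable_itv.
  have lI : leb I = (eps k)%:E.
    have E : leb (`](- t - eps k)%R, (- t)%R[%classic : set R) = (eps k)%:E.
      rewrite lebesgue_measure_itv/= lte_fin gtrBl eps0 -EFinD.
      by congr (_%:E); ring.
    exact: E.
  have mFx : measurable_fun setT (fun tau : mR => Fs (x, tau)).
    exact: (measurableT_comp mFs (measurable_pair1 x)).
  have msh : measurable_fun setT (fun h : mR => Fs (x, t + h)%R).
    have m1 : measurable_fun setT (fun h : mR => (h + t)%R : mR).
      by have [] := preserves_lebesgue_shift t.
    have := measurableT_comp mFx m1.
    by under [X in measurable_fun _ X -> _]eq_fun do rewrite /= addrC.
  have ek : (eps k)%:E * (k.+1%:R : R)%:E = 1 by rewrite -EFinM mulVf ?pnatr_eq0.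
  rewrite /W -(@lee_pmul2l _ (eps k)%:E)// ?lte_fin// muleA ek mul1e.
  apply: (@le_trans _ _ (\int[leb]_(h in I) Fs (x, t + h)%R)); last first.
    apply: (ge0_integral_shift_le (q := fun tau => Fs (x, tau))) => //.
    by move=> h; rewrite /I /J /= !in_itv/= => /andP[? ?]; apply/andP; split; lra.
  rewrite muleC -lI -integral_cst//; apply: ae_ge0_le_integral => //.
  - by move=> h _; rewrite lee_fin ltW.
  - exact: measurable_funTS.
  - apply: filterS line => h Hh; rewrite /I /= in_itv/= => /andP[h1 h2]; apply: Hh.
    by rewrite h2 andbT; lra.
apply: (@le_trans _ _ (g + lam%:E + (lam `^ (1 - s))%:E * c%:E)).
  rewrite -(fineK gfin) -EFinM -!EFinD lee_fin /c mulrCA EL mulr1.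
  by rewrite le_eqVlt; apply/orP; left; apply/eqP; ring.
by apply: leeD2l; apply: lee_wpmul2l => //; rewrite lee_fin powR_ge0.
Qed.

(** * Smallness of the integrals of |f|, f^2 and |f|^3 on slabs *)

Implicit Types (r m : R).

Lemma powRDgt0 r (a b : R) : (0 < r)%R -> (r `^ a * r `^ b = r `^ (a + b))%R.
Proof. by move=> r0; rewrite -powRD// (gt_eqF r0) implybT. Qed.

Lemma powR_le1 r (p : R) : (0 <= r <= 1)%R -> (0 <= p)%R -> (r `^ p <= 1)%R.
Proof.
move=> /andP[r0 r1] p0; have E1 : (1 = 1 `^ p :> R)%R by rewrite powR1.
by rewrite [leRHS]E1 ge0_ler_powR ?nnegrE.
Qed.

Lemma powR_small (p c : R) : (0 < p)%R -> (0 < c)%R ->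
  exists2 d : R, (0 < d)%R & forall r, (0 < r <= d)%R -> (r `^ p <= c)%R.
Proof.
move=> p0 c0; exists (c `^ p^-1)%R; first exact: powR_gt0.
move=> r /andP[r0 rd].
have -> : c = ((c `^ p^-1) `^ p)%R by rewrite -powRrM mulVf ?gt_eqF// powRr1// ltW.
by rewrite ge0_ler_powR ?nnegrE ?powR_ge0// ltW.
Qed.

Lemma slab_box1 (r T : R) : (r <= 2^-1)%R -> (T <= 1)%R -> slab r T `<=` @box1 R.
Proof.
move=> rh T1 z [/(scubeS rh)[c1 c2 c3]] /=; rewrite in_itv/= => /andP[t1 t2].
by apply/box1E; split=> //; rewrite t2 andbT (le_lt_trans _ t1)// lerN2.
Qed.

(** Integrate the trace majorant over the slab. The derivative contributes a constant times r^(1-m)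
    r^4, the trace its integral over a small cube, and [lam] balances the remaining terms. *)
Lemma slab_small_sup (D : set V) (f g : V -> R) (m s s1 l1 N K eta : R) :
  @box1 R `<=` D -> weak_derivative D (dir_t R) f g ->
  (m < 1)%R -> (1 <= s)%R -> ((2 - m) * s = 3)%R ->
  (1 <= s1)%R -> (1 <= l1)%R -> (3 / s1 + 2 / l1 = 4)%R -> (0 <= N)%R -> (0 <= K)%R ->
  {ae leb, forall t : mR, (- 1 < t < 0)%R ->
    \int[leb3 R]_(x in scube 2^-1) (`|cut f (x, t)| `^ s)%:E <= N%:E} ->
  (forall r, (0 < r <= 4^-1)%R ->
    \int[leb]_(t in `](- r `^ (3 - m))%R, 0%R[)
      (\int[leb3 R]_(x in scube r) (`|cut g (x, t)| `^ s1)%:E) `^ (l1 / s1) <=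
    (K * r `^ (gamma_star s1 m * l1))%:E) ->
  (0 < eta)%R ->
  exists2 d : R, (0 < d)%R & forall r, (0 < r <= d)%R ->
    \int[leb4 R]_(z in slab r (r `^ (3 - m))) `|cut f z|%:E <= (eta * r ^+ 4)%:E.
Proof.
move=> BD wd m1 s_ge1 ms s11 l11 sl N0 K0 hN hK eta0.
have [lf lg _] := wd.
have mF := measurable_cut lf BD; have mG := measurable_cut lg BD.
have s10 : (0 < s1)%R := lt_le_trans ltr01 s11.
have l10 : (0 < l1)%R := lt_le_trans ltr01 l11.
have dirt i : (0 <= pr i (dir_t R))%R.
  by rewrite /pr /dir_t; case: i => [[|[|[|[|i]]]] p]/=.
have [u [mu u0 uN hu]] := trace_majorant mF mG s_ge1 N0 (ae_line_bound BD wd dirt) hN.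
have mQ := @measurable_scube R 2^-1.
pose u' := u \_ (scube 2^-1).
have mu' : measurable_fun setT u'.
  by apply/(measurable_restrictT _ mQ); exact: measurable_funTS.
have u'0 x : 0 <= u' x by rewrite /u' patchE; case: ifP.
have iu' : \int[leb3 R]_x u' x < +oo.
  by rewrite -integral_mkcond (le_lt_trans uN)// ltry.
(* 10 = 1 + 8 + 1: the derivative, the constant [lam] over a cube of volume 8 r^3, and the trace. *)
pose kap : R := (eta / 10)%R; have kap0 : (0 < kap)%R by rewrite divr_gt0.
have [d1 d10 hd1] := small_space_integral mu' u'0 iu' (powR_gt0 s kap0).
have C0 : (0 < 8 * (1 + K))%R by rewrite mulr_gt0// ltr_pwDl.
have m1' : (0 < 1 - m)%R by rewrite subr_gt0.
have [d2 d20 hd2] := powR_small m1' (divr_gt0 kap0 C0).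
exists (Num.min 4^-1 (Num.min d1 d2))%R; first by rewrite !lt_min d10 d20 invr_gt0 ltr0n.
move=> r; rewrite !le_min => /andP[r0 /and3P[r4 rd1 rd2]].
have rr1 : (0 < r <= 4^-1)%R by rewrite r0.
have r1 : (r <= 1)%R by apply: (le_trans r4); rewrite invf_le1// ler1n.
have rh : (r <= 2^-1)%R by rewrite (le_trans r4)// lef_pV2 ?posrE// ler_nat.
set T := (r `^ (3 - m))%R.
have T0 : (0 < T)%R by exact: powR_gt0.
have T1 : (T <= 1)%R.
  by rewrite powR_le1 ?(ltW r0)// subr_ge0 (le_trans (ltW m1))// ler1n.
pose J : set mR := `](- T)%R, 0%R[%classic.
have mJ : measurable J by exact: measurable_itv.
have mC := measurable_scube r.
(* The natural size r^-alpha times kap. Since (2 - m) s = 3, both the term in [lam] and the one in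
   lam^(1-s) then scale like r^4 after multiplication by T. *)
pose lam : R := (kap * r `^ (m - 2))%R.
have lam0 : (0 < lam)%R by rewrite mulr_gt0// powR_gt0.
pose gx (x : mspace R) := \int[leb]_(t in J) `|cut g (x, t)|%:E.
have mabsG : measurable_fun setT (fun z => `|cut g z|%:E).
  by apply/measurable_EFinP; exact: measurableT_comp.
have mgx : measurable_fun setT gx by exact: (measurable_time_integral mJ mabsG).
have gx0 x : 0 <= gx x by exact: integral_ge0.
pose H (x : mspace R) := gx x + lam%:E + (lam `^ (1 - s))%:E * u x.
have ls0 : (0 <= lam `^ (1 - s))%R by exact: powR_ge0.
have mlu : measurable_fun setT (fun x => (lam `^ (1 - s))%:E * u x) by exact: measurable_funeM.
have lu0 x : 0 <= (lam `^ (1 - s))%:E * u x by rewrite mule_ge0.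
have mgl : measurable_fun setT (fun x => gx x + lam%:E).
  by apply: emeasurable_funD => //; exact: measurable_cst.
have gl0 x : 0 <= gx x + lam%:E by rewrite adde_ge0// lee_fin ltW.
have mH : measurable_fun setT H by exact: emeasurable_funD.
have H0 x : 0 <= H x by rewrite adde_ge0.
have mslab : measurable (slab r T) by exact: measurableX.
have mHz : measurable_fun setT (fun z : mV => H z.1).
  exact: (measurableT_comp mH measurable_fst).
apply: (@le_trans _ _ (\int[leb4 R]_(z in slab r T) H z.1)).
  apply: ae_ge0_le_integral => //.
  - by apply: measurable_funTS; apply/measurable_EFinP; exact: measurableT_comp.
  - exact: measurable_funTS.
  - apply: filterS hu => z hz zs; apply: hz (slab_box1 rh T1 zs) _ _ _ lam0.
    by case: zs => _ /=; rewrite in_itv/= => /andP[].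
rewrite (tonelli_spacetime_swap mC mJ mHz (fun z => H0 z.1)).
have -> : \int[leb3 R]_(x in scube r) \int[leb]_(t in J) H ((x, t) : mV).1 =
    T%:E * \int[leb3 R]_(x in scube r) H x.
  have pH (x : mspace R) : scube r x -> 0 <= H x by move=> _; exact: H0.
  rewrite -(ge0_integralZl (leb3 R) mC (measurable_funTS mH) pH) ?lee_fin ?(ltW T0)//.
  apply: eq_integral => x _; transitivity (\int[leb]_(t in J) cst (H x) t) => //.
  by rewrite integral_cst// [X in _ * X]lebesgue_measure_window// muleC.
have -> : \int[leb3 R]_(x in scube r) H x = \int[leb3 R]_(x in scube r) gx x +
    (lam * (8 * r ^+ 3))%:E + (lam `^ (1 - s))%:E * \int[leb3 R]_(x in scube r) u x.
  have p1 (x : mspace R) : scube r x -> 0 <= gx x + lam%:E by [].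
  have p2 (x : mspace R) : scube r x -> 0 <= (lam `^ (1 - s))%:E * u x by [].
  have p3 (x : mspace R) : scube r x -> 0 <= gx x by [].
  have p4 (x : mspace R) : scube r x -> 0 <= lam%:E by rewrite lee_fin ltW.
  have p5 (x : mspace R) : scube r x -> 0 <= u x by [].
  rewrite (ge0_integralD (leb3 R) mC p1 (measurable_funTS mgl) p2 (measurable_funTS mlu)).
  rewrite (ge0_integralD (leb3 R) mC p3 (measurable_funTS mgx) p4 (measurable_cst _)).
  rewrite (ge0_integralZl (leb3 R) mC (measurable_funTS mu) p5) ?lee_fin//.
  by rewrite integral_cst// [X in _ + _ * X + _]leb3_scube.
have I1 : \int[leb3 R]_(x in scube r) gx x <= (8 * (1 + K) * r ^+ 2)%:E.
  rewrite -(tonelli_spacetime_swap mC mJ mabsG) => [|z]; last by rewrite lee_fin.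
  apply: (slab_derivative_le mG s11 l11 r0 _ (hK r rr1)).
  (* With k = 3 / (2 s1) one has 1 - 1/l1 = k - 1, and m cancels: 3 - 2k + 1 - (k - 1)(1 - m) + (3 -
     m)(k - 1) = 2. *)
  rewrite /gamma_star.
  have -> : (l1^-1 = (4 - 3 / s1) / 2)%R by rewrite -sl; field; rewrite !gt_eqF.
  by field; rewrite gt_eqF.
have I2 : \int[leb3 R]_(x in scube r) u x <= (kap `^ s)%:E.
  apply: le_trans (hd1 r _); last by rewrite r0.
  rewrite le_eqVlt; apply/orP; left; apply/eqP; apply: eq_integral => x.
  by rewrite inE /u' patchE => /(scubeS rh) xh; rewrite mem_set.
apply: (@le_trans _ _ (T%:E * ((8 * (1 + K) * r ^+ 2)%:E + (lam * (8 * r ^+ 3))%:E +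
    (lam `^ (1 - s))%:E * (kap `^ s)%:E))).
  rewrite lee_wpmul2l ?lee_fin ?(ltW T0)//; apply: leeD; first exact: leeD2r.
  by rewrite lee_wpmul2l ?lee_fin.
rewrite -[leLHS]/((T * (8 * (1 + K) * r ^+ 2 + lam * (8 * r ^+ 3) +
    lam `^ (1 - s) * kap `^ s))%:E) lee_fin.
have rX (n : nat) : (r ^+ n = r `^ n%:R)%R by rewrite powR_mulrn// ltW.
have E1 : (T * r ^+ 2 = r `^ (1 - m) * r ^+ 4)%R.
  by rewrite !rX !powRDgt0//; congr (_ `^ _)%R; ring.
have E2 : (T * (lam * r ^+ 3) = kap * r ^+ 4)%R.
  rewrite /lam /T !rX.
  rewrite (_ : (_ * (kap * _ * _) = kap * (r `^ (3 - m) * r `^ (m - 2) * r `^ 3%:R))%R); last by ring.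
  by rewrite !powRDgt0//; congr (_ * _ `^ _)%R; ring.
have kk : (kap `^ (1 - s) * kap `^ s = kap)%R.
  by rewrite powRDgt0// subrK powRr1// ltW.
have E3 : (T * (lam `^ (1 - s) * kap `^ s) = kap * r ^+ 4)%R.
  rewrite /lam /T powRM ?powR_ge0 ?(ltW kap0)// -powRrM rX.
  rewrite (_ : (_ * (_ * _ * _) =
    kap `^ (1 - s) * kap `^ s * (r `^ (3 - m) * r `^ ((m - 2) * (1 - s))))%R); last by ring.
  rewrite kk powRDgt0//; congr (_ * _ `^ _)%R.
  rewrite (_ : (3 - m + (m - 2) * (1 - s) = 1 + (2 - m) * s)%R); last by ring.
  by rewrite ms; ring.
have E4 : (8 * (1 + K) * r `^ (1 - m) <= kap)%R.
  by rewrite mulrC -ler_pdivlMr//; apply: hd2; rewrite r0.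
have r40 : (0 <= r ^+ 4)%R by rewrite exprn_ge0// ltW.
have E5 := ler_wpM2r r40 E4.
rewrite (_ : (T * _ = 8 * (1 + K) * (T * r ^+ 2) + 8 * (T * (lam * r ^+ 3)) +
  T * (lam `^ (1 - s) * kap `^ s))%R); last by ring.
rewrite E1 E2 E3 mulrA; apply: (le_trans (lerD (lerD E5 (lexx _)) (lexx _))).
by rewrite /kap le_eqVlt; apply/orP; left; apply/eqP; field.
Qed.

(** Apply a^2 <= k a^3 + a / k with k = kap r^(2-m), the scale at which the cubic and the linear
    bounds both become multiples of r^(m+2). *)
Lemma slab_square_small (F : mV -> R) (m C del : R) :
  measurable_fun setT F -> (0 < C)%R -> (0 < del)%R ->
  (exists2 d : R, (0 < d)%R & forall r, (0 < r <= d)%R ->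
    \int[leb4 R]_(z in slab r (r `^ (3 - m))) (`|F z| ^+ 3)%:E <= (C * r `^ (2 * m))%:E) ->
  (forall eta : R, (0 < eta)%R -> exists2 d : R, (0 < d)%R & forall r, (0 < r <= d)%R ->
    \int[leb4 R]_(z in slab r (r `^ (3 - m))) `|F z|%:E <= (eta * r ^+ 4)%:E) ->
  exists2 d : R, (0 < d)%R & forall r, (0 < r <= d)%R ->
    \int[leb4 R]_(z in slab r (r `^ (3 - m))) (F z ^+ 2)%:E <= (del * r `^ (m + 2))%:E.
Proof.
move=> mF C0 del0 [d1 d10 h3] h1.
(* The cubic term then contributes del / 2, and so does the linear one, whose bound is taken with
   eta = kap del / 2. *)
pose kap : R := (del / (2 * C))%R.
have kap0 : (0 < kap)%R by rewrite divr_gt0// mulr_gt0.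
have [d2 d20 h2] := h1 (kap * (del / 2))%R (mulr_gt0 kap0 (divr_gt0 del0 (ltr0n _ 2))).
exists (Num.min d1 d2); first by rewrite lt_min d10.
move=> r; rewrite le_min => /and3P[r0 rd1 rd2].
have {}h3 := h3 r (introT andP (conj r0 rd1)); have {}h2 := h2 r (introT andP (conj r0 rd2)).
set S := slab r _ in h2 h3 *.
have mS : measurable S by apply: measurableX => //; exact: measurable_scube.
pose k : R := (kap * r `^ (2 - m))%R.
have k0 : (0 < k)%R by rewrite mulr_gt0// powR_gt0.
have mabs : measurable_fun setT (fun z => `|F z|%R) by exact: measurableT_comp.
have m1 : measurable_fun S (fun z => `|F z|%:E).
  by apply: measurable_funTS; apply/measurable_EFinP.
have m3 : measurable_fun S (fun z => (`|F z| ^+ 3)%:E).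
  by apply: measurable_funTS; apply/measurable_EFinP; exact: measurable_funX.
have p1 (z : mV) : S z -> 0 <= `|F z|%:E by rewrite lee_fin.
have p3 (z : mV) : S z -> 0 <= (`|F z| ^+ 3)%:E by rewrite lee_fin exprn_ge0.
have mk3 : measurable_fun S (fun z => k%:E * (`|F z| ^+ 3)%:E) by exact: measurable_funeM.
have mk1 : measurable_fun S (fun z => (k^-1)%:E * `|F z|%:E) by exact: measurable_funeM.
have pk3 (z : mV) : S z -> 0 <= k%:E * (`|F z| ^+ 3)%:E.
  by move=> zS; rewrite mule_ge0 ?p3// lee_fin ltW.
have pk1 (z : mV) : S z -> 0 <= (k^-1)%:E * `|F z|%:E.
  by move=> zS; rewrite mule_ge0// lee_fin invr_ge0 ltW.
apply: (@le_trans _ _ (\int[leb4 R]_(z in S) (k%:E * (`|F z| ^+ 3)%:E + (k^-1)%:E * `|F z|%:E))).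
  apply: ge0_le_integral => //.
  - by move=> z _; rewrite lee_fin sqr_ge0.
  - by apply: measurable_funTS; apply/measurable_EFinP; exact: measurable_funX.
  - exact: emeasurable_funD.
  - move=> z _; rewrite -!EFinM -EFinD lee_fin -(real_normK (num_real (F z))).
    set a := `|F z|%R; have a0 : (0 <= a)%R by rewrite /a.
    have ki0 : (0 < k^-1)%R by rewrite invr_gt0.
    have kk : (k * k^-1 = 1)%R by rewrite mulfV// gt_eqF.
    rewrite -subr_ge0 (_ : (_ - _ = a * (k^-1 * ((k * a - 1) ^+ 2 + k * a)))%R).
      by rewrite mulr_ge0// mulr_ge0 ?(ltW ki0)// addr_ge0 ?sqr_ge0// mulr_ge0// ltW.
    by field; rewrite gt_eqF.
rewrite (ge0_integralD (leb4 R) mS pk3 mk3 pk1 mk1).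
rewrite (ge0_integralZl (leb4 R) mS m3 p3) ?lee_fin ?(ltW k0)//.
rewrite (ge0_integralZl (leb4 R) mS m1 p1) ?lee_fin ?invr_ge0 ?(ltW k0)//.
apply: (@le_trans _ _ (k%:E * (C * r `^ (2 * m))%:E + (k^-1)%:E * (kap * (del / 2) * r ^+ 4)%:E)).
  by apply: leeD; rewrite lee_wpmul2l ?lee_fin ?invr_ge0 ?(ltW k0).
rewrite -!EFinM -EFinD lee_fin.
have E1 : (r `^ (2 - m) * r `^ (2 * m) = r `^ (m + 2))%R.
  by rewrite powRDgt0//; congr (_ `^ _)%R; ring.
have E2 : (r `^ (2 - m) * r `^ (m + 2) = r ^+ 4)%R.
  by rewrite powRDgt0// -(powR_mulrn 4 (ltW r0)); congr (_ `^ _)%R; ring.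
rewrite -E2 le_eqVlt; apply/orP; left; apply/eqP.
rewrite (_ : (k * _ = kap * C * (r `^ (2 - m) * r `^ (2 * m)))%R); last by rewrite /k; ring.
rewrite E1 /k /kap; field; rewrite (gt_eqF C0) (gt_eqF del0) gt_eqF//; exact: powR_gt0.
Qed.

(** [sobolev_box] is used twice: with e = 1 and the a priori bound on the integral of f^2 it bounds
    the cubic integral, which feeds [slab_square_small]; with e small and the improved bound on f^2
    it gives the claim. *)
Lemma slab_cube_small (D : set V) (f g1 g2 g3 : V -> R) (m M eta : R) :
  @box1 R `<=` D -> weak_derivative D (dir_x R (@Ordinal 3 0 isT)) f g1 ->
  weak_derivative D (dir_x R (@Ordinal 3 1 isT)) f g2 ->
  weak_derivative D (dir_x R (@Ordinal 3 2 isT)) f g3 ->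
  (0 <= m < 1)%R -> (0 < M)%R ->
  (forall r, (0 < r <= 8^-1)%R -> {ae leb, forall t : mR, (- r `^ (3 - m) < t < 0)%R ->
    \int[leb3 R]_(x in scube (2 * r)) (cut f (x, t) ^+ 2)%:E <= (M * r `^ (2 * m - 1))%:E}) ->
  (forall r, (0 < r <= 8^-1)%R -> [/\ energy r (r `^ (3 - m)) g1 <= (M * r `^ m)%:E,
    energy r (r `^ (3 - m)) g2 <= (M * r `^ m)%:E &
    energy r (r `^ (3 - m)) g3 <= (M * r `^ m)%:E]) ->
  (forall eta : R, (0 < eta)%R -> exists2 d : R, (0 < d)%R & forall r, (0 < r <= d)%R ->
    \int[leb4 R]_(z in slab r (r `^ (3 - m))) `|cut f z|%:E <= (eta * r ^+ 4)%:E) ->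
  (0 < eta)%R -> exists2 d : R, (0 < d)%R & forall r, (0 < r <= d)%R ->
    \int[leb4 R]_(z in slab r (r `^ (3 - m))) (`|cut f z| ^+ 3)%:E <= (eta * r `^ (2 * m))%:E.
Proof.
move=> BD w1 w2 w3 /andP[m0 m1] M0 hA hE h1 eta0.
have [lf _ _] := w1; have mF := measurable_cut lf BD.
have be0 : (0 <= 3 - m)%R by rewrite subr_ge0 (le_trans (ltW m1))// ler1n.
have T01 r : (0 < r <= 8^-1)%R -> (0 < r `^ (3 - m) <= 1)%R.
  move=> /andP[r0 r4]; rewrite powR_gt0//= powR_le1// ltW//=.
  by apply: (le_trans r4); rewrite invf_le1// ler1n.
(* With A = M r^(2m-1) and eps = e r^m every term scales like r^(2m). The factor 4 counts the three
   derivatives and the term T A / r^2, each at most M r^m. *)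
have bound e r (X : R) : (0 < e)%R -> (0 < r <= 8^-1)%R ->
    energy r (r `^ (3 - m)) f <= (X * r `^ (m + 2))%:E ->
    \int[leb4 R]_(z in slab r (r `^ (3 - m))) (`|cut f z| ^+ 3)%:E <=
      ((4 * M * e + 4 ^+ 6 * M ^+ 2 / e ^+ 3 * X) * r `^ (2 * m))%:E.
  move=> e0 rr hX; have /andP[r0 r4] := rr.
  have rr4 : (0 < r <= 4^-1)%R by rewrite r0 (le_trans r4)// lef_pV2 ?posrE// ler_nat.
  have A0 : (0 < M * r `^ (2 * m - 1))%R by rewrite mulr_gt0// powR_gt0.
  have ep0 : (0 < e * r `^ m)%R by rewrite mulr_gt0// powR_gt0.
  apply: le_trans (sobolev_box BD w1 w2 w3 rr4 (T01 r rr) A0 ep0 (hA r rr)) _.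
  have [e1 e2 e3] := hE r rr.
  apply: (@le_trans _ _ ((e * r `^ m)%:E * ((M * r `^ m)%:E + (M * r `^ m)%:E + (M * r `^ m)%:E +
     (r `^ (3 - m) * (M * r `^ (2 * m - 1) / r ^+ 2))%:E) +
     (4 ^+ 6 * (M * r `^ (2 * m - 1)) ^+ 2 / (e * r `^ m) ^+ 3)%:E * (X * r `^ (m + 2))%:E)).
    have q0 : (0 <= 4 ^+ 6 * (M * r `^ (2 * m - 1)) ^+ 2 / (e * r `^ m) ^+ 3)%R.
      by rewrite divr_ge0 ?exprn_ge0 ?(ltW ep0)// mulr_ge0 ?exprn_ge0// ltW.
    apply: leeD; last by rewrite lee_wpmul2l ?lee_fin.
    rewrite lee_wpmul2l ?lee_fin ?(ltW ep0)//; apply: leeD => //.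
    by apply: leeD => //; exact: leeD.
  rewrite -[leLHS]/((e * r `^ m * (M * r `^ m + M * r `^ m + M * r `^ m +
     r `^ (3 - m) * (M * r `^ (2 * m - 1) / r ^+ 2)) +
     4 ^+ 6 * (M * r `^ (2 * m - 1)) ^+ 2 / (e * r `^ m) ^+ 3 * (X * r `^ (m + 2)))%:E) lee_fin.
  have rX (n : nat) (a : R) : ((r `^ a) ^+ n = r `^ (a * n%:R))%R.
    by rewrite -powR_mulrn ?powR_ge0// -powRrM.
  have r2 : (r ^+ 2 = r `^ 2)%R by rewrite -powR_mulrn// ltW.
  have F1 : (r `^ (3 - m) * (M * r `^ (2 * m - 1) / r ^+ 2) = M * r `^ m)%R.
    rewrite r2 -powRN (_ : (_ * (M * _ * _) =
      M * (r `^ (3 - m) * r `^ (2 * m - 1) * r `^ (- 2)))%R); last by ring.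
    by rewrite !powRDgt0//; congr (_ * _ `^ _)%R; ring.
  have F2 : ((r `^ (2 * m - 1)) ^+ 2 * (r `^ (- m)) ^+ 3 * r `^ (m + 2) = r `^ (2 * m))%R.
    by rewrite !rX !powRDgt0//; congr (_ `^ _)%R; ring.
  have F3 : (r `^ m * r `^ m = r `^ (2 * m))%R.
    by rewrite powRDgt0//; congr (_ `^ _)%R; ring.
  have rm0 : (r `^ m != 0)%R by rewrite gt_eqF// powR_gt0.
  rewrite F1 -F3 le_eqVlt; apply/orP; left; apply/eqP.
  rewrite (_ : (4 ^+ 6 * _ / _ * _ = 4 ^+ 6 * M ^+ 2 / e ^+ 3 * X *
     ((r `^ (2 * m - 1)) ^+ 2 * (r `^ (- m)) ^+ 3 * r `^ (m + 2)))%R); last first.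
    by rewrite powRN; field; rewrite rm0 gt_eqF.
  by rewrite F2 -F3; field; rewrite gt_eqF.
have mQ r : measurable (scube (2 * r)) by exact: measurable_scube.
have msq : measurable_fun setT (fun z => (cut f z ^+ 2)%:E).
  by apply/measurable_EFinP; exact: measurable_funX.
have sq0 z : 0 <= (cut f z ^+ 2)%:E by rewrite lee_fin sqr_ge0.
have fE r : (0 < r <= 8^-1)%R -> energy r (r `^ (3 - m)) f <= (M * r `^ (m + 2))%:E.
  move=> rr; have /andP[r0 r4] := rr; have /andP[T0 T1] := T01 r rr.
  pose J : set mR := `](- r `^ (3 - m))%R, 0%R[%classic.
  have mJ : measurable J by exact: measurable_itv.
  rewrite /energy /slab (tonelli_spacetime (mQ r) mJ msq sq0).
  have A0 : (0 <= M * r `^ (2 * m - 1))%R by rewrite mulr_ge0 ?(ltW M0)// powR_ge0.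
  apply: (@le_trans _ _ (\int[leb]_(t in J) cst (M * r `^ (2 * m - 1))%:E t)).
    apply: ae_ge0_le_integral => //.
    - by move=> t _; exact: integral_ge0.
    - by apply: measurable_funTS; exact: (measurable_slice_integral (mQ r) msq sq0).
    - by apply: filterS (hA r rr) => t ht; rewrite /J /= in_itv.
  rewrite integral_cst// [X in _ * X]lebesgue_measure_window// -EFinM lee_fin -mulrA powRDgt0//.
  by rewrite (_ : (2 * m - 1 + (3 - m) = m + 2)%R)//; ring.
pose C : R := (4 * M * 1 + 4 ^+ 6 * M ^+ 2 / 1 ^+ 3 * M)%R.
have C0 : (0 < C)%R.
  by rewrite addr_gt0// ?mulr_gt0// ?divr_gt0// mulr_gt0// exprn_gt0.
have hC : exists2 d : R, (0 < d)%R & forall r, (0 < r <= d)%R ->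
    \int[leb4 R]_(z in slab r (r `^ (3 - m))) (`|cut f z| ^+ 3)%:E <= (C * r `^ (2 * m))%:E.
  exists (8^-1)%R; first by rewrite invr_gt0 ltr0n.
  by move=> r rr; apply: bound => //; exact: fE.
(* 4 M e = eta / 2. The other half comes from q times eta / (2 q), and 2^(m+2) in [del] pays for
   applying the bound on f^2 at radius 2r. *)
pose e : R := (eta / (8 * M))%R.
have e0 : (0 < e)%R by rewrite divr_gt0// mulr_gt0.
pose q : R := (4 ^+ 6 * M ^+ 2 / e ^+ 3)%R.
have q0 : (0 < q)%R by rewrite divr_gt0 ?exprn_gt0// mulr_gt0 ?exprn_gt0//.
pose del : R := (eta / (2 * q) / 2 `^ (m + 2))%R.
have p20 : (0 < (2 : R) `^ (m + 2))%R by exact: powR_gt0.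
have del0 : (0 < del)%R by rewrite !divr_gt0// mulr_gt0.
have [d d0 hd] := slab_square_small mF C0 del0 hC h1.
exists (Num.min 8^-1 (d / 2))%R; first by rewrite lt_min invr_gt0 ltr0n divr_gt0.
move=> r; rewrite le_min => /and3P[r0 r4 rd].
have rr : (0 < r <= 8^-1)%R by rewrite r0.
have r20 : (0 < 2 * r)%R by rewrite mulr_gt0.
have hf : energy r (r `^ (3 - m)) f <= (del * 2 `^ (m + 2) * r `^ (m + 2))%:E.
  rewrite -mulrA -powRM ?(ltW r0)//; apply: le_trans (hd (2 * r)%R _); last first.
    by rewrite r20 mulrC -ler_pdivlMr.
  have mS T : measurable (slab (2 * r) T) by apply: measurableX => //; exact: measurable_scube.
  rewrite /energy; apply: ge0_subset_integral => //; first exact: measurable_funTS.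
  move=> z [z1 z2]; split => //; move: z2; rewrite /= !in_itv/= => /andP[t1 ->].
  rewrite andbT (le_lt_trans _ t1)// lerN2 ge0_ler_powR ?nnegrE ?(ltW r0) ?(ltW r20)//.
  by rewrite ler_peMl ?ler1n// ltW.
apply: le_trans (bound e r _ e0 rr hf) _.
rewrite le_eqVlt; apply/orP; left; apply/eqP; congr ((_ * _)%:E).
rewrite -/q /e /del; field; rewrite (gt_eqF M0) (gt_eqF p20) (gt_eqF q0)//.
Qed.
End time_derivative.

(** * The scaled quantities *)

(** The integral of a nonnegative function is a supremum over simple functions below it, so no
    measurability is required. The integrands of the scaled quantities can thus be compared directly
    with cut-off components. *)
Lemma ge0_le_integral_sub d (T : measurableType d) (R : realType)
    (mu : {measure set T -> \bar R}) (A B : set T) (f g : T -> \bar R) :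
  A `<=` B -> (forall x, B x -> (0 <= g x)%E) -> (forall x, A x -> (0 <= f x <= g x)%E) ->
  (\int[mu]_(x in A) f x <= \int[mu]_(x in B) g x)%E.
Proof.
move=> AB g0 fg; rewrite !ge0_integralE//; last by move=> x /fg/andP[].
apply: le_ereal_sup => _ [h hf <-]; exists h => // x; apply: (le_trans (hf x)).
rewrite !patchE; case: ifPn => [|_].
  by rewrite inE => xA; rewrite mem_set; [have /andP[] := fg x xA|exact: AB].
by case: ifPn => //; rewrite inE => /g0.
Qed.

Section euclidean_norms.
Variable R : realType.

Lemma normr_le_enorm (I : finType) (a : I -> R) i : `|a i| <= enorm a.
Proof.
rewrite -(sqrtr_sqr (a i)) ler_wsqrtr// (bigD1 i)//= lerDl sumr_ge0// => j _.
exact: sqr_ge0.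
Qed.

(** The Euclidean norm is at most the sum of the |a_i|, hence 3 times their maximum, and the cube of
    the maximum is one of the summands: 27 = 3^3. *)
Lemma enorm3_cube (a : 'I_3 -> R) : enorm a ^+ 3 <= 27 * \sum_i `|a i| ^+ 3.
Proof.
pose A := `|a ord0| + `|a (lift ord0 ord0)| + `|a (lift ord0 (lift ord0 ord0))|.
have eA : enorm a <= A.
  rewrite -[leRHS](@ger0_norm _ A) ?addr_ge0// -(sqrtr_sqr A) ler_sqrt ?sqr_ge0// !big_ord_recl big_ord0 addr0.
  rewrite -(real_normK (num_real (a ord0))) -(real_normK (num_real (a (lift ord0 ord0)))).
  rewrite -(real_normK (num_real (a (lift ord0 (lift ord0 ord0))))) /A.
  move: (normr_ge0 (a ord0)) (normr_ge0 (a (lift ord0 ord0))) (normr_ge0 (a (lift ord0 (lift ord0 ord0)))).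
  by move: `|_| `|_| `|_| => x y z *; nra.
apply: (@le_trans _ _ (A ^+ 3)); first by rewrite lerXn2r ?nnegrE ?sqrtr_ge0// !addr_ge0.
rewrite !big_ord_recl big_ord0 addr0 /A.
move: (normr_ge0 (a ord0)) (normr_ge0 (a (lift ord0 ord0))) (normr_ge0 (a (lift ord0 (lift ord0 ord0)))).
move: `|_| `|_| `|_| => x y z x0 y0 z0.
have cube (b c : R) : 0 <= b -> b <= c -> b ^+ 3 <= c ^+ 3.
  by move=> b0 bc; rewrite lerXn2r ?nnegrE// (le_trans b0).
pose M := Num.max x (Num.max y z).
have [xM yM zM] : [/\ x <= M, y <= M & z <= M] by rewrite /M !le_max !lexx !orbT.
apply: (@le_trans _ _ ((3 * M) ^+ 3)); first by apply: cube; [rewrite !addr_ge0|lra].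
rewrite exprMn (_ : 3 ^+ 3 = 27); last by ring.
rewrite ler_wpM2l//.
have [x3 y3 z3] : [/\ 0 <= x ^+ 3, 0 <= y ^+ 3 & 0 <= z ^+ 3] by split; exact: exprn_ge0.
have [->|[->|->]] : M = x \/ M = y \/ M = z.
- by rewrite /M; case: (leP y z) => _; case: (leP x _) => _; tauto.
- lra.
- lra.
- lra.
Qed.

Lemma sball_scube (r : R) : sball r `<=` @scube R r.
Proof.
move=> x; rewrite /sball/= /snorm => h.
have w (a : R) : a ^+ 2 <= x.1.1 ^+ 2 + x.1.2 ^+ 2 + x.2 ^+ 2 -> - r < a < r.
  by move=> ha; rewrite -ltr_norml (le_lt_trans _ h)// -(sqrtr_sqr a) ler_wsqrtr.
split; apply: w; first by rewrite -addrA lerDl addr_ge0 ?sqr_ge0.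
  by rewrite addrAC lerDr addr_ge0 ?sqr_ge0.
by rewrite lerDr addr_ge0 ?sqr_ge0.
Qed.

(** The diagonal gives sqrt 3, which is below 2. *)
Lemma scube_sball (r : R) : 0 < r -> @scube R r `<=` sball (2 * r).
Proof.
move=> r0 x [c1 c2 c3]; rewrite /sball/= /snorm.
have w (a : R) : - r < a < r -> a ^+ 2 < r ^+ 2.
  by move=> /andP[? ?]; rewrite -subr_gt0 subr_sqr mulr_gt0// ?subr_gt0// -ltrBlDl sub0r.
rewrite -[ltRHS]ger0_norm ?mulr_ge0 ?(ltW r0)// -sqrtr_sqr ltr_sqrt; last first.
  by rewrite exprn_gt0// mulr_gt0.
apply: lt_le_trans (ltrD (ltrD (w _ c1) (w _ c2)) (w _ c3)) _.
by rewrite exprMn; have := sqr_ge0 r; lra.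
Qed.

End euclidean_norms.

Section extraction.
Variable R : realType.
Local Notation V := (spacetime R).
Local Notation mV := (mspacetime R).
Local Notation mR := (measurableTypeR R).
Local Notation leb := (@lebesgue_measure R).
Implicit Types (r m B : R).

Lemma normr_cut_le (f : V -> R) (z : mV) : `|cut f z| <= `|f z|.
Proof. by rewrite /cut patchE; case: ifP => // _; rewrite normr0. Qed.

(** As m < 1 and r <= 1, r^(3-m) <= r^2: the short slabs lie in parabolic cylinders. *)
Lemma window_sub m r (rho : R) : m < 1 -> 0 < r <= rho -> rho <= 1 ->
  `](- r `^ (3 - m)), 0[%classic `<=` (`](- rho ^+ 2), 0[%classic : set mR).
Proof.
move=> m1 /andP[r0 rr] rho1 t; rewrite /= !in_itv/= => /andP[h ->]; rewrite andbT.
apply: le_lt_trans h; rewrite lerN2 -powR_mulrn; last exact: le_trans (ltW r0) rr.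
apply: (@le_trans _ _ (r `^ 2)).
  by apply: ger_powR; [rewrite r0 (le_trans rr)|lra].
by rewrite ge0_ler_powR// nnegrE ?(ltW r0)// (le_trans (ltW r0)).
Qed.

Local Open Scope ereal_scope.

Lemma slab_cylinder m r : (m < 1)%R -> (0 < r)%R -> (4 * r <= 1)%R ->
  slab (2 * r) (r `^ (3 - m)) `<=` cylinder (4 * r).
Proof.
move=> m1 r0 r4 z [z1 z2]; split.
  have := scube_sball (mulr_gt0 (ltr0n _ 2) r0) z1.
  by rewrite (_ : 2 * (2 * r) = 4 * r)%R//; ring.
apply: (window_sub m1 _ r4) z2; rewrite r0/= ler_peMl ?(ltW r0)//; exact: ler1n.
Qed.

(** Radius 4r: the energy lives on the cube of half side 2r, which lies in the ball of twice that
    radius. *)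
Lemma qE_energy m gv r B i j : (m < 1)%R -> (0 < r)%R -> (4 * r <= 1)%R ->
  qE m gv (4 * r) <= B%:E -> energy r (r `^ (3 - m)) (gv i j) <= (B * (4 * r) `^ m)%:E.
Proof.
move=> m1 r0 r4; have p0 : (0 < (4 * r) `^ m)%R by rewrite powR_gt0// mulr_gt0.
rewrite /qE muleC lee_pdivrMr// -EFinM; apply: le_trans; rewrite /energy.
apply: ge0_le_integral_sub => [|z _|z _]; first exact: slab_cylinder.
  by rewrite lee_fin sqr_ge0.
rewrite !lee_fin sqr_ge0/= -real_normK ?num_real// lerXn2r ?nnegrE ?sqrtr_ge0//.
exact: le_trans (normr_cut_le _ _) (normr_le_enorm (fun ij : 'I_3 * 'I_3 => gv ij.1 ij.2 z) (i, j)).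
Qed.

Lemma qA_slices m m1 v r B i : (m < 1)%R -> (0 < r)%R -> (4 * r <= 1)%R ->
  qA m1 v (4 * r) <= B%:E -> {ae leb, forall t : mR, (- r `^ (3 - m) < t < 0)%R ->
    \int[leb3 R]_(x in scube (2 * r)) (cut (v i) (x, t) ^+ 2)%:E <= (B * (4 * r) `^ m1)%:E}.
Proof.
move=> m_lt1 r0 r4; have p0 : (0 < (4 * r) `^ m1)%R by rewrite powR_gt0// mulr_gt0.
rewrite /qA; set k := (X in ess_sup _ X) => hB.
have := ess_sup_ge (@lebesgue_measure R) k; apply: filterS => t kt ht.
have tJ : (t \in (`](- (4 * r) ^+ 2)%R, 0%R[%classic : set mR)).
  rewrite inE; apply: (@window_sub m r (4 * r) m_lt1 _ r4 t); last by rewrite /= in_itv.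
  by rewrite r0/= ler_peMl ?(ltW r0)//; exact: ler1n.
have := le_trans kt hB; rewrite /k patchE tJ muleC lee_pdivrMr// -EFinM; apply: le_trans.
apply: ge0_le_integral_sub => [x xs|x _|x _].
- by have := scube_sball (mulr_gt0 (ltr0n _ 2) r0) xs; rewrite (_ : 2 * (2 * r) = 4 * r)%R//; ring.
- by rewrite lee_fin sqr_ge0.
rewrite !lee_fin sqr_ge0/= -real_normK ?num_real// lerXn2r ?nnegrE ?sqrtr_ge0//.
exact: le_trans (normr_cut_le _ _) (normr_le_enorm (fun i => v i (x, t)) i).
Qed.

Lemma qN_slices m s1 l1 hv dtv r B i : (m < 1)%R -> (0 < s1)%R -> (0 < l1)%R ->
  (0 < r)%R -> (2 * r <= 1)%R -> qN m s1 l1 hv dtv (2 * r) <= B%:E ->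
  \int[leb]_(t in `](- r `^ (3 - m))%R, 0%R[)
    (\int[leb3 R]_(x in scube r) (`|cut (dtv i) (x, t)| `^ s1)%:E) `^ (l1 / s1) <=
  (B * (2 * r) `^ (gamma_star s1 m * l1))%:E.
Proof.
move=> m_lt1 s10 l10 r0 r2.
have p0 : (0 < (2 * r) `^ (gamma_star s1 m * l1))%R by rewrite powR_gt0// mulr_gt0.
rewrite /qN muleC lee_pdivrMr// -EFinM; apply: le_trans.
have rr : (0 < r <= 2 * r)%R by rewrite r0/= ler_peMl ?(ltW r0)//; exact: ler1n.
apply: ge0_le_integral_sub => [|t _|t _]; [exact: window_sub|exact: poweR_ge0|].
rewrite poweR_ge0/=; apply: gt0_ler_poweR.
- by rewrite divr_ge0// ltW.
- by rewrite in_itv/= leey andbT; apply: integral_ge0 => x _; rewrite lee_fin powR_ge0.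
- by rewrite in_itv/= leey andbT; apply: integral_ge0 => x _; rewrite lee_fin addr_ge0 ?powR_ge0.
apply: ge0_le_integral_sub => [|x _|x _]; [exact: scube_sball| |].
  by rewrite lee_fin addr_ge0 ?powR_ge0.
rewrite !lee_fin powR_ge0/= (@le_trans _ _ (speed dtv (x, t) `^ s1)%R)//; last first.
  by rewrite lerDr powR_ge0.
rewrite ge0_ler_powR ?nnegrE ?(ltW s10) ?sqrtr_ge0//.
exact: le_trans (normr_cut_le _ _) (normr_le_enorm (fun i => dtv i (x, t)) i).
Qed.
End extraction.

Section mixed_norms.
Variable R : realType.
Local Notation V := (spacetime R).
Local Notation mV := (mspacetime R).
Local Notation mR := (measurableTypeR R).
Local Notation leb := (@lebesgue_measure R).

Lemma measurable_sball (r : R) : 0 < r -> measurable (sball r : set (mspace R)).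
Proof.
move=> r0; pose g (x : mspace R) : R := (x.1.1 : R) ^+ 2 + (x.1.2 : R) ^+ 2 + (x.2 : R) ^+ 2.
have mg : measurable_fun setT g.
  have m11 : measurable_fun setT (fun x : mspace R => x.1.1).
    exact: (measurableT_comp measurable_fst measurable_fst).
  have m12 : measurable_fun setT (fun x : mspace R => x.1.2).
    exact: (measurableT_comp measurable_snd measurable_fst).
  have m2 : measurable_fun setT (fun x : mspace R => x.2) by exact: measurable_snd.
  apply: measurable_funD; first apply: measurable_funD; exact: measurable_funX.
have mI : measurable (`]-oo, (r ^+ 2)[%classic : set R) by exact: measurable_itv.
have := mg measurableT _ mI; rewrite setTI; congr measurable.
have E a : (Num.sqrt a < r) = (a < r ^+ 2).
  by rewrite -{1}(ger0_norm (ltW r0)) -sqrtr_sqr ltr_sqrt// exprn_gt0.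
by apply/seteqP; split=> x /=; rewrite in_itv/= /sball /snorm /= E.
Qed.

Local Open Scope ereal_scope.

Lemma lebesgue_measure_setT_gt0 : 0 < leb [set: mR].
Proof.
apply: (@lt_le_trans _ _ (leb (`](- 1)%R, 0%R[%classic : set mR))).
  by rewrite lebesgue_measure_window// lte_fin.
by apply: le_measure; rewrite ?inE//; exact: measurable_itv.
Qed.

Lemma mixed_slab_small (f : V -> R) (m l eta : R) (s : \bar R) :
  (m < 1)%R -> 1 <= s -> (1 <= l)%R ->
  (3 * (1 - fine s^-1) + (3 - m) * (1 - l^-1) = 4)%R ->
  mem_mixed (leb3 R) leb s l%:E (sball 1) `](-1)%R, 0%R[ f -> (0 < eta)%R ->
  exists2 d : R, (0 < d)%R & forall r : R, (0 < r <= d)%R ->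
    \int[leb4 R]_(z in slab r (r `^ (3 - m))) `|cut f z|%:E <= (eta * r ^+ 4)%:E.
Proof.
move=> m1 s1 l1 expo [mf nf] eta0.
pose J : set mR := `](-1)%R, 0%R[%classic.
pose D : set mV := (sball 1 : set (mspace R)) `*` J.
have mD : measurable D.
  by apply: measurableX; [exact: measurable_sball|exact: measurable_itv].
pose F : mV -> R := f \_ D.
have mF : measurable_fun setT F by apply/(measurable_restrictT _ mD).
have l0 : (0 < l)%R := lt_le_trans ltr01 l1.
have be0 : (0 < 3 - m)%R by rewrite subr_gt0 (lt_trans m1)// ltr1n.
have nE (t : mR) : ((fun t => 'N[leb3 R]_s[(fun x => (f (x, t))%:E) \_ (sball 1)]) \_ J) t =
    'N[leb3 R]_s[(fun x => (F (x, t))%:E)].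
  rewrite patchE; case: ifPn => tJ.
    rewrite inE in tJ; congr Lnorm; apply/funext => x; rewrite /F !patchE.
    case: ifPn => xb; first by rewrite mem_set//; split=> //; rewrite inE in xb.
    by rewrite memNset// => -[xb' _]; move/negP: xb; apply; rewrite inE.
  rewrite (_ : (fun x => (F (x, t))%:E) = cst 0).
    by rewrite Lnorm0// gt_eqF// (lt_le_trans _ s1).
  apply/funext => x; rewrite /F patchE memNset// => -[_ tJ'].
  by move/negP: tJ; apply; rewrite inE.
have hn : \int[leb]_t 'N[leb3 R]_s[(fun x => (F (x, t))%:E)] `^ l < +oo.
  have li0 : (l^-1 != 0)%R by rewrite gt_eqF// invr_gt0.
  move: nf; set k := (X in 'N[_]_ _[X]) => nf.
  rewrite unlock in nf; move: nf => /(lty_poweRy li0); congr (_ < _); apply: eq_integral => t _.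
  transitivity (k t `^ l); last by congr (_ `^ _); exact: nE.
  by rewrite gee0_abs// /k patchE; case: ifP => // _; exact: Lnorm_ge0.
have [d d0 hd] := slab_small_finite mF s1 l1 be0 expo hn eta0.
exists (Num.min 2^-1 d)%R; first by rewrite lt_min invr_gt0 ltr0n.
move=> r; rewrite le_min => /and3P[r0 rh rd].
have r1 : (r <= 1)%R by apply: (le_trans rh); rewrite invf_le1// ler1n.
have T1 : (r `^ (3 - m) <= 1)%R by rewrite powR_le1 ?(ltW r0) ?(ltW be0).
apply: le_trans (hd r _); last by rewrite r0.
rewrite le_eqVlt; apply/orP; left; apply/eqP; apply: eq_integral => z.
rewrite inE => zs; have zb := slab_box1 rh T1 zs; rewrite (cutE _ zb) /F patchE mem_set//.
have [z1 z2] := box1_cylinder zb; split => //.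
by move: z2; rewrite expr1n.
Qed.

Lemma mixed_slices (f : V -> R) (s : R) : (1 <= s)%R ->
  mem_mixed (leb3 R) leb s%:E +oo (sball 1) `](-1)%R, 0%R[ f ->
  exists2 N : R, (0 <= N)%R & {ae leb, forall t : mR, (- 1 < t < 0)%R ->
    \int[leb3 R]_(x in scube 2^-1) (`|cut f (x, t)| `^ s)%:E <= N%:E}.
Proof.
move=> s1 [_]; set k := (X in 'N[_]_ _[X]).
have s0 : (0 < s)%R := lt_le_trans ltr01 s1.
have leb0 := lebesgue_measure_setT_gt0.
rewrite unlock leb0; set E := ess_sup _ _ => Efin.
have E0 : 0 <= E by apply: ess_sup_gee => //; apply: nearW => t /=.
have EE : E = (fine E)%:E by rewrite fineK// ge0_fin_numE.
exists (fine E `^ s)%R; first exact: powR_ge0.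
have := ess_sup_ge leb (abse \o k); apply: filterS => t kt ht.
have tJ : (t \in (`](-1)%R, 0%R[%classic : set R)) by rewrite inE /= in_itv.
move: kt; rewrite /= -/E /k patchE tJ gee0_abs ?Lnorm_ge0// => kt.
have : 'N[leb3 R]_s%:E[(fun x => (f (x, t))%:E) \_ (sball 1)] `^ s <= E `^ s.
  apply: gt0_ler_poweR => //; first exact: ltW.
    by rewrite in_itv/= leey Lnorm_ge0.
  by rewrite in_itv/= leey E0.
rewrite -poweR_EFin -EE; apply: le_trans.
rewrite unlock -poweRrM mulVf ?gt_eqF// poweRe1; last first.
  by apply: integral_ge0 => x _; exact: poweR_ge0.
apply: ge0_le_integral_sub => // [x _|x xc]; first exact: poweR_ge0.
rewrite lee_fin powR_ge0/= patchE mem_set; last first.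
  by have := @scube_sball R 2^-1 (_ : 0 < 2^-1)%R x xc; rewrite mulfV//; apply; rewrite invr_gt0.
rewrite poweR_EFin lee_fin ge0_ler_powR ?nnegrE ?(ltW s0)//; exact: normr_cut_le.
Qed.

(** The ball is enlarged to the cube and the speed is bounded by its components; on small slabs
    [cut] changes nothing. *)
Lemma qM_cvg0 (m : R) (v : 'I_3 -> V -> R) : (m < 1)%R ->
  (forall i, measurable_fun setT (cut (v i))) ->
  (forall i (eta : R), (0 < eta)%R -> exists2 d : R, (0 < d)%R & forall r : R, (0 < r <= d)%R ->
    \int[leb4 R]_(z in slab r (r `^ (3 - m))) (`|cut (v i) z| ^+ 3)%:E <= (eta * r `^ (2 * m))%:E) ->
  qM m v r @[r --> (0%R : R)^'+] --> 0.
Proof.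
move=> m1 mv hv.
have key (e : R) : (0 < e)%R -> \forall r \near (0%R : R)^'+, 0 <= qM m v r <= e%:E.
  (* 81 = 27 times 3: the constant of [enorm3_cube] and the three components. *)
  move=> e0; pose eta : R := (e / 81)%R; have eta0 : (0 < eta)%R by rewrite divr_gt0.
  have /choice[d hd0] (i : 'I_3) : exists x : R, (0 < x)%R /\ forall r : R, (0 < r <= x)%R ->
      \int[leb4 R]_(z in slab r (r `^ (3 - m))) (`|cut (v i) z| ^+ 3)%:E <= (eta * r `^ (2 * m))%:E.
    by have [x x0 hx] := hv i eta eta0; exists x.
  have d0 i : (0 < d i)%R by have [] := hd0 i.
  have hd i := (hd0 i).2.
  pose dd : R := (Num.min 2^-1 (\big[Num.min/1]_(i < 3) d i))%R.
  have dd0 : (0 < dd)%R.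
    by rewrite lt_min invr_gt0 ltr0n/=; apply: (big_ind (fun y : R => 0 < y)%R) => // x y x0 y0; rewrite lt_min x0.
  near=> r.
  have r0 : (0 < r)%R by near: r; exact: nbhs_right_gt.
  have rd : (r < dd)%R by near: r; exact: nbhs_right_lt.
  have rh : (r <= 2^-1)%R by apply: ltW; apply: lt_le_trans rd _; rewrite ge_min lexx.
  have rdi i : (0 < r <= d i)%R.
    rewrite r0/=; apply: ltW; apply: lt_le_trans rd _; rewrite ge_min; apply/orP; right.
    exact: bigmin_le_cond.
  have r1 : (r <= 1)%R by apply: (le_trans rh); rewrite invf_le1// ler1n.
  have T1 : (r `^ (3 - m) <= 1)%R.
    by rewrite powR_le1 ?(ltW r0)// subr_ge0 (le_trans (ltW m1))// ler1n.
  have sp0 (z : V) : 0 <= (speed v z ^+ 3)%:E by rewrite lee_fin exprn_ge0// sqrtr_ge0.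
  have p0 : (0 < r `^ (- (2 * m)))%R by exact: powR_gt0.
  apply/andP; split.
    by rewrite /qM mule_ge0 ?lee_fin ?(ltW p0)//; apply: integral_ge0.
  pose S := slab r (r `^ (3 - m)).
  have mS : measurable S by apply: measurableX => //; exact: measurable_scube.
  have m3 i : measurable_fun S (fun z => (`|cut (v i) z| ^+ 3)%:E).
    apply: measurable_funTS; apply/measurable_EFinP; apply: measurable_funX.
    exact: measurableT_comp.
  have q3 i z : S z -> 0 <= (`|cut (v i) z| ^+ 3)%:E by rewrite lee_fin exprn_ge0.
  have I : \int[leb4 R]_(z in sball r `*` `](- (r `^ (3 - m)))%R, 0%R[) (speed v z ^+ 3)%:E <=
      27%:E * \sum_(i < 3) \int[leb4 R]_(z in S) (`|cut (v i) z| ^+ 3)%:E.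
    rewrite -(ge0_integral_sum (leb4 R) mS m3 q3).
    have ms : measurable_fun S (fun z => \sum_(i < 3) (`|cut (v i) z| ^+ 3)%:E).
      by apply: emeasurable_sum => i; exact: m3.
    have qs z : S z -> 0 <= \sum_(i < 3) (`|cut (v i) z| ^+ 3)%:E.
      by move=> zS; apply: sume_ge0 => i _; exact: q3.
    rewrite -(ge0_integralZl (leb4 R) mS ms qs)//.
    have sub : sball r `*` `](- (r `^ (3 - m)))%R, 0%R[ `<=` S.
      by move=> z [z1 z2]; split => //; exact: sball_scube.
    apply: ge0_le_integral_sub => // [z zS|z /sub zS]; first by rewrite mule_ge0// qs.
    rewrite sp0/= sumEFin -EFinM lee_fin.
    have zb := slab_box1 rh T1 zS.
    apply: le_trans (enorm3_cube (fun i => v i z)) _.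
    by rewrite ler_wpM2l// ler_sum// => i _; rewrite (cutE _ zb).
  rewrite /qM muleC -lee_pdivlMr//; apply: le_trans I _.
  apply: (@le_trans _ _ (27%:E * \sum_(i < 3) (eta * r `^ (2 * m))%:E)).
    by rewrite lee_wpmul2l// lee_sum// => i _; exact: hd.
  rewrite sumEFin -!EFinM lee_fin sumr_const card_ord powRN invrK /eta.
  by rewrite -mulr_natr le_eqVlt; apply/orP; left; apply/eqP; field.
apply/fine_cvgP; split.
  near=> r; have /andP[h0 h1] : 0 <= qM m v r <= 1%:E by near: r; exact: key.
  by rewrite ge0_fin_numE// (le_lt_trans h1)// ltry.
apply/cvgrPdist_le => e e0; near=> r.
have /andP[h0 h1] : 0 <= qM m v r <= e%:E by near: r; exact: key.
rewrite sub0r normrN /= ger0_norm ?fine_ge0// -lee_fin fineK// ge0_fin_numE//.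
by rewrite (le_lt_trans h1)// ltry.
Unshelve. all: by end_near. Qed.
End mixed_norms.

Section scaled_bounds.
Variable R : realType.
Local Open Scope ereal_scope.

Lemma ereal_sup_lty_bound (P : set R) (F : R -> \bar R) :
  ereal_sup [set F r | r in P] < +oo ->
  exists2 B : R, (0 < B)%R & forall r, P r -> F r <= B%:E.
Proof.
set S := ereal_sup _ => Sy; exists (Num.max (fine S) 1)%R; first by rewrite lt_max ltr01 orbT.
move=> r Pr; have : F r <= S by apply: ereal_sup_ubound; exists r.
move: Sy; case: S => [s| |]//= _; last by rewrite leeNy_eq => /eqP ->; exact: leNye.
by move=> /le_trans; apply; rewrite lee_fin le_max lexx.
Qed.

Lemma qA_ge0 (m1 : R) v r : 0 <= qA m1 v r.
Proof.
apply: ess_sup_gee; first exact: lebesgue_measure_setT_gt0.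
apply: nearW => t; rewrite patchE; case: ifP => // _.
by rewrite mule_ge0 ?lee_fin ?invr_ge0 ?powR_ge0//; apply: integral_ge0 => x _; rewrite lee_fin sqr_ge0.
Qed.

Lemma qE_ge0 (m : R) gv r : 0 <= qE m gv r.
Proof.
by rewrite mule_ge0 ?lee_fin ?invr_ge0 ?powR_ge0//; apply: integral_ge0 => x _; rewrite lee_fin sqr_ge0.
Qed.

Lemma qD_ge0 (m : R) q r : 0 <= qD m q r.
Proof.
by rewrite mule_ge0 ?lee_fin ?invr_ge0 ?powR_ge0//; apply: integral_ge0 => x _; rewrite lee_fin powR_ge0.
Qed.
End scaled_bounds.

Theorem theorem5p1 (R : realType)
    (v : 'I_3 -> spacetime R -> R) (q : spacetime R -> R)
    (hvL3 : forall i, mem_L (leb4 R) 3%:E (cylinder 1) (v i))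
    (hqL32 : mem_L (leb4 R) (3 / 2)%:E (cylinder 1) q)
    (hNS : navier_stokes (cylinder 1) v q)
    (r1 : R) (hr1 : 0 < r1 < 1)
    (hbounded : forall a : R, 0 < a < 1 -> forall i,
       mem_L (leb4 R) +oo%E
         ((sball 1 `*` `](-1), (- a ^+ 2)[)
          `|` ([set x | r1 < snorm x < 1] `*` `](-1), 0[)) (v i))
    (gv : 'I_3 -> 'I_3 -> spacetime R -> R)
    (hgv : forall i j, weak_derivative (cylinder 1) (dir_x R j) (v i) (gv i j))
    (hv : 'I_3 -> 'I_3 -> 'I_3 -> spacetime R -> R)
    (hhv : forall i j k,
       weak_derivative (cylinder 1) (dir_x R k) (gv i j) (hv i j k))
    (dtv : 'I_3 -> spacetime R -> R)
    (hdtv : forall i, weak_derivative (cylinder 1) (dir_t R) (v i) (dtv i))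
    (m m1 : R) (hm : 1 / 2 <= m < 1) (hm1 : m1 = 2 * m - 1)
    (hM1 : (ereal_sup [set qA m1 v r + qE m gv r + qD m q r
                      | r in [set r : R | (0 < r < 1)%R]] < +oo)%E)
    (s1 l1 : R) (hs1 : 1 < s1) (hl1 : 1 < l1) (hs1l1 : 3 / s1 + 2 / l1 = 4)
    (hM2 : (ereal_sup [set qN m s1 l1 hv dtv r
                      | r in [set r : R | (0 < r < 1)%R]] < +oo)%E)
    (alpha : R) (halpha : alpha = 2 - m)
    (s2 l2 : \bar R) (hs2 : (1 <= s2)%E) (hl2 : (1 <= l2)%E)
    (hs2l2 : (3%:E * s2^-1 + (alpha + 1)%:E * l2^-1 = alpha%:E)%E)
    (hv_mixed : forall i,
       mem_mixed (leb3 R) (@lebesgue_measure R) s2 l2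
         (sball 1) `](-1), 0[ (v i))
    (hcont : m = 1 / 2 -> l2 = +oo%E ->
       exists delta1 : R, 0 < delta1 <= 1 /\ mem_CL2 delta1 v) :
  qM m v r @[r --> 0^'+] --> 0%E.
Proof.
have [mh m_lt1] := andP hm.
have m0 : 0 <= m by apply: le_trans mh; rewrite divr_ge0.
have [B B0 hB] := ereal_sup_lty_bound hM1; have [N N0 hN] := ereal_sup_lty_bound hM2.
have [hA hE] : (forall r, 0 < r < 1 -> (qA m1 v r <= B%:E)%E) /\
    (forall r, 0 < r < 1 -> (qE m gv r <= B%:E)%E).
  by split=> r /hB; apply: le_trans; rewrite -addeA ?leeDl ?adde_ge0 ?qE_ge0 ?qD_ge0//
    addeCA leeDl// adde_ge0 ?qA_ge0 ?qD_ge0.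
have s10 : 0 < s1 := lt_trans ltr01 hs1.
have l10 : 0 < l1 := lt_trans ltr01 hl1.
have h1 i (eta : R) : 0 < eta -> exists2 d : R, 0 < d & forall r, 0 < r <= d ->
    (\int[leb4 R]_(z in slab r (r `^ (3 - m))) `|cut (v i) z|%:E <= (eta * r ^+ 4)%:E)%E.
  move=> eta0; have hvi := hv_mixed i; clear hcont hv_mixed; move: hl2 hs2l2 hvi; case: l2 => [l| |]//.
    rewrite lee_fin => hl hsl hvi.
    have l0 : 0 < l := lt_le_trans ltr01 hl.
    have s2i : (s2^-1 = (fine s2^-1)%:E)%E.
      move: hs2; case: (s2) => [s| |]// hs.
      by rewrite inver gt_eqF// (lt_le_trans ltr01).
    apply: (mixed_slab_small m_lt1 hs2 hl _ hvi eta0).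
    (* As 3 - m = alpha + 1, the exponent is 6 - m minus the left side of the relation on [s2] and
       [l2], that is 6 - m - alpha = 4. *)
    rewrite s2i inver (gt_eqF l0) -!EFinM -EFinD in hsl; case: hsl => hsl.
    rewrite [LHS](_ : _ = 6 - m - (3 * fine (s2^-1)%E + (2 - m + 1) * l^-1)); last by ring.
    by rewrite -halpha hsl halpha; ring.
  (* Now [l2] is infinite and 3 / s2 = alpha. An infinite [s2] would force alpha = 0, whereas alpha
     = 2 - m > 1. *)
  move=> _; rewrite invey mule0 adde0; move: hs2; case: (s2) => [s| |]//; last first.
    by rewrite invey mule0 => _ [] /esym/eqP; rewrite halpha gt_eqF// subr_gt0 (lt_trans m_lt1)// ltr1n.
  rewrite lee_fin => s_ge1; have s0 : 0 < s := lt_le_trans ltr01 s_ge1.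
  rewrite inver (gt_eqF s0) -EFinM => -[hs] hvi.
  have [K K0 hK] := mixed_slices s_ge1 hvi.
  (* The power of 2 comes from using [qN] at radius 2r, whose ball contains the cube of half side
     r. *)
  have N20 : 0 <= N * 2 `^ (gamma_star s1 m * l1) by rewrite mulr_ge0 ?powR_ge0// ltW.
  apply: (slab_small_sup (@box1_cylinder R) (hdtv i) m_lt1 s_ge1 _ (ltW hs1) (ltW hl1) hs1l1 K0 N20 hK _ eta0).
    by rewrite -halpha -hs mulfVK// gt_eqF.
  move=> r /andP[r0 r4]; rewrite -mulrA -powRM ?(ltW r0)//.
  have r2 : 2 * r < 1 by lra.
  by apply: (qN_slices i m_lt1 s10 l10 r0 (ltW r2)); apply: hN; rewrite /= r2 mulr_gt0.
apply: qM_cvg0 => // i; first by have [lf _ _] := hdtv i; exact: (measurable_cut lf (@box1_cylinder R)).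
move=> eta eta0; have M0 : 0 < 4 * B by rewrite mulr_gt0.
(* The exponents m and 2m - 1 are at most 1, so the factor 4^p due to radius 4r is at most 4; hence
   the common bound 4 B. *)
have p4 (p r : R) : p <= 1 -> 0 < r -> B * (4 * r) `^ p <= 4 * B * r `^ p.
  move=> p1 r0; rewrite powRM ?(ltW r0)// mulrA ler_wpM2r ?powR_ge0// mulrC ler_wpM2r ?(ltW B0)//.
  by rewrite -[leRHS]powRr1// ler_powR// ler1n.
apply: (slab_cube_small (@box1_cylinder R) (hgv i _) (hgv i _) (hgv i _) _ M0 _ _ (h1 i) eta0).
- by rewrite m0.
- move=> r /andP[r0 r8]; have r4 : 4 * r < 1 by lra.
  have rr : 0 < 4 * r < 1 by rewrite r4 mulr_gt0.
  apply: filterS (qA_slices i m_lt1 r0 (ltW r4) (hA _ rr)) => t ht /ht/le_trans; apply.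
  by rewrite lee_fin hm1; apply: p4 => //; lra.
- move=> r /andP[r0 r8]; have r4 : 4 * r < 1 by lra.
  have rr : 0 < 4 * r < 1 by rewrite r4 mulr_gt0.
  by split; apply: le_trans (qE_energy i _ m_lt1 r0 (ltW r4) (hE _ rr)) _; rewrite lee_fin p4// ltW.
Qed.
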